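(* Let $\vec\xi=(\theta,v,u,w)$ with $\theta\in J_N$ and $v\in A,u\in B,w\in C$ homogeneous, let $\alpha\in V$ be homogeneous with $\mathrm{wt}(\alpha)\ge1$, and let $x_0\ne0\ne y_0$. Then: (1) $G^{A(BC):y}_{h,k}(\vec\xi;x_0,y)$ is a linear combination of $\{G^{A(BC):y}_{h,k}(\vec\mu;x_0,y)\mid\vec\mu\in\mathcal J^0_N\}$ with coefficients in $\mathbb C[\iota_{x_0,y}\{(x_0-y)^{-1}\}][y]\subseteq\mathbb C[[y]]$. (2) $G^{A(BC):x-y}_{h,k}(\vec\xi;x,y_0)$ is a linear combination of $\{G^{A(BC):x-y}_{h,k}(\vec\mu;x,y_0)\mid\vec\mu\in\mathcal J^0_N\}$ with coefficients in $\mathbb C[x,\iota_{y_0,x-y_0}\{x^{-1}\}][x-y_0]\subseteq\mathbb C[[x-y_0]]$. Furthermore, for the residue classes of the coefficients modulo $\mathbb C[[x-y_0]](x-y_0)$, respectively $\mathbb C[[y]]y$, one has $$G_{h,k}^{A(BC):x-y}(\alpha_{-1}^{[2]}\vec\xi;x,y_0)\equiv\sum_{j\ge0}G_{h,k}^{A(BC):x-y}(\alpha_j^{[3]}\vec\xi;x,y_0)\pmod{\mathbb C[[x-y_0]](x-y_0)},$$ $$G_{h,k}^{A(BC):x-y}(\alpha_{-1}^{[3]}\vec\xi;x,y_0)\equiv\sum_{j\ge0}(-1)^{j+1}G_{h,k}^{A(BC):x-y}(\alpha_j^{[2]}\vec\xi;x,y_0)\pmod{\mathbb C[[x-y_0]](x-y_0)},$$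 $$G_{h,k}^{A(BC):x-y}(\alpha_{-1}^{[4]}\vec\xi;x,y_0)\equiv0\pmod{\mathbb C[[x-y_0]](x-y_0)},$$ $$G_{h,k}^{A(BC):y}(\alpha_{-1}^{[2]}\vec\xi;x_0,y)\equiv0\pmod{\mathbb C[[y]]y},$$ $$G_{h,k}^{A(BC):y}(\alpha_{-1}^{[3]}\vec\xi;x_0,y)\equiv\sum_{j\ge0}G_{h,k}^{A(BC):y}(\alpha_j^{[4]}\vec\xi;x_0,y)\pmod{\mathbb C[[y]]y},$$ $$G_{h,k}^{A(BC):y}(\alpha_{-1}^{[4]}\vec\xi;x_0,y)\equiv-\sum_{j\ge0}(-1)^jG_{h,k}^{A(BC):y}(\alpha_j^{[3]}\vec\xi;x_0,y)\pmod{\mathbb C[[y]]y}.$$ The same results hold for $G^{(AB)C:x-y}_{h,k}(\vec\xi';x,y_0)$ and $G^{(AB)C:y}_{h,k}(\vec\xi';x_0,y)$, upon replacing $A(BC),\vec\xi,\vec\mu,\mathcal J_N,\mathcal J^0_N,\iota_{x,y}$ by $(AB)C,\vec\xi',\vec\mu',\mathcal J'_N,{\mathcal J'}^0_N,\iota_{y,x-y}$, respectively.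
   Context: $V$ is a vertex operator algebra; $\alpha_n$ denotes the modes, $Y(\alpha,z)=\sum\alpha_nz^{-n-1}$. A $V$-module $W$ is $\mathbb N$-gradable if $W=\bigoplus_{m\in\mathbb N}W_{(m)}$ with $\alpha_kW_{(m)}\subseteq W_{(m+\mathrm{wt}(\alpha)-k-1)}$. $W$ is $C_1$-cofinite if $\dim W/C_1(W)<\infty$, $C_1(W)=\mathrm{span}\{\alpha_{-1}w\mid w\in W,\alpha\in V,\mathrm{wt}(\alpha)\ge1\}$. For a $C_1$-cofinite $\mathbb N$-gradable indecomposable $W$ one has $W=\bigoplus_{m\in\mathbb N}W_{d+m}$, $W_d\ne0$ (generalized $L(0)$-eigenspaces, finite dimensional), and one uses the grading $W_{(m)}=W_{d+m}$ (and direct sums of these gradings in general). $\mathrm{gr}(w)=m$ for $w\in W_{(m)}$. $W^\vee=\bigoplus_m\mathrm{Hom}(W_{(m)},\mathbb C)$ is the contragredient module, $\mathrm{gr}(\theta)=m$ for $\theta\in\mathrm{Hom}(W_{(m)},\mathbb C)$, and $W^\vee_{(\le N)}=\bigoplus_{m\le N}\mathrm{Hom}(W_{(m)},\mathbb C)$. A logarithmic intertwining operator of type $\binom{C}{A\ B}$ is a linear assignment $v\mapsto\mathcal Y(v,z)=\sum_{h=0}^K\mathcal Y_h(v,z)\log^h(z)$, $\mathcal Y_h(v,z)=\sum_{s\in\mathbb C}v_{s,h}z^{-s-1}$, $v_{s,h}\in\mathrm{Hom}(B,C)$ (lower truncated), satisfying (I1) $\alpha_m\mathcal Y(v,z)u-\mathcal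 Y(v,z)\alpha_mu=\sum_{j\ge0}\binom mj\mathcal Y(\alpha_jv,z)u\,z^{m-j}$; (I2) $\mathcal Y(\alpha_mv,z)u=\sum_{j\ge0}\binom mj(-1)^j\{\alpha_{m-j}z^j\mathcal Y(v,z)u-(-1)^m\mathcal Y(v,z)\alpha_jz^{m-j}u\}$; (I3) $\mathcal Y(L(-1)v,z)u=\frac{d}{dz}\mathcal Y(v,z)u$. The fusion product $(A\boxtimes B,\mathcal Y^{AB})$ is the universal pair of an $\mathbb N$-gradable module and a logarithmic intertwining operator of type $\binom{A\boxtimes B}{A\ B}$ (every logarithmic intertwining operator from $A,B$ to an $\mathbb N$-gradable module factors uniquely through it by a $V$-homomorphism); for $C_1$-cofinite $\mathbb N$-gradable $A,B$ it exists and is again $C_1$-cofinite $\mathbb N$-gradable. $A,B,C$ are indecomposable $C_1$-cofinite $\mathbb N$-gradable modules, $A(BC)=A\boxtimes(B\boxtimes C)$, $(AB)C=(A\boxtimes B)\boxtimes C$, with fusion operators $\mathcal Y^{A(BC)},\mathcal Y^{BC},\mathcal Y^{(AB)C},\mathcal Y^{AB}$; subscript $h$ (or $k$) means the coefficient of $\log^h$ (or $\log^k$). $\Omega=(A(BC))^\vee\times A\times B\times C$, $\Omega'=((AB)C)^\vee\times A\times B\times C$; quadruples are $\vec\xi=(\theta,v,u,w)\in\Omega$, $\vec\xi'=(\theta',v,u,w)\in\Omega'$; $\Omega_N$ is the subset with $\theta\in(A(BC))^\vee_{(\le N)}$, similarly $\Omega'_N$. $\alpha_n^{[i]}$ is the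 action of $\alpha_n$ on the $i$-th coordinate. $\mathrm{gr}^{234}(\vec\xi)=\mathrm{gr}(v)+\mathrm{gr}(u)+\mathrm{gr}(w)$. Put $G^{A(BC):y}_{h,k}(\vec\xi;x,y)=\langle\theta,\mathcal Y_h^{A(BC)}(v,x)\mathcal Y_k^{BC}(u,y)w\rangle y^{\mathrm{gr}^{234}(\vec\xi)}$, $G^{A(BC):x-y}_{h,k}(\vec\xi;x,y)=\langle\theta,\mathcal Y_h^{A(BC)}(v,x)\mathcal Y_k^{BC}(u,y)w\rangle(x-y)^{\mathrm{gr}^{234}(\vec\xi)}$, $G^{(AB)C:y}_{h,k}(\vec\xi';x,y)=\langle\theta',\mathcal Y_h^{(AB)C}(\mathcal Y_k^{AB}(v,x-y)u,y)w\rangle y^{\mathrm{gr}^{234}(\vec\xi')}$, $G^{(AB)C:x-y}_{h,k}(\vec\xi';x,y)=\langle\theta',\mathcal Y_h^{(AB)C}(\mathcal Y_k^{AB}(v,x-y)u,y)w\rangle(x-y)^{\mathrm{gr}^{234}(\vec\xi')}$, extended linearly in the quadruple. For each $W\in\{A,B,C\}$, $P_W$ is a (finite-dimensional) complement of $C_1(W)$ in $W$ spanned by homogeneous elements and $J_{P_W}$ a homogeneous basis of it; $\tilde P_W\supseteq P_W$ is a finite-dimensional subspace spanned by homogeneous elements with homogeneous basis $J_{\tilde P_W}$. $J_N$ is a homogeneous basis of $(A(BC))^\vee_{(\le N)}$. $\mathcal J_N=J_N\times J_{\tilde P_A}\times J_{\tilde P_B}\times J_{\tilde P_C}$, $\mathcal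 J_N^0=J_N\times J_{P_A}\times J_{P_B}\times J_{P_C}$, with $\mathcal J^0_N\subseteq\mathcal J_N$; $\mathcal J'_N,{\mathcal J'}^0_N$ are the analogues with $((AB)C)^\vee$. $\iota_{x,y}\{(x-y)^s\}=\sum_{j\ge0}\binom sjx^{s-j}(-y)^j$, $\iota_{y,x-y}\{x^s\}=\sum_{j\ge0}\binom sjy^{s-j}(x-y)^j$. The meaning of ''$\equiv$'': the left side equals the right side plus a finite linear combination of functions $G_{h,k}(\vec\nu)$ of the same type ($\vec\nu\in\Omega_N$, resp. $\Omega'_N$) with coefficients in the indicated ideal $\mathbb C[[x-y_0]](x-y_0)$, resp. $\mathbb C[[y]]y$. *)

(* Defs.v *)
From HB Require Import structures.
From mathcomp Require Import all_boot all_order all_algebra.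
From mathcomp Require Import complex.
From mathcomp Require Import all_classical reals sequences exp trigo.

(* Infinite sums below are the finitely supported sums \sum_(i \in A) F i of
   fsbigop; the truncation axioms make every support finite. *)

Set Implicit Arguments.
Unset Strict Implicit.
Unset Printing Implicit Defensive.
Import Order.TTheory GRing.Theory Num.Theory.
Local Open Scope classical_set_scope.
Local Open Scope complex_scope.
Local Open Scope ring_scope.

Section Numbers.
Context {R : realType}.

Definition cexp (z : R[i]) : R[i] :=
  (expR (complex.Re z))%:C * (cos (complex.Im z) +i* sin (complex.Im z)).

(* z ^ s for the branch of the power function given by a logarithm l of z,
   that is, cexp l = z *)
Definition cpow (l s : R[i]) : R[i] := cexp (s * l).

Definition cbinom (s : R[i]) (j : nat) : R[i] :=
  (\prod_(i < j) (s - i%:R)) / (j`!)%:R.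

End Numbers.

Section LinearAlgebra.
Context {R : realType} {E : lmodType R[i]}.

Definition lspan (S : set E) : set E :=
  [set x | exists n (c : 'I_n -> R[i]) (e : 'I_n -> E),
     (forall i, S (e i)) /\ x = \sum_i c i *: e i].

Definition lin_indep (S : set E) : Prop :=
  forall n (c : 'I_n -> R[i]) (e : 'I_n -> E),
    injective e -> (forall i, S (e i)) -> \sum_i c i *: e i = 0 ->
    forall i, c i = 0.

Definition is_basis (S U : set E) : Prop := lin_indep S /\ lspan S = U.

Definition subspace (U : set E) : Prop :=
  U 0 /\ forall (a : R[i]) x y, U x -> U y -> U (a *: x + y).

Definition fin_dim (U : set E) : Prop :=
  exists n (e : 'I_n -> E), U `<=` lspan (range e).

Definition fin_codim (U : set E) : Prop :=
  exists n (e : 'I_n -> E),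
    forall x, exists y z, [/\ lspan (range e) y, U z & x = y + z].

Definition is_complement (P U : set E) : Prop :=
  [/\ subspace P, P `&` U `<=` [set 0] &
      forall x, exists y z, [/\ P y, U z & x = y + z]].

(* A grading E = \bigoplus_m E_(m), given by the projections pr m of E onto
   the pieces E_(m). *)
Definition is_grading (pr : nat -> E -> E) : Prop :=
  [/\ forall m, linear (pr m),
      forall m n x, pr m (pr n x) = if m == n then pr n x else 0 &
      forall x, exists M : nat,
        (forall m, (M <= m)%N -> pr m x = 0) /\ x = \sum_(m < M) pr m x].

Definition piece (pr : nat -> E -> E) (m : nat) : set E :=
  [set x | pr m x = x].

Definition homogeneous (pr : nat -> E -> E) : set E :=
  \bigcup_(m in [set: nat]) piece pr m.

Definition pieceZ (pr : nat -> E -> E) (m : int) : set E :=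
  if m is Posz n then piece pr n else [set 0].

(* The graded dual \bigoplus_m Hom(E_(m), C), realized as the space of the
   linear forms on E that vanish on all but finitely many E_(m). *)
Definition dual_le (pr : nat -> E -> E) (N : nat) : set (E -> R[i]^o) :=
  [set theta | linear theta /\
     forall m x, (N < m)%N -> piece pr m x -> theta x = 0].

Definition dual_piece (pr : nat -> E -> E) (m : nat) : set (E -> R[i]^o) :=
  [set theta | linear theta /\
     forall n x, n != m -> piece pr n x -> theta x = 0].

End LinearAlgebra.

Definition dual_homogeneous {R : realType} {E : lmodType R[i]}
    (pr : nat -> E -> E) : set (E -> R[i]^o) :=
  \bigcup_(m in [set: nat]) dual_piece pr m.

(* vm a n b = a_n b is the action on V itself, wm a n w = a_n w that on W. *)
Definition weak_module_axioms {R : realType} (V W : lmodType R[i])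
    (vac : V) (vm : V -> int -> V -> V) (wm : V -> int -> W -> W) : Prop :=
  (forall n w, linear (fun a => wm a n w)) /\
  (forall a n, linear (wm a n)) /\
  (forall a w, exists N : nat, forall n : nat, (N <= n)%N -> wm a n%:Z w = 0) /\
  (forall n w, wm vac n w = if n == -1 then w else 0) /\
  (forall a b w (p q r : int),
     \sum_(i \in [set: nat])
        cbinom p%:~R i *: wm (vm a (r + i%:Z) b) (p + q - i%:Z) w =
     \sum_(i \in [set: nat])
        ((-1) ^+ i * cbinom r%:~R i) *:
          (wm a (p + r - i%:Z) (wm b (q + i%:Z) w)
           - (-1) ^ r *: wm b (q + r - i%:Z) (wm a (p + i%:Z) w))).

(* The weight spaces of V are the eigenspaces of L(0) = omega_1. *)
Definition weight_space {R : realType} (V : lmodType R[i])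
    (vm : V -> int -> V -> V) (omega : V) (n : int) : set V :=
  [set a | vm omega 1 a = n%:~R *: a].

Definition voa_axioms {R : realType} (V : lmodType R[i])
    (vm : V -> int -> V -> V) (vac omega : V) (c : R[i]) : Prop :=
  let L (n : int) := vm omega (n + 1) in
  weak_module_axioms vac vm vm /\
  (forall a, vm a (-1) vac = a) /\
  (forall a (n : nat), vm a n%:Z vac = 0) /\
  (forall (m n : int) b,
     L m (L n b) - L n (L m b) =
       (m - n)%:~R *: L (m + n) b
       + (if m + n == 0 then ((m ^+ 3 - m)%:~R / 12%:R * c) *: b else 0)) /\
  (forall a (n : int) b, vm (L (-1) a) n b = - (n%:~R *: vm a (n - 1) b)) /\
  (forall a,
     lspan (\bigcup_(n in [set: int]) weight_space vm omega n) a) /\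
  (forall n, fin_dim (weight_space vm omega n)) /\
  (exists n0 : int, forall n, n < n0 -> weight_space vm omega n `<=` [set 0]).

Record voa (R : realType) := VOA {
  voa_car :> lmodType R[i];
  mode : voa_car -> int -> voa_car -> voa_car;
  vacuum : voa_car;
  conformal : voa_car;
  central_charge : R[i];
  voaP : voa_axioms mode vacuum conformal central_charge }.
Arguments mode {R v}.
Arguments vacuum {R} v.
Arguments conformal {R} v.

Definition has_wt {R : realType} {V : voa R} (a : V) (n : int) : Prop :=
  weight_space mode (conformal V) n a.

Record vmodule (R : realType) (V : voa R) := VModule {
  vmodule_car :> lmodType R[i];
  act : V -> int -> vmodule_car -> vmodule_car;
  vmoduleP : weak_module_axioms (vacuum V) mode act }.
Arguments act {R V v}.

Section Modules.
Context {R : realType} {V : voa R}.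
Implicit Types A B D E W : vmodule V.

Definition L0 W : W -> W := act (conformal V) 1.

Definition L0_gen_eigen W (lambda : R[i]) : set W :=
  [set w | exists r : nat, iter r (fun x => L0 x - lambda *: x) w = 0].

Definition submodule W (U : set W) : Prop :=
  subspace U /\ forall a n w, U w -> U (act a n w).

Definition indecomposable W (U : set W) : Prop :=
  ~ (U `<=` [set 0]) /\
  forall U1 U2 : set W,
    submodule U1 -> submodule U2 -> U1 `<=` U -> U2 `<=` U ->
    U1 `&` U2 `<=` [set 0] ->
    (forall w, U w -> exists w1 w2, [/\ U1 w1, U2 w2 & w = w1 + w2]) ->
    U1 `<=` [set 0] \/ U2 `<=` [set 0].

Definition nat_gradable W : Prop :=
  exists pr : nat -> W -> W, is_grading pr /\
    forall (a : V) (n k : int) (m : nat) (w : W),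
      has_wt a n -> piece pr m w -> pieceZ pr (m%:Z + n - k - 1) (act a k w).

Definition C1 W : set W :=
  lspan [set x | exists (a : V) (n : int) (w : W),
                   [/\ has_wt a n, 1 <= n & x = act a (-1) w]].

Definition C1_cofinite W : Prop := fin_codim (@C1 W).

(* The grading W_(m) = W_{d+m} of an indecomposable W, and the direct sum of
   these gradings, for some decomposition of W into indecomposables U i, in
   general.  For an indecomposable W the only possible family is n = 1, U 0 = W. *)
Definition canonical_grading W (pr : nat -> W -> W) : Prop :=
  is_grading pr /\
  exists n (U : 'I_n -> set W) (d : 'I_n -> R[i]),
    [/\ forall i, submodule (U i) /\ indecomposable (U i),
        forall w, exists! u : {ffun 'I_n -> W},
          (forall i, U i (u i)) /\ w = \sum_i u i,
        forall i, exists2 w, w <> 0 & (U i `&` L0_gen_eigen (d i)) w &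
        forall m w, piece pr m w <->
          exists u : 'I_n -> W,
            (forall i, (U i `&` L0_gen_eigen (d i + m%:R)) (u i)) /\
            w = \sum_i u i].

Definition vhom D E (f : D -> E) : Prop :=
  linear f /\ forall a n w, f (act a n w) = act a n (f w).

(* Y v h s u is v_{s,h} u, the coefficient of z^(-s-1) log^h(z) in Y(v,z)u. *)
Definition intw A B D := A -> nat -> R[i] -> B -> D.

(* (I1)-(I3) are compared coefficientwise at z^(-s-1) log^h(z). *)
Definition log_intertwining A B D (Y : intw A B D) : Prop :=
  (forall h s u, linear (fun v => Y v h s u)) /\
  (forall v h s, linear (Y v h s)) /\
  (exists K : nat, forall v h s u, (K < h)%N -> Y v h s u = 0) /\
  (forall v u s, exists N : nat,
     forall (n h : nat), (N <= n)%N -> Y v h (s + n%:R) u = 0) /\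
  (forall (a : V) (m : int) v h s u,
     act a m (Y v h s u) - Y v h s (act a m u) =
     \sum_(j \in [set: nat])
        cbinom m%:~R j *: Y (act a j%:Z v) h (s + m%:~R - j%:R) u) /\
  (forall (a : V) (m : int) v h s u,
     Y (act a m v) h s u =
     \sum_(j \in [set: nat])
        (cbinom m%:~R j * (-1) ^+ j) *:
          (act a (m - j%:Z) (Y v h (s + j%:R) u)
           - (-1) ^ m *: Y v h (s + m%:~R - j%:R) (act a j%:Z u))) /\
  (forall v h s u,
     Y (act (conformal V) 0 v) h s u =
     - (s *: Y v h (s - 1) u) + h.+1%:R *: Y v h.+1 (s - 1) u).

Definition is_fusion_product A B D (Y : intw A B D) : Prop :=
  [/\ nat_gradable D, log_intertwining Y &
      forall E (Y' : intw A B E), nat_gradable E -> log_intertwining Y' ->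
        exists! f : D -> E,
          vhom f /\ forall v h s u, Y' v h s u = f (Y v h s u)].

End Modules.

Section FormalSeries.
Context {R : realType}.

(* lser: formal sums \sum_(n : int) c_n z^n;
   cser: formal sums \sum_(p : C) f_p z^p. *)
Definition lser := int -> R[i].
Definition cser := R[i] -> R[i]^o.

Definition lconst (a : R[i]) : lser := fun n => if n == 0 then a else 0.

Definition lmon (k : int) : lser := fun n => (n == k)%:R.

(* (a + b z)^k expanded in nonnegative powers of z *)
Definition iota_pow (a b : R[i]) (k : int) : lser :=
  fun n => if n is Posz j then cbinom k%:~R j * a ^ (k - j%:Z) * b ^+ j else 0.

Definition ladd (c d : lser) : lser := fun n => c n + d n.

Definition lmul (c d : lser) : lser :=
  fun n => \sum_(m \in [set: int]) c m * d (n - m).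

Definition lact (c : lser) (f : cser) : cser :=
  fun p => \sum_(n \in [set: int]) c n * f (p - n%:~R).

Definition is_powser (c : lser) : Prop := forall n, n < 0 -> c n = 0.

Definition in_max_ideal (c : lser) : Prop := forall n, n <= 0 -> c n = 0.

(* The C-algebra generated by gens.  A coefficient is recorded as a pair of
   expansions (c, r) of one rational function: c multiplies the correlation
   series, and r is its image in C[[y]], resp. C[[x - y0]]. *)
Inductive gen_alg (gens : set (lser * lser)) : lser -> lser -> Prop :=
| gen_alg_const a : gen_alg gens (lconst a) (lconst a)
| gen_alg_gen c r : gens (c, r) -> gen_alg gens c r
| gen_alg_add c r c' r' : gen_alg gens c r -> gen_alg gens c' r' ->
    gen_alg gens (ladd c c') (ladd r r')
| gen_alg_mul c r c' r' : gen_alg gens c r -> gen_alg gens c' r' ->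
    gen_alg gens (lmul c c') (lmul r r').

(* C[(x0 - y)^-1][y], acting on series in y *)
Definition ring_y_in_y (x0 : R[i]) : lser -> lser -> Prop :=
  gen_alg [set (iota_pow x0 (-1) (-1), iota_pow x0 (-1) (-1));
               (lmon 1, lmon 1)].

(* C[(x0 - y)^-1][y], acting on series in t = x0 - y *)
Definition ring_y_in_t (x0 : R[i]) : lser -> lser -> Prop :=
  gen_alg [set (lmon (-1), iota_pow x0 (-1) (-1));
               (iota_pow x0 (-1) 1, lmon 1)].

(* C[x, x^-1][x - y0], acting on series in x *)
Definition ring_xy_in_x (y0 : R[i]) : lser -> lser -> Prop :=
  gen_alg [set (lmon 1, iota_pow y0 1 1);
               (lmon (-1), iota_pow y0 1 (-1));
               (iota_pow (- y0) 1 1, lmon 1)].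

(* C[x, x^-1][x - y0], acting on series in t = x - y0 *)
Definition ring_xy_in_t (y0 : R[i]) : lser -> lser -> Prop :=
  gen_alg [set (iota_pow y0 1 1, iota_pow y0 1 1);
               (iota_pow y0 1 (-1), iota_pow y0 1 (-1));
               (lmon 1, lmon 1)].

(* f = \sum_i c_i G(mu_i), where the coefficients (c_i, r_i) satisfy K *)
Definition combination {Q : Type} (K : lser -> lser -> Prop) (G : Q -> cser)
    (J : set Q) (f : cser) : Prop :=
  exists n (mu : 'I_n -> Q) (c r : 'I_n -> lser),
    (forall i, J (mu i) /\ K (c i) (r i)) /\
    f = \sum_i lact (c i) (G (mu i)).

Definition lin_comb {Q : Type} (K : lser -> lser -> Prop) (G : Q -> cser)
    (J : set Q) (f : cser) : Prop :=
  combination (fun c r => K c r /\ is_powser r) G J f.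

Definition eq_mod {Q : Type} (K : lser -> lser -> Prop) (G : Q -> cser)
    (Omega : set Q) (f g : cser) : Prop :=
  exists2 e, combination (fun c r => K c r /\ in_max_ideal r) G Omega e &
             f = g + e.

End FormalSeries.
Arguments lser : clear implicits.
Arguments cser : clear implicits.

Section Correlation.
Context {R : realType} {V : voa R}.

Record quad (W A B C : vmodule V) := Quad {
  q1 : W -> R[i]^o; q2 : A; q3 : B; q4 : C }.

Section Quadruples.
Context {W A B C : vmodule V}.
Implicit Types xi : quad W A B C.

Definition act2 (a : V) (n : int) xi :=
  Quad (q1 xi) (act a n (q2 xi)) (q3 xi) (q4 xi).
Definition act3 (a : V) (n : int) xi :=
  Quad (q1 xi) (q2 xi) (act a n (q3 xi)) (q4 xi).
Definition act4 (a : V) (n : int) xi :=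
  Quad (q1 xi) (q2 xi) (q3 xi) (act a n (q4 xi)).

Definition quad_le (gW : nat -> W -> W) (N : nat) : set (quad W A B C) :=
  [set xi | dual_le gW N (q1 xi)].

Definition quad_prod (J1 : set (W -> R[i]^o)) (J2 : set A) (J3 : set B)
    (J4 : set C) : set (quad W A B C) :=
  [set xi | [/\ J1 (q1 xi), J2 (q2 xi), J3 (q3 xi) & J4 (q4 xi)]].

(* Multiplication of F xi by z^(gr(v) + gr(u) + gr(w)) for homogeneous v, u, w,
   where zpow k is the series z^k, extended linearly. *)
Definition gr_twist (gA : nat -> A -> A) (gB : nat -> B -> B)
    (gC : nat -> C -> C) (zpow : nat -> lser R) (F : quad W A B C -> cser R) :
    quad W A B C -> cser R :=
  fun xi => \sum_(m \in [set: nat * nat * nat])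
    lact (zpow (m.1.1 + m.1.2 + m.2)%N)
         (F (Quad (q1 xi) (gA m.1.1 (q2 xi)) (gB m.1.2 (q3 xi))
                  (gC m.2 (q4 xi)))).

End Quadruples.

Section IteratedRight.
Context {A B C BC W : vmodule V}.
Variables (Y1 : intw A BC W) (Y2 : intw B C BC).
Variables (gA : nat -> A -> A) (gB : nat -> B -> B) (gC : nat -> C -> C).

(* <theta, Y1_h(v,x0) Y2_k(u,y) w> as a series in y; lx is a logarithm of x0 *)
Definition corr_right_y (h k : nat) (lx : R[i]) (xi : quad W A B C) : cser R :=
  fun p => \sum_(s \in [set: R[i]])
    q1 xi (Y1 (q2 xi) h s (Y2 (q3 xi) k (- p - 1) (q4 xi))) * cpow lx (- s - 1).

(* <theta, Y1_h(v,x) Y2_k(u,y0) w> as a series in x; ly is a logarithm of y0 *)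
Definition corr_right_x (h k : nat) (ly : R[i]) (xi : quad W A B C) : cser R :=
  fun p => \sum_(s \in [set: R[i]])
    q1 xi (Y1 (q2 xi) h (- p - 1) (Y2 (q3 xi) k s (q4 xi))) * cpow ly (- s - 1).

(* G^{A(BC):y}_{h,k}(xi; x0, y), a series in y *)
Definition G_right_y (h k : nat) (lx : R[i]) : quad W A B C -> cser R :=
  gr_twist gA gB gC (fun g => lmon g%:Z) (corr_right_y h k lx).

(* G^{A(BC):x-y}_{h,k}(xi; x, y0), a series in x *)
Definition G_right_xy (h k : nat) (ly y0 : R[i]) : quad W A B C -> cser R :=
  gr_twist gA gB gC (fun g => iota_pow (- y0) 1 g%:Z) (corr_right_x h k ly).

End IteratedRight.

Section IteratedLeft.
Context {A B C AB W : vmodule V}.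
Variables (Y1 : intw AB C W) (Y2 : intw A B AB).
Variables (gA : nat -> A -> A) (gB : nat -> B -> B) (gC : nat -> C -> C).

(* <theta, Y1_h(Y2_k(v,t)u, y0) w> as a series in t = x - y0 *)
Definition corr_left_xy (h k : nat) (ly : R[i]) (xi : quad W A B C) : cser R :=
  fun p => \sum_(s \in [set: R[i]])
    q1 xi (Y1 (Y2 (q2 xi) k (- p - 1) (q3 xi)) h s (q4 xi)) * cpow ly (- s - 1).

(* <theta, Y1_h(Y2_k(v,t)u, y) w> with y = x0 - t, as a series in t:
   y^(-s-1) is expanded as \sum_j binom(-s-1, j) x0^(-s-1-j) (-t)^j. *)
Definition corr_left_y (h k : nat) (lx : R[i]) (xi : quad W A B C) : cser R :=
  fun p => \sum_(j \in [set: nat]) \sum_(s \in [set: R[i]])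
    q1 xi (Y1 (Y2 (q2 xi) k (j%:R - p - 1) (q3 xi)) h s (q4 xi)) *
    (cbinom (- s - 1) j * cpow lx (- s - 1 - j%:R) * (-1) ^+ j).

(* G^{(AB)C:x-y}_{h,k}(xi; x, y0), a series in t = x - y0 *)
Definition G_left_xy (h k : nat) (ly : R[i]) : quad W A B C -> cser R :=
  gr_twist gA gB gC (fun g => lmon g%:Z) (corr_left_xy h k ly).

(* G^{(AB)C:y}_{h,k}(xi; x0, y), a series in t = x0 - y *)
Definition G_left_y (h k : nat) (lx x0 : R[i]) : quad W A B C -> cser R :=
  gr_twist gA gB gC (fun g => iota_pow x0 (-1) g%:Z) (corr_left_y h k lx).

End IteratedLeft.

End Correlation.

(* Main.v *)
Require Import Defs.
From mathcomp Require Import all_boot all_order all_algebra.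
From mathcomp Require Import complex.
From mathcomp Require Import all_classical reals sequences exp trigo.
From mathcomp Require Import ring zify.

(** For a in V of positive weight the intertwining axioms express the correlation
    function of a quadruple in which a_(-1) acts on one of the three vectors
    through the functions in which nonnegative modes of a act on the other two
    vectors, or negative modes act on the form.  For the product of two
    intertwining operators at x and y, and equally for their iterate, these are

      F(a_(-1) v) = sum_j x^j F(theta a_(-1-j)) + sum_j x^(-1-j) F(a_j w)
                  + sum_j (x - y)^(-1-j) F(a_j u),
      F(a_(-1) u) = sum_j y^j F(theta a_(-1-j)) + sum_j y^(-1-j) F(a_j w)
                  - sum_j (-1)^j (x - y)^(-1-j) F(a_j v),
      F(a_(-1) w) = F(theta a_(-1)) - sum_j (-1)^j x^(-1-j) F(a_j v)
                  - sum_j (-1)^j y^(-1-j) F(a_j u)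

    ([right_identities], [left_identities]).  A product is a series in two
    variables, expanded in y / x, and an iterate is one expanded in t / y with
    t = x - y.  Both are coefficient functions [f b s] of a big and a small
    variable, on which all integral powers of x, y and x - y act ([monom],
    [monomM]).  Setting a variable to a number requires finite sums over complex
    exponents.  They are finite because intertwining operators add generalized
    L(0)-weights ([gen_Y]) and the form sees finitely many weights
    ([dual_le_gen]), which gives [homog2_right] and [homog2_left].

    The functions G carry the factor y^gr or (x - y)^gr.  If a has weight p, then
    a_(-1) raises the total degree by p, whereas a_j lowers the degree reached in
    this way by j + 1 and the modes on the form leave the original degree.  Hence
    in terms of G each coefficient above is multiplied by the (j + 1)-st,
    respectively the p-th, power of y or x - y.  What results lies in the
    coefficient ring, and in its maximal ideal unless the factor cancels a pole:
    the poles in y in one case, those in x - y in the other.  These are the six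
    congruences ([modeY2] to [modeT4]).

    All functions on the right have smaller total degree.  A homogeneous vector is
    a combination of basis vectors of the complement of C_1 and of vectors
    a_(-1) v' ([C1_induction]), so induction on the total degree shows that the
    basis quadruples suffice ([spanning]). *)

Set Implicit Arguments.
Unset Strict Implicit.
Unset Printing Implicit Defensive.
Import Order.TTheory GRing.Theory Num.Theory.
Local Open Scope classical_set_scope.
Local Open Scope ring_scope.

(** * Sums with finite support *)

Definition fin_supp (T : choiceType) (V : nmodType) (F : T -> V) : Prop :=
  exists s : seq T, forall i, i \notin s -> F i = 0.

Section FiniteSums.
Context {T : choiceType} {V : nmodType}.
Implicit Types (F G : T -> V) (s : seq T).

Lemma fsum_seq s F : (forall i, i \notin s -> F i = 0) ->
  \sum_(i \in [set: T]) F i = \sum_(i <- undup s) F i.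
Proof.
move=> sF; rewrite (fsbigE (undup s)) ?undup_uniq//.
  by apply: eq_bigl => i; rewrite in_setT.
by move=> i _; rewrite mem_undup; exact: sF.
Qed.

Lemma fsum_eq F G : F =1 G ->
  \sum_(i \in [set: T]) F i = \sum_(i \in [set: T]) G i.
Proof. by move=> FG; apply: eq_fsbigr => i _. Qed.

Lemma fsum_eq0 F : (forall i, F i = 0) -> \sum_(i \in [set: T]) F i = 0.
Proof. by move=> F0; apply: fsbig1 => i _. Qed.

Lemma fsum_single (t : T) F : (forall i, i != t -> F i = 0) ->
  \sum_(i \in [set: T]) F i = F t.
Proof.
move=> F0; rewrite (@fsum_seq [:: t]) /= ?big_seq1//.
by move=> i; rewrite inE; exact: F0.
Qed.

Lemma fsumD F G : fin_supp F -> fin_supp G ->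
  \sum_(i \in [set: T]) (F i + G i) =
  \sum_(i \in [set: T]) F i + \sum_(i \in [set: T]) G i.
Proof.
move=> [s sF] [t tG].
have sF' i : i \notin s ++ t -> F i = 0 by rewrite mem_cat => /norP[/sF].
have tG' i : i \notin s ++ t -> G i = 0 by rewrite mem_cat => /norP[_ /tG].
rewrite (fsum_seq sF') (fsum_seq tG') (@fsum_seq (s ++ t)) ?big_split// => i ist.
by rewrite sF'// tG'// addr0.
Qed.

End FiniteSums.

Lemma fsum_morph (T : choiceType) (V V' : nmodType) (f : V -> V') (F : T -> V) :
  f 0 = 0 -> {morph f : x y / x + y} ->
  fin_supp F -> f (\sum_(i \in [set: T]) F i) = \sum_(i \in [set: T]) f (F i).
Proof.
move=> f0 fD [s sF]; rewrite (fsum_seq sF) (big_morph f fD f0).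
by rewrite (@fsum_seq _ _ s)// => i /sF ->.
Qed.


Lemma exchange_fsum (T T' : choiceType) (V : nmodType) (F : T -> T' -> V)
    (s : seq T) (t : seq T') :
  (forall i j, F i j != 0 -> (i \in s) && (j \in t)) ->
  \sum_(i \in [set: T]) \sum_(j \in [set: T']) F i j =
  \sum_(j \in [set: T']) \sum_(i \in [set: T]) F i j.
Proof.
move=> Fst.
have F0 i j : (i \notin s) || (j \notin t) -> F i j = 0.
  by rewrite -negb_and; apply: contraNeq; exact: Fst.
have Fi i : \sum_(j \in [set: T']) F i j = \sum_(j <- undup t) F i j.
  by apply: fsum_seq => j tj; rewrite F0// tj orbT.
have Fj j : \sum_(i \in [set: T]) F i j = \sum_(i <- undup s) F i j.
  by apply: fsum_seq => i si; rewrite F0// si.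
rewrite (fsum_eq Fi) (fsum_eq Fj) (@fsum_seq _ _ s) => [|i si]; last first.
  by rewrite big1// => j _; rewrite F0// si.
rewrite (@fsum_seq _ _ t) => [|j tj]; last first.
  by rewrite big1// => i _; rewrite F0// tj orbT.
exact: exchange_big.
Qed.

Lemma fsum_ord (V : nmodType) (F : nat -> V) (M : nat) :
  (forall j, (M <= j)%N -> F j = 0) ->
  \sum_(j \in [set: nat]) F j = \sum_(j < M) F j.
Proof.
move=> F0; rewrite (@fsum_seq _ _ (iota 0 M)) => [|j]; last first.
  by rewrite mem_iota add0n -leqNgt; exact: F0.
rewrite undup_id ?iota_uniq// -(big_mkord xpredT F).
by rewrite /index_iota subn0.
Qed.

Lemma fsum_reindex (T T' : choiceType) (V : nmodType) (g : T' -> T)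
    (g' : T -> T') (F : T -> V) : cancel g g' -> cancel g' g ->
  \sum_(i \in [set: T]) F i = \sum_(j \in [set: T']) F (g j).
Proof. by move=> gK g'K; apply: reindex_fsbigT; exists g'. Qed.

Lemma fsumM (T : choiceType) (K : idomainType) (a : K) (F : T -> K) :
  a * \sum_(i \in [set: T]) F i = \sum_(i \in [set: T]) a * F i.
Proof. exact: mulr_fsumr. Qed.

Lemma fsumMr (T : choiceType) (K : idomainType) (a : K) (F : T -> K) :
  (\sum_(i \in [set: T]) F i) * a = \sum_(i \in [set: T]) F i * a.
Proof. exact: mulr_fsuml. Qed.

(** * Generalized binomial coefficients and the power function *)

Section Binomials.
Context {R : realType}.
Implicit Types (a b : R[i]).

Lemma cbinom0 a : cbinom a 0 = 1.
Proof. by rewrite /cbinom big_ord0 fact0 divr1. Qed.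

Lemma natrS_neq0 n : n.+1%:R != 0 :> R[i].
Proof. by rewrite pnatr_eq0. Qed.

Lemma cbinomS a j : j.+1%:R * cbinom a j.+1 = (a - j%:R) * cbinom a j.
Proof.
rewrite /cbinom big_ord_recr/= factS natrM; field.
by rewrite nat1r natrS_neq0 pnatr_eq0 -lt0n fact_gt0.
Qed.

Lemma cbinom1 a : cbinom a 1 = a.
Proof.
by have := cbinomS a 0; rewrite cbinom0 mul1r mulr1 subr0.
Qed.

(** Both sides satisfy the first order recursion
    (l + 1) c_(l+1) = (a + b - l) c_l with c_0 = 1. *)
Lemma cbinom_vandermonde a b l :
  cbinom (a + b) l = \sum_(m < l.+1) cbinom a m * cbinom b (l - m).
Proof.
elim: l => [|l IH]; first by rewrite big_ord1 !cbinom0 mulr1.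
apply: (mulfI (natrS_neq0 l)); rewrite cbinomS IH.
have -> : l.+1%:R * \sum_(m < l.+2) cbinom a m * cbinom b (l.+1 - m) =
    \sum_(m < l.+2) (m%:R * cbinom a m) * cbinom b (l.+1 - m) +
    \sum_(m < l.+2) cbinom a m * ((l.+1 - m)%:R * cbinom b (l.+1 - m)).
  rewrite mulr_sumr -big_split; apply: eq_bigr => m _ /=.
  by rewrite natrB -1?ltnS//; ring.
rewrite [in RHS]big_ord_recl/= mulr0n !mul0r add0r [X in _ = _ + X]big_ord_recr/=.
rewrite subnn mulr0n mul0r mulr0 addr0 mulr_sumr -big_split; apply: eq_bigr => m _ /=.
have ml : (m <= l)%N by rewrite -ltnS.
by rewrite /bump add1n cbinomS subSS subSn// cbinomS natrB//; ring.
Qed.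

Lemma cbinom_small n j : (n < j)%N -> cbinom n%:R j = 0 :> R[i].
Proof.
by move=> nj; rewrite /cbinom (bigD1 (Ordinal nj))//= subrr !mul0r.
Qed.

Lemma cbinom_pascal a j : cbinom (a + 1) j.+1 = cbinom a j.+1 + cbinom a j.
Proof.
rewrite addrC cbinom_vandermonde 2!big_ord_recl/= cbinom0 cbinom1 !mul1r subn0.
rewrite /bump/= add1n subSS subn0 big1 ?addr0// => m _.
by rewrite !add1n (@cbinom_small 1)// mul0r.
Qed.

Lemma cbinom_nat n j : cbinom n%:R j = 'C(n, j)%:R :> R[i].
Proof.
elim: n j => [|n IH] [|j]; rewrite ?cbinom0 ?bin0//.
  by rewrite bin0n; exact: cbinom_small.
by rewrite -natr1 cbinom_pascal !IH binS natrD.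
Qed.

Lemma cbinom_neg (i l : nat) :
  cbinom (- 1 - i%:R) l = (-1) ^+ l * 'C(i + l, i)%:R :> R[i].
Proof.
elim: l => [|l IH]; first by rewrite cbinom0 addn0 binn mulr1.
apply: (mulfI (natrS_neq0 l)); rewrite cbinomS IH exprS.
have /(congr1 (fun n => n%:R : R[i])) : (l.+1 * 'C(i + l.+1, i) =
    (i + l).+1 * 'C(i + l, i))%N.
  have e1 : 'C(i + l.+1, i) = 'C((i + l).+1, l.+1).
    by rewrite -(@bin_sub _ i) ?leq_addr// addKn addnS.
  by rewrite e1 -mul_bin_diag -[in RHS](@bin_sub _ i) ?leq_addr// addKn.
rewrite !natrM => e.
transitivity (- (-1) ^+ l * ((i + l).+1%:R * 'C(i + l, i)%:R) : R[i]).
  by rewrite -natr1 natrD; ring.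
by rewrite -e; ring.
Qed.

Lemma cbinom_negM (i l : nat) :
  cbinom (- 1 - i%:R) l * (-1) ^+ l = 'C(i + l, i)%:R :> R[i].
Proof. by rewrite cbinom_neg mulrAC -expr2 sqrr_sign mul1r. Qed.

(** Dividing the i-th derivative of 1 / (x - y) in x by i! and then expanding
    in y, or expanding first and then differentiating each power of x. *)
Lemma cbinom_neg_sym (i l : nat) :
  (-1) ^+ i * cbinom (- 1 - l%:R) i = (-1) ^+ l * cbinom (- 1 - i%:R) l :> R[i].
Proof.
rewrite !cbinom_neg !mulrA -!expr2 !sqrr_sign !mul1r.
by rewrite -(@bin_sub (l + i) l) ?leq_addr// addKn addnC.
Qed.

Lemma cbinomN1 (l : nat) : cbinom (- 1) l = (-1) ^+ l :> R[i].
Proof. by have := cbinom_neg 0 l; rewrite subr0 bin0 mulr1. Qed.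

Lemma cbinom_neg_swap (i l : nat) : cbinom (- 1 - l%:R) i =
  (-1) ^+ i * (cbinom (- 1 - i%:R) l * (-1) ^+ l) :> R[i].
Proof.
by rewrite [cbinom _ l * _]mulrC -cbinom_neg_sym mulrA -expr2 sqrr_sign mul1r.
Qed.

End Binomials.

Section Powers.
Context {R : realType}.
Implicit Types (l s t z w : R[i]).

Lemma cexpD z w : cexp (z + w) = cexp z * cexp w :> R[i].
Proof.
case: z w => [a b] [c d]; rewrite /cexp /= expRD cosD sinD.
by apply/eqP; rewrite eq_complex/=; apply/andP; split; apply/eqP; ring.
Qed.

Lemma cexp0 : cexp 0 = 1 :> R[i].
Proof.
rewrite /cexp /= expR0 cos0 sin0.
by apply/eqP; rewrite eq_complex/=; apply/andP; split; apply/eqP; ring.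
Qed.

Lemma cpowD l s t : cpow l (s + t) = cpow l s * cpow l t.
Proof. by rewrite /cpow mulrDl cexpD. Qed.

Lemma cpow0 l : cpow l 0 = 1.
Proof. by rewrite /cpow mul0r cexp0. Qed.

Lemma cpow1 l : cpow l 1 = cexp l.
Proof. by rewrite /cpow mul1r. Qed.

Lemma cpow_neq0 l s : cpow l s != 0.
Proof.
apply/eqP => e0; have := cpowD l s (- s); rewrite subrr cpow0 e0 mul0r => /eqP.
by rewrite oner_eq0.
Qed.

Lemma cpow_nat l (n : nat) : cpow l n%:R = cexp l ^+ n.
Proof.
by elim: n => [|n IH]; rewrite ?cpow0// -natr1 cpowD IH cpow1 exprSr.
Qed.

Lemma cpow_int l (n : int) : cpow l n%:~R = cexp l ^ n.
Proof.
case: n => n; first exact: cpow_nat.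
rewrite NegzE mulrNz; apply: (mulIf (cpow_neq0 l n.+1%:R)).
rewrite -cpowD addNr cpow0 cpow_nat -exprnN mulVf// -cpow_nat.
exact: cpow_neq0.
Qed.

End Powers.

(** * Coefficient rings acting on truncated series *)

Section Truncated.
Context {R : realType}.
Implicit Types (c d : lser R) (f g : cser R) (sg : bool).

(** Series in y, or in t = x - y, have finitely many negative powers, while the
    product of two intertwining operators at a fixed y has finitely many
    positive powers of x.  The boolean [sg] selects the direction, so that both
    kinds are treated at once. *)
Definition dirz sg (n : int) : int := if sg then n else - n.

Definition bounded sg c : Prop :=
  exists N : nat, forall n : int, dirz sg n < - N%:Z -> c n = 0.

Definition truncated sg f : Prop :=
  forall p, exists N : nat, forall n : nat, (N <= n)%N ->
    f (p - (dirz sg n)%:~R) = 0.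

Definition zwindow (L : nat) : seq int :=
  [seq i%:Z - L%:Z | i <- iota 0 (L + L).+1].

Lemma mem_zwindow (L : nat) (n : int) : (`|n| <= L)%N -> n \in zwindow L.
Proof.
move=> nL; apply/mapP; exists (absz (n + L%:Z)); first by rewrite mem_iota; lia.
lia.
Qed.

Lemma lact_window sg c f p : bounded sg c -> truncated sg f ->
  exists L, forall n, c n * f (p - n%:~R) != 0 -> (`|n| <= L)%N.
Proof.
move=> [N cN] /(_ p)[M fM]; exists (N + M)%N => n.
apply: contraNT; rewrite -ltnNge => nL; apply/eqP.
have [nN|nN] := ltP (dirz sg n) (- N%:Z); first by rewrite cN// mul0r.
have [k kE Mk] : exists2 k : nat, n = dirz sg k & (M <= k)%N.
  exists `|n|%N; last by move: nN nL; rewrite /dirz; case: ifP; lia.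
  by move: nN nL; rewrite /dirz; case: ifP; lia.
by rewrite kE fM// mulr0.
Qed.

Lemma lact_supp sg c f p : bounded sg c -> truncated sg f ->
  fin_supp (fun n => c n * f (p - n%:~R)).
Proof.
move=> cb ft; have [L cfL] := lact_window p cb ft; exists (zwindow L) => n.
by move=> nL; apply: contraNeq nL => /cfL; exact: mem_zwindow.
Qed.

Lemma lactD sg c f g : bounded sg c -> truncated sg f -> truncated sg g ->
  lact c (f + g) = lact c f + lact c g.
Proof.
move=> cb ft gt; apply/funext => p.
change (lact c (f + g) p = lact c f p + lact c g p).
rewrite /lact -fsumD; [|exact: (lact_supp p cb ft)|exact: (lact_supp p cb gt)].
by apply: fsum_eq => n; rewrite mulrDr.
Qed.

Lemma lactZ c a f : lact c (a *: f) = a *: lact c f.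
Proof.
apply/funext => p; change (lact c (a *: f) p = a * lact c f p).
rewrite /lact fsumM.
by apply: fsum_eq => n; rewrite mulrCA.
Qed.

Lemma lact0 c : lact c 0 = 0.
Proof. by have := lactZ c 0 0; rewrite !scale0r. Qed.

Lemma lact_const a f : lact (lconst a) f = a *: f.
Proof.
apply/funext => p; rewrite /lact (@fsum_single _ _ 0) => [|n n0].
  by rewrite /lconst eqxx subr0.
by rewrite /lconst (negPf n0) mul0r.
Qed.

Lemma lact_mon k f p : lact (lmon k) f p = f (p - k%:~R).
Proof.
rewrite /lact (@fsum_single _ _ k) => [|n nk].
  by rewrite /lmon eqxx mul1r.
by rewrite /lmon (negPf nk) mul0r.
Qed.

(** For each exponent, only finitely many pairs of terms of [c] and [d] meet the
    support of [f], so the two sums may be exchanged. *)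
Lemma lact_mul sg c d f : bounded sg c -> bounded sg d -> truncated sg f ->
  lact (lmul c d) f = lact c (lact d f).
Proof.
move=> [Nc cN] [Nd dN] ft; apply/funext => p.
have [Nf fN] := ft p.
pose w := zwindow (Nc + Nd + Nf)%N.
have supp k m : c k * (d (m - k) * f (p - m%:~R)) != 0 -> (k \in w) && (m \in w).
  have [ck|ck] := ltP (dirz sg k) (- Nc%:Z); first by rewrite cN ?mul0r ?eqxx.
  have [dk|dk] := ltP (dirz sg (m - k)) (- Nd%:Z).
    by rewrite (dN _ dk) mul0r mulr0 eqxx.
  have [fm|fm] := ltP (dirz sg m) (Nf%:Z : int); last first.
    have -> : m = dirz sg `|m|%N by move: fm; rewrite /dirz; case: ifP; lia.
    rewrite fN ?mulr0 ?eqxx//; by move: fm; rewrite /dirz; case: ifP; lia.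
  move=> _; apply/andP; split; apply: mem_zwindow;
    by move: ck dk fm; rewrite /dirz; case: ifP; lia.
rewrite /lact /lmul.
transitivity (\sum_(m \in [set: int]) \sum_(k \in [set: int])
    c k * (d (m - k) * f (p - m%:~R))).
  by apply: fsum_eq => m; rewrite fsumMr; apply: fsum_eq => k; rewrite mulrA.
rewrite (@exchange_fsum _ _ _ _ w w) => [|m k /supp]; last by rewrite andbC.
apply: fsum_eq => k; move: k => k; rewrite -fsumM; congr (_ * _).
rewrite (@fsum_reindex int int _ (fun l : int => l + k) (fun l : int => l - k));
  [|by move=> l /=; lia|by move=> l /=; lia].
apply: fsum_eq => l; rewrite addrK rmorphD/= opprD.
by rewrite [- l%:~R - _]addrC addrA.
Qed.

Lemma truncatedD sg f g : truncated sg f -> truncated sg g -> truncated sg (f + g).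
Proof.
move=> ft gt p; have [M fM] := ft p; have [N gN] := gt p.
exists (M + N)%N => n MNn; rewrite [LHS]/GRing.add/= fM ?gN ?addr0//; lia.
Qed.

Lemma truncated0 sg : truncated sg 0.
Proof. by move=> p; exists 0%N. Qed.

Lemma truncated_sum sg (I : Type) (s : seq I) (P : pred I) (F : I -> cser R) :
  (forall i, P i -> truncated sg (F i)) -> truncated sg (\sum_(i <- s | P i) F i).
Proof.
move=> Ft; elim/big_ind: _ => //; [exact: truncated0|exact: truncatedD].
Qed.

Lemma lact_sum sg c (I : Type) (s : seq I) (F : I -> cser R) :
  bounded sg c -> (forall i, truncated sg (F i)) ->
  lact c (\sum_(i <- s) F i) = \sum_(i <- s) lact c (F i).
Proof.
move=> cb Ft; elim: s => [|i s IH]; first by rewrite !big_nil lact0.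
rewrite !big_cons (lactD cb) ?IH//; exact: truncated_sum.
Qed.

Lemma truncated_lact sg c f : bounded sg c -> truncated sg f ->
  truncated sg (lact c f).
Proof.
move=> [Nc cN] ft p; have [Nf fN] := ft p.
exists (Nc + Nf)%N => n nN; apply: fsum_eq0 => m.
have [cm|cm] := ltP (dirz sg m) (- Nc%:Z); first by rewrite cN// mul0r.
rewrite -addrA -opprD -rmorphD/=.
have -> : dirz sg n + m = dirz sg (absz (dirz sg n + m)).
  by move: cm; rewrite /dirz; case: ifP; lia.
rewrite fN ?mulr0//; by move: cm; rewrite /dirz; case: ifP; lia.
Qed.

Lemma bounded_const sg a : bounded sg (lconst a).
Proof. by exists 0%N; rewrite /lconst => n n0; case: eqP n0 => // ->; case: sg. Qed.

Lemma bounded_mon sg k : bounded sg (lmon k).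
Proof.
exists `|k|%N; rewrite /lmon => n n0; case: eqP n0 => // ->.
by rewrite /dirz; case: ifP; lia.
Qed.

Lemma bounded_add sg c d : bounded sg c -> bounded sg d -> bounded sg (ladd c d).
Proof.
move=> [Nc cN] [Nd dN]; exists (Nc + Nd)%N => n nN.
by rewrite /ladd cN ?dN ?addr0//; lia.
Qed.

Lemma bounded_mul sg c d : bounded sg c -> bounded sg d -> bounded sg (lmul c d).
Proof.
move=> [Nc cN] [Nd dN]; exists (Nc + Nd)%N => n nN.
apply: fsum_eq0 => m.
have [cm|cm] := ltP (dirz sg m) (- Nc%:Z); first by rewrite cN// mul0r.
by rewrite dN ?mulr0//; move: nN cm; rewrite /dirz; case: ifP; lia.
Qed.

Lemma powser_bounded c : is_powser c -> bounded true c.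
Proof. by move=> c0; exists 0%N => n; rewrite oppr0; exact: c0. Qed.

Lemma powser_iota a b k : is_powser (@iota_pow R a b k).
Proof. by case. Qed.

(** With a natural exponent the expansion is a polynomial, and so it also acts on
    series that are infinite in the negative direction. *)
Lemma bounded_iota_nat sg a b (k : nat) : bounded sg (@iota_pow R a b k%:Z).
Proof.
exists k => -[] // n; rewrite /dirz; case: ifP => _ nk //.
  by exfalso; lia.
by rewrite /iota_pow cbinom_small ?mul0r//; lia.
Qed.

Lemma iota_powD a b k l : a != 0 ->
  lmul (@iota_pow R a b k) (iota_pow a b l) = iota_pow a b (k + l).
Proof.
move=> a0; apply/funext => -[n|n]; last first.
  apply: fsum_eq0 => -[m|m]; rewrite ?mul0r//.
  have -> : Negz n - m%:Z = Negz (n + m)%N by lia.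
  by rewrite mulr0.
rewrite /lmul (@fsum_seq _ _ [seq i%:Z | i <- iota 0 n.+1]); last first.
  move=> [m|m] mn; last by rewrite mul0r.
  have nm : (n < m)%N.
    rewrite ltnNge; apply: contra mn => mn; apply/mapP; exists m => //.
    by rewrite mem_iota.
  have -> : n%:Z - m%:Z = Negz (m - n).-1 by lia.
  by rewrite mulr0.
rewrite undup_id; last by rewrite map_inj_uniq ?iota_uniq// => i j [].
rewrite big_map -[iota 0 n.+1]/(index_iota 0 n.+1) big_mkord.
rewrite /iota_pow rmorphD/= cbinom_vandermonde !mulr_suml; apply: eq_bigr => m _.
have mn : (m <= n)%N by rewrite -ltnS.
rewrite subzn//.
have -> : k + l - n%:Z = (k - m%:Z) + (l - (n - m)%N%:Z) by lia.
rewrite [in RHS]expfzDr//.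
have -> : b ^+ n = b ^+ (n - m) * b ^+ m by rewrite -exprD subnK.
ring.
Qed.

End Truncated.

Section GeneratedAlgebra.
Context {R : realType}.
Variables (gens : set (lser R * lser R)) (sg : bool).
Hypothesis gensP : forall c r, gens (c, r) -> bounded sg c /\ is_powser r.

Lemma powser_mul (c d : lser R) : is_powser c -> is_powser d -> is_powser (lmul c d).
Proof.
move=> c0 d0 n n0; apply: fsum_eq0 => m.
have [m0|m0] := ltP m 0; first by rewrite c0// mul0r.
by rewrite d0 ?mulr0//; lia.
Qed.

Lemma max_ideal_mull (c d : lser R) : is_powser c -> in_max_ideal d ->
  in_max_ideal (lmul c d).
Proof.
move=> c0 d0 n n0; apply: fsum_eq0 => m.
have [m0|m0] := ltP m 0; first by rewrite c0// mul0r.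
by rewrite d0 ?mulr0//; lia.
Qed.

Lemma gen_algP c r : gen_alg gens c r -> bounded sg c /\ is_powser r.
Proof.
elim=> [a|c' r' /gensP//|c1 r1 c2 r2 _ [b1 p1] _ [b2 p2]|
        c1 r1 c2 r2 _ [b1 p1] _ [b2 p2]].
- by split; [exact: bounded_const|rewrite /lconst => n; case: eqP => // ->].
- split; first exact: bounded_add.
  by move=> n n0; rewrite /ladd p1// p2// addr0.
- by split; [exact: bounded_mul|exact: powser_mul].
Qed.

End GeneratedAlgebra.

(** * Series in two variables *)

Lemma fsum_antidiag (V : nmodType) (F : nat -> nat -> V) (M : nat) :
  (forall l m, (M <= l + m)%N -> F l m = 0) ->
  \sum_(l \in [set: nat]) \sum_(m \in [set: nat]) F l m =
  \sum_(n \in [set: nat]) \sum_(l < n.+1) F l (n - l)%N.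
Proof.
move=> FM; pose G l n := if (l <= n)%N then F l (n - l)%N else 0.
transitivity (\sum_(l \in [set: nat]) \sum_(n \in [set: nat]) G l n).
  apply: fsum_eq => l.
  rewrite (@fsum_ord _ _ M) => [|m Mm]; last by rewrite FM//; lia.
  rewrite (@fsum_ord _ _ (l + M)) => [|n Mn]; last first.
    by rewrite /G; case: leqP => // ln; rewrite FM//; lia.
  rewrite big_split_ord/= [X in _ = X + _]big1 ?add0r => [|i _]; last first.
    by rewrite /G leqNgt ltn_ord.
  by apply: eq_bigr => m _; rewrite /G leq_addr addKn.
rewrite (@exchange_fsum _ _ _ _ (iota 0 M) (iota 0 M)) => [|l n]; last first.
  rewrite /G; case: leqP => [ln|]; last by rewrite eqxx.
  move=> Fn0; rewrite !mem_iota; case: (ltnP n M) => [nM|Mn]; first by lia.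
  by rewrite FM ?eqxx// in Fn0; lia.
apply: fsum_eq => n; rewrite (@fsum_ord _ _ n.+1) => [|l nl]; last first.
  by rewrite /G leqNgt nl.
by apply: eq_bigr => l _; rewrite /G -ltnS ltn_ord.
Qed.

Section TwoVariables.
Context {R : realType}.

Definition ser2 := R[i] -> R[i] -> R[i]^o.
Implicit Types (f g : ser2) (b s : R[i]).

(** The value [f b s] is the coefficient of X^(-b-1) Y^(-s-1), where X is the
    variable called big and Y the one called small.  The two conditions are what
    makes (X + e Y)^k, expanded in powers of Y / X, act for every integer k: the
    action preserves the total exponent and moves the exponent of Y upwards. *)
Definition homog2 f : Prop :=
  (exists S : seq R[i], forall b s, b + s \notin S -> f b s = 0) /\
  (forall s, exists N : nat, forall n, (N <= n)%N ->
     forall b, f b (s + n%:R) = 0).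

(** Multiplication by X^i Y^j (X + e Y)^k, where the last factor is expanded in
    nonnegative powers of Y. *)
Definition monom (e : R[i]) (i j k : int) f : ser2 := fun b s =>
  \sum_(l \in [set: nat])
    cbinom k%:~R l * e ^+ l *
    f (b + (i + k - l%:Z)%:~R) (s + (j + l%:Z)%:~R).

Lemma homog2_supp f s (j : int) : homog2 f -> exists N : nat,
  forall l : nat, (N <= l)%N -> forall b, f b (s + (j + l%:Z)%:~R) = 0.
Proof.
move=> [_ /(_ (s + j%:~R))[N fN]]; exists N => l Nl b.
by rewrite rmorphD/= addrA fN.
Qed.

Lemma monom_supp e i j k f b s : homog2 f -> exists N : nat,
  forall l : nat, (N <= l)%N -> cbinom k%:~R l * e ^+ l *
    f (b + (i + k - l%:Z)%:~R) (s + (j + l%:Z)%:~R) = 0.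
Proof.
move=> /(homog2_supp s j)[N fN]; exists N => l Nl.
by rewrite fN// mulr0.
Qed.

Lemma fin_supp_nat (V : nmodType) (F : nat -> V) (N : nat) :
  (forall l, (N <= l)%N -> F l = 0) -> fin_supp F.
Proof.
by move=> FN; exists (iota 0 N) => i; rewrite mem_iota add0n -leqNgt; exact: FN.
Qed.

Lemma homog2_0 : homog2 0.
Proof. by split; [exists [::]|move=> s; exists 0%N]. Qed.

Lemma homog2D f g : homog2 f -> homog2 g -> homog2 (f + g).
Proof.
move=> [[S fS] fN] [[S' gS] gN]; split.
  exists (S ++ S') => b s; rewrite mem_cat => /norP[/fS fbs /gS gbs].
  by change (f b s + g b s = 0); rewrite fbs gbs addr0.
move=> s; have [N fN'] := fN s; have [N' gN'] := gN s; exists (N + N')%N => n nN b.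
change (f b (s + n%:R) + g b (s + n%:R) = 0).
by rewrite fN' ?gN' ?addr0//; lia.
Qed.

Lemma homog2Z a f : homog2 f -> homog2 (a *: f).
Proof.
move=> [[S fS] fN]; split.
  by exists S => b s /fS fbs; change (a * f b s = 0); rewrite fbs mulr0.
move=> s; have [N fN'] := fN s; exists N => n nN b.
by change (a * f b (s + n%:R) = 0); rewrite fN' ?mulr0.
Qed.

Lemma homog2_sum (I : Type) (r : seq I) (F : I -> ser2) :
  (forall i, homog2 (F i)) -> homog2 (\sum_(i <- r) F i).
Proof.
by move=> Fh; elim/big_ind: _ => //; [exact: homog2_0|exact: homog2D].
Qed.

Lemma homog2_monom e i j k f : homog2 f -> homog2 (monom e i j k f).
Proof.
move=> fh; have [[S fS] _] := fh; split.
  exists [seq q - (i + j + k)%:~R | q <- S] => b s bs; apply: fsum_eq0 => l.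
  rewrite fS ?mulr0//; apply: contra bs => bs; apply/mapP.
  by eexists; [exact: bs|rewrite !rmorphD/= rmorphN/=; ring].
move=> s; have [N fN] := homog2_supp s j fh; exists N => n Nn b.
apply: fsum_eq0 => l.
have -> : s + n%:R + (j + l%:Z)%:~R = s + (j + (n + l)%N%:Z)%:~R.
  by rewrite PoszD !rmorphD/=; ring.
by rewrite fN ?mulr0//; lia.
Qed.

Lemma monomD e i j k f g : homog2 f -> homog2 g ->
  monom e i j k (f + g) = monom e i j k f + monom e i j k g.
Proof.
move=> fh gh; apply/funext => b; apply/funext => s.
change (monom e i j k (f + g) b s = monom e i j k f b s + monom e i j k g b s).
have [N fN] := monom_supp e i j k b s fh.
have [M gM] := monom_supp e i j k b s gh.
rewrite /monom -fsumD; [|exact: fin_supp_nat fN|exact: fin_supp_nat gM].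
by apply: fsum_eq => l; rewrite -mulrDr.
Qed.

Lemma monomZ e i j k a f : monom e i j k (a *: f) = a *: monom e i j k f.
Proof.
apply/funext => b; apply/funext => s.
change (monom e i j k (a *: f) b s = a * monom e i j k f b s).
by rewrite /monom fsumM; apply: fsum_eq => l; rewrite mulrCA.
Qed.

Lemma monom_shift e i j f b s : monom e i j 0 f b s = f (b + i%:~R) (s + j%:~R).
Proof.
rewrite /monom (@fsum_single _ _ 0%N) => [|[|l]//= _].
  by rewrite cbinom0 expr0 !mul1r subr0 !addr0.
by rewrite (@cbinom_small _ 0)// !mul0r.
Qed.

Lemma monom_id e f : monom e 0 0 0 f = f.
Proof.
by apply/funext => b; apply/funext => s; rewrite monom_shift !addr0.
Qed.

(** Vandermonde's identity makes the expansions of (X + e Y)^k multiplicative in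
    the integer k, negative exponents included. *)
Lemma monomM e i j k i' j' k' f : homog2 f ->
  monom e i j k (monom e i' j' k' f) = monom e (i + i') (j + j') (k + k') f.
Proof.
move=> fh; apply/funext => b; apply/funext => s.
have [N fN] := homog2_supp s (j + j') fh.
pose F l m := (cbinom k%:~R l * e ^+ l) * ((cbinom k'%:~R m * e ^+ m) *
    f (b + (i + i' + (k + k') - (l + m)%N%:Z)%:~R)
      (s + (j + j' + (l + m)%N%:Z)%:~R)).
transitivity (\sum_(l \in [set: nat]) \sum_(m \in [set: nat]) F l m).
  rewrite /monom; apply: fsum_eq => l; rewrite fsumM; apply: fsum_eq => m.
  rewrite /F; congr (_ * (_ * f _ _)); rewrite -addrA -rmorphD/=;
    by congr (_ + _%:~R); lia.
rewrite (@fsum_antidiag _ F N) => [|l m lm]; last by rewrite /F fN// !mulr0.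
rewrite /monom; apply: fsum_eq => n.
rewrite rmorphD/= cbinom_vandermonde !mulr_suml; apply: eq_bigr => l _.
have ln : (l <= n)%N by rewrite -ltnS.
rewrite /F subnKC//.
have -> : e ^+ n = e ^+ l * e ^+ (n - l) by rewrite -exprD subnKC.
by rewrite !mulrA; congr (_ * _); ring.
Qed.

Lemma monom_add e f : monom e 0 0 1 f = monom e 1 0 0 f + e *: monom e 0 1 0 f.
Proof.
apply/funext => b; apply/funext => s.
change (monom e 0 0 1 f b s = monom e 1 0 0 f b s + e * monom e 0 1 0 f b s).
rewrite !monom_shift /monom (@fsum_ord _ _ 2) => [|[|[|l]]//= _]; last first.
  by rewrite (@cbinom_small _ 1)// !mul0r.
by rewrite !big_ord_recl big_ord0/= cbinom0 cbinom1 expr0 expr1 !mul1r !addr0.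
Qed.

End TwoVariables.
Arguments ser2 : clear implicits.

(** * Specializing one of the two variables *)

Section Specializations.
Context {R : realType}.
Variable l : R[i].
Let z := cexp l.
Implicit Types (f g : ser2 R) (b s p : R[i]).

(** The big variable takes the value z, with powers taken on the branch of the
    logarithm l.  In [spec_small] the small variable does, and in [spec_sum] the
    sum of both does: there big = z - t is expanded in the small variable t. *)
Definition spec_big f : cser R := fun p =>
  \sum_(b \in [set: R[i]]) f b (- p - 1) * cpow l (- b - 1).

Definition spec_small f : cser R := fun p =>
  \sum_(s \in [set: R[i]]) f (- p - 1) s * cpow l (- s - 1).

Definition spec_sum f : cser R := fun p =>
  \sum_(m \in [set: nat]) \sum_(b \in [set: R[i]])
    f b (m%:R - p - 1) *
    (cbinom (- b - 1) m * cpow l (- b - 1 - m%:R) * (-1) ^+ m).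

Record specialization sg (Sp : ser2 R -> cser R) : Prop := {
  specD : forall f g, homog2 f -> homog2 g -> Sp (f + g) = Sp f + Sp g;
  specZ : forall a f, Sp (a *: f) = a *: Sp f;
  spec_trunc : forall f, homog2 f -> truncated sg (Sp f) }.

Lemma supp_big f s (c : R[i] -> R[i]) :
  homog2 f -> fin_supp (fun b => f b s * c b).
Proof.
move=> [[S fS] _]; exists [seq q - s | q <- S] => b bS.
rewrite fS ?mul0r//; apply: contra bS => bS; apply/mapP.
by eexists; [exact: bS|rewrite addrK].
Qed.

Lemma fin_suppM (T : choiceType) (a : R[i]) (F : T -> R[i]) :
  fin_supp F -> fin_supp (fun t => a * F t).
Proof. by move=> [S FS]; exists S => t /FS ->; rewrite mulr0. Qed.

Lemma supp_small f b (c : R[i] -> R[i]) :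
  homog2 f -> fin_supp (fun s => f b s * c s).
Proof.
move=> [[S fS] _]; exists [seq q - b | q <- S] => s bS.
rewrite fS ?mul0r//; apply: contra bS => bS; apply/mapP.
by eexists; [exact: bS|rewrite addrC addKr].
Qed.

Lemma spec_big_specialization : specialization true spec_big.
Proof.
split=> [f g fh gh|a f|f [_ ft] p].
- apply/funext => p; change (spec_big (f + g) p = spec_big f p + spec_big g p).
  rewrite /spec_big -fsumD; [|exact: supp_big..].
  by apply: fsum_eq => b; rewrite -mulrDl; congr (_ * _).
- apply/funext => p; change (spec_big (a *: f) p = a * spec_big f p).
  by rewrite /spec_big fsumM; apply: fsum_eq => b; rewrite [RHS]mulrA; congr (_ * _).
- have [N fN] := ft (- p - 1); exists N => n Nn; apply: fsum_eq0 => b.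
  have -> : - (p - (dirz true n)%:~R) - 1 = - p - 1 + n%:R by rewrite /=; ring.
  by rewrite fN// mul0r.
Qed.

(** The total degrees form a finite set, so a large positive power of the big
    variable forces a power of the small one that is already truncated. *)
Lemma spec_small_specialization : specialization false spec_small.
Proof.
split=> [f g fh gh|a f|f fh p].
- apply/funext => p.
  change (spec_small (f + g) p = spec_small f p + spec_small g p).
  rewrite /spec_small -fsumD; [|exact: supp_small..].
  by apply: fsum_eq => b; rewrite -mulrDl; congr (_ * _).
- apply/funext => p; change (spec_small (a *: f) p = a * spec_small f p).
  by rewrite /spec_small fsumM; apply: fsum_eq => b; rewrite [RHS]mulrA; congr (_ * _).
- have [[S fS] ft] := fh.
  have [N fN] : exists N : nat, forall q, q \in S -> forall n, (N <= n)%N ->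
      forall b, f b (q + p + 1 + n%:R) = 0.
    elim: S {fS} => [|q S [N fN]]; first by exists 0%N.
    have [M fM] := ft (q + p + 1); exists (N + M)%N => q'.
    rewrite inE => /predU1P[-> n Nn b|q'S n Nn b]; first by rewrite fM//; lia.
    by rewrite fN//; lia.
  exists N => n Nn; apply: fsum_eq0 => s.
  have -> : - (p - (dirz false n)%:~R) - 1 = - p - 1 - n%:R.
    by rewrite /= rmorphN/=; ring.
  have [bS|bS] := boolP (- p - 1 - n%:R + s \in S); last by rewrite fS// mul0r.
  have -> : s = - p - 1 - n%:R + s + p + 1 + n%:R by ring.
  by rewrite fN// mul0r.
Qed.

Lemma spec_sum_supp f p : homog2 f -> exists N, forall m, (N <= m)%N ->
  \sum_(b \in [set: R[i]]) f b (m%:R - p - 1) *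
    (cbinom (- b - 1) m * cpow l (- b - 1 - m%:R) * (-1) ^+ m) = 0.
Proof.
move=> [_ /(_ (- p - 1))[N fN]]; exists N => m Nm; apply: fsum_eq0 => b.
by rewrite -addrA addrC fN// mul0r.
Qed.

Lemma spec_sum_specialization : specialization true spec_sum.
Proof.
split=> [f g fh gh|a f|f [_ ft] p].
- apply/funext => p; change (spec_sum (f + g) p = spec_sum f p + spec_sum g p).
  have [N fN] := spec_sum_supp p fh; have [M gM] := spec_sum_supp p gh.
  rewrite /spec_sum -fsumD; [|exact: fin_supp_nat fN|exact: fin_supp_nat gM].
  apply: fsum_eq => m; rewrite -fsumD; [|exact: supp_big..].
  by apply: fsum_eq => b; rewrite -mulrDl; congr (_ * _).
- apply/funext => p; change (spec_sum (a *: f) p = a * spec_sum f p).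
  rewrite /spec_sum fsumM; apply: fsum_eq => m; rewrite fsumM.
  by apply: fsum_eq => b; rewrite [RHS]mulrA; congr (_ * _).
- have [N fN] := ft (- p - 1); exists N => n Nn.
  apply: fsum_eq0 => m; apply: fsum_eq0 => b.
  have -> : m%:R - (p - (dirz true n)%:~R) - 1 = - p - 1 + (n + m)%:R.
    by rewrite /= natrD; ring.
  by rewrite fN ?mul0r//; lia.
Qed.

Lemma fsum_Posz (V : nmodType) (F : int -> V) : (forall n, F (Negz n) = 0) ->
  \sum_(n \in [set: int]) F n = \sum_(n \in [set: nat]) F n%:Z.
Proof.
move=> F0; rewrite -(@fsbig_widen _ _ _ _ (range Posz)) ?fsbig_image//.
- by move=> i j _ _ [].
- by move=> [n|n] [_ Hn]; [case: Hn; exists n|exact: F0].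
Qed.

Lemma lact_iota a c k (f : cser R) p : lact (iota_pow a c k) f p =
  \sum_(n \in [set: nat]) cbinom k%:~R n * a ^ (k - n%:Z) * c ^+ n * f (p - n%:R).
Proof. by rewrite /lact fsum_Posz// => n; rewrite mul0r. Qed.

Lemma lact_iota1 a c (f : cser R) p :
  lact (iota_pow a c 1) f p = a * f p + c * f (p - 1).
Proof.
rewrite lact_iota (@fsum_ord _ _ 2) => [|n n2]; last first.
  by rewrite (@cbinom_small _ 1)// !mul0r.
rewrite !big_ord_recl big_ord0/= cbinom0 cbinom1 addr0 !subr0 subrr.
by rewrite expr0z expr1z expr0 expr1 !mul1r mulr1 addr0.
Qed.

Lemma fsum_translate (V : nmodType) (c : R[i]) (F : R[i] -> V) :
  \sum_(b \in [set: R[i]]) F b = \sum_(b \in [set: R[i]]) F (b - c).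
Proof.
by apply: (@fsum_reindex _ _ _ _ (fun b => b + c)) => b; rewrite (addrK, subrK).
Qed.

Lemma spec_big_monom e i j k f : homog2 f ->
  spec_big (monom e i j k f) =
  z ^ i *: lact (lmon j) (lact (iota_pow z e k) (spec_big f)).
Proof.
move=> fh; apply/funext => p.
change (spec_big (monom e i j k f) p =
  z ^ i * lact (lmon j) (lact (iota_pow z e k) (spec_big f)) p).
rewrite lact_mon lact_iota /spec_big /monom.
have [[S fS] _] := fh; have [N fN] := homog2_supp (- p - 1) j fh.
pose F b n := cbinom k%:~R n * e ^+ n *
    f (b + (i + k - n%:Z)%:~R) (- p - 1 + (j + n%:Z)%:~R) * cpow l (- b - 1).
transitivity (\sum_(b \in [set: R[i]]) \sum_(n \in [set: nat]) F b n).
  by apply: fsum_eq => b; rewrite fsumMr.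
rewrite (@exchange_fsum _ _ _ _ [seq q - (i + j + k)%:~R + p + 1 | q <- S] (iota 0 N))
  => [|b n Fbn]; last first.
  apply/andP; split; last first.
    rewrite mem_iota/= add0n ltnNge; apply: contra Fbn => Nn.
    by rewrite /F fN// mulr0 mul0r.
  apply: contraNT Fbn => bS; rewrite /F fS ?mulr0 ?mul0r//.
  apply: contra bS => bS; apply/mapP.
  by eexists; [exact: bS|rewrite !rmorphD/= rmorphN/=; ring].
rewrite fsumM; apply: fsum_eq => n.
rewrite (fsum_translate (i + k - n%:Z)%:~R) !fsumM; apply: fsum_eq => b.
rewrite /F subrK.
have -> : - p - 1 + (j + n%:Z)%:~R = - (p - j%:~R - n%:R) - 1.
  by rewrite rmorphD/=; ring.
have -> : - (b - (i + k - n%:Z)%:~R) - 1 = (- b - 1) + (i + k - n%:Z)%:~R by ring.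
have zu : z != 0 by rewrite /z -cpow1 cpow_neq0.
rewrite cpowD cpow_int -[i + k - _]addrA expfzDr// -/z; ring.
Qed.

Lemma spec_small_shift e i j f :
  spec_small (monom e i j 0 f) = z ^ j *: lact (lmon i) (spec_small f).
Proof.
apply/funext => p.
change (spec_small (monom e i j 0 f) p = z ^ j * lact (lmon i) (spec_small f) p).
rewrite lact_mon /spec_small (fsum_translate j%:~R) fsumM; apply: fsum_eq => s.
rewrite monom_shift subrK.
have -> : - p - 1 + i%:~R = - (p - i%:~R) - 1 by ring.
have -> : - (s - j%:~R) - 1 = (- s - 1) + j%:~R by ring.
by rewrite cpowD cpow_int -/z; ring.
Qed.

Lemma spec_sum_shift e j f :
  spec_sum (monom e 0 j 0 f) = lact (lmon j) (spec_sum f).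
Proof.
apply/funext => p; rewrite lact_mon /spec_sum.
apply: fsum_eq => m; apply: fsum_eq => b; rewrite monom_shift addr0.
by congr (f _ _ * _); ring.
Qed.

(** The big variable becomes z - t: its action is Pascal's rule for the
    coefficients of the expansion of (z - t)^(-b-1). *)
Lemma spec_sum_big e f : homog2 f ->
  spec_sum (monom e 1 0 0 f) = lact (iota_pow z (-1) 1) (spec_sum f).
Proof.
move=> fh; apply/funext => p; rewrite lact_iota1 /spec_sum.
have [N fN] := spec_sum_supp p fh; have [M fM] := spec_sum_supp (p - 1) fh.
have [K fK] := spec_sum_supp p (homog2_monom e 1 0 0 fh).
pose L := (N + M + K)%N.
rewrite (@fsum_ord _ _ L.+1) => [|m Lm]; last by apply: fK; rewrite /L in Lm; lia.
rewrite [X in z * X](@fsum_ord _ _ L.+1) => [|m Lm]; last first.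
  by apply: fN; rewrite /L in Lm; lia.
rewrite [X in -1 * X](@fsum_ord _ _ L) => [|m Lm]; last first.
  by apply: fM; rewrite /L in Lm; lia.
rewrite 2!big_ord_recl mulrDr -[RHS]addrA; congr (_ + _).
  rewrite (fsum_translate 1) fsumM; apply: fsum_eq => b.
  rewrite monom_shift subrK addr0 !cbinom0 expr0 /= !subr0.
  have -> : - (b - 1) - 1 = (- b - 1) + 1 by ring.
  by rewrite cpowD cpow1 -/z; ring.
rewrite !mulr_sumr -big_split; apply: eq_bigr => m _ /=.
rewrite (fsum_translate 1) fsumM fsumM -fsumD; last 2 first.
- by apply: fin_suppM; exact: supp_big.
- by apply: fin_suppM; exact: supp_big.
apply: fsum_eq => b; rewrite monom_shift subrK addr0 /bump/= add1n.
have -> : - (b - 1) - 1 = (- b - 1) + 1 by ring.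
rewrite cbinom_pascal.
have -> : - b - 1 + 1 - m.+1%:R = - b - 1 - m%:R by rewrite -natr1; ring.
have -> : m%:R - (p - 1) - 1 = m.+1%:R - p - 1 by rewrite -natr1; ring.
have -> : - b - 1 - m%:R = (- b - 1 - m.+1%:R) + 1 by rewrite -natr1; ring.
by rewrite cpowD cpow1 -/z exprS; ring.
Qed.

(** Since big + small becomes (z - t) + t = z; the inverse powers follow because
    the monomials act invertibly. *)
Lemma spec_sum_sum k f : homog2 f ->
  spec_sum (monom 1 0 0 k f) = z ^ k *: spec_sum f.
Proof.
have zu : z != 0 by rewrite /z -cpow1 cpow_neq0.
have spec1 g : homog2 g -> spec_sum (monom 1 0 0 1 g) = z *: spec_sum g.
  move=> gh; rewrite monom_add scale1r.
  rewrite (specD spec_sum_specialization); [|exact: homog2_monom..].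
  rewrite spec_sum_big// spec_sum_shift; apply/funext => p.
  change (lact (iota_pow z (-1) 1) (spec_sum g) p +
    lact (lmon 1) (spec_sum g) p = z * spec_sum g p).
  by rewrite lact_iota1 lact_mon; ring.
have specV g : homog2 g -> spec_sum (monom 1 0 0 (-1) g) = z^-1 *: spec_sum g.
  move=> gh; have := spec1 _ (homog2_monom 1 0 0 (-1) gh).
  by rewrite monomM// !addr0 subrr monom_id => ->; rewrite scalerA mulVf// scale1r.
move=> fh; case: k => n; elim: n => [|n IH].
- by rewrite monom_id expr0z scale1r.
- rewrite intS -[0 in LHS]addr0 -monomM// spec1 ?IH ?scalerA -?expfzDr ?intS//.
    by rewrite -exprSz -intS.
  exact: homog2_monom.
- exact: specV.
- have -> : Negz n.+1 = -1 + Negz n by lia.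
  rewrite -[0 in LHS]addr0 -monomM// specV ?IH ?scalerA ?expfzDr//.
  exact: homog2_monom.
Qed.

End Specializations.

(** * Generalized weights and the canonical grading *)

Section LinearMaps.
Context {R : realType} {E E' : lmodType R[i]}.
Variable f : E -> E'.
Hypothesis fL : linear f.

Lemma lin0 : f 0 = 0.
Proof. by have := fL (-1) 0 0; rewrite scaler0 addr0 scaleN1r addNr. Qed.

Lemma linD x y : f (x + y) = f x + f y.
Proof. by have := fL 1 x y; rewrite !scale1r. Qed.

Lemma linZ a x : f (a *: x) = a *: f x.
Proof. by have := fL a x 0; rewrite lin0 !addr0. Qed.

Lemma linN x : f (- x) = - f x.
Proof. by rewrite -scaleN1r linZ scaleN1r. Qed.

Lemma linB x y : f (x - y) = f x - f y.
Proof. by rewrite linD linN. Qed.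

Lemma lin_sum (I : Type) (r : seq I) (P : pred I) (F : I -> E) :
  f (\sum_(i <- r | P i) F i) = \sum_(i <- r | P i) f (F i).
Proof. exact: (big_morph f linD lin0). Qed.

Lemma lin_fsum (T : choiceType) (F : T -> E) : fin_supp F ->
  f (\sum_(i \in [set: T]) F i) = \sum_(i \in [set: T]) f (F i).
Proof. exact: fsum_morph lin0 linD. Qed.

End LinearMaps.

Section Commutators.
Context {R : realType} {V : voa R} {W : vmodule V}.
Implicit Types (w x : W) (a b : V).

Lemma act_linear a n : linear (act (v:=W) a n).
Proof. by have [_ []] := vmoduleP W. Qed.

Lemma act_linear_l n w : linear (fun a => act a n w).
Proof. by have [] := vmoduleP W. Qed.

Lemma act_trunc a w : exists N : nat, forall j : nat, (N <= j)%N -> act a j%:Z w = 0.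
Proof. by have [_ [_ []]] := vmoduleP W. Qed.

Lemma act_vacuum n w : act (vacuum V) n w = if n == -1 then w else 0.
Proof. by have [_ [_ [_ []]]] := vmoduleP W. Qed.

Lemma borcherds a b w (p q r : int) :
  \sum_(i \in [set: nat])
     cbinom p%:~R i *: act (mode a (r + i%:Z) b) (p + q - i%:Z) w =
  \sum_(i \in [set: nat])
     ((-1) ^+ i * cbinom r%:~R i) *:
       (act a (p + r - i%:Z) (act b (q + i%:Z) w)
        - (-1) ^ r *: act b (q + r - i%:Z) (act a (p + i%:Z) w)).
Proof. by have [_ [_ [_ [_ ]]]] := vmoduleP W. Qed.

(** Both sides produce L(-1) b: the creation property recovers a state from its
    mode -1 on the vacuum, and L(-1) acts there as a derivative. *)
Lemma conformal0_creation b : mode (conformal V) 0 b = mode b (-2) (vacuum V).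
Proof.
have [_ [cr [_ [_ [der _]]]]] := voaP V.
rewrite -[LHS]cr; have := der b (-1) (vacuum V).
by rewrite addNr mulrN1z scaleN1r opprK => ->; congr (mode b _ _).
Qed.

(** The derivative property passes from the algebra to its modules because
    L(-1) b = b_(-2) 1, and the modes of b_(-2) 1 are computed by the Borcherds
    identity, where the vacuum leaves a single term. *)
Lemma act_derivative b q w :
  act (mode (conformal V) 0 b) q w = - (q%:~R *: act b (q - 1) w).
Proof.
rewrite conformal0_creation.
have := borcherds b (vacuum V) w 0 q (-2).
rewrite (@fsum_single _ _ 0%N) => [|[|i]//= _]; last first.
  by rewrite (@cbinom_small _ 0)// scale0r.
rewrite cbinom0 scale1r add0r subr0 addr0 => ->.
have c2 i : (-1) ^+ i * cbinom (-2)%:~R i = i.+1%:R :> R[i].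
  have -> : (-2)%:~R = - 1 - 1%:R :> R[i] by ring.
  rewrite cbinom_neg mulrA -expr2 sqrr_sign mul1r add1n bin1//.
have -> : (-1 : R[i]) ^ (-2) = 1 by rewrite -[-2]/(- (2%:Z)) -exprnN sqrrN expr1n invr1.
case: q => [[|q]|q].
- rewrite scale0r oppr0; apply: fsum_eq0 => i; rewrite !act_vacuum.
  case: eqP => [|_]; first by lia.
  case: eqP => [|_]; first by lia.
  by rewrite (lin0 (act_linear _ _)) scaler0 subrr scaler0.
- rewrite (@fsum_single _ _ q) => [|i iq]; rewrite !act_vacuum.
    case: eqP => [|_]; first by lia.
    case: eqP => [_|]; last by lia.
    rewrite (lin0 (act_linear _ _)) c2 sub0r !scale1r scalerN add0r.
    by congr (- (_ *: act _ _ _)); lia.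
  case: eqP => [|_]; first by lia.
  case: eqP => [|_]; first by lia.
  by rewrite (lin0 (act_linear _ _)) scaler0 subrr scaler0.
- rewrite (@fsum_single _ _ q) => [|i iq]; rewrite !act_vacuum.
    case: eqP => [_|]; last by lia.
    case: eqP => [|_]; first by lia.
    rewrite c2 scaler0 subr0 NegzE mulrNz scaleNr opprK.
    by congr (_ *: act _ _ _); lia.
  case: eqP => [|_]; first by lia.
  case: eqP => [|_]; first by lia.
  by rewrite (lin0 (act_linear _ _)) scaler0 subrr scaler0.
Qed.

(** The commutator of L(0) = omega_1 with a_k consists of (omega_0 a)_(k+1) and
    (omega_1 a)_k; the first is a derivative and the second sees the weight. *)
Lemma L0_act a n k w : has_wt a n ->
  L0 (act a k w) = act a k (L0 w) + (n - k - 1)%:~R *: act a k w.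
Proof.
move=> an; have := borcherds (conformal V) a w 1 k 0.
rewrite [X in _ = X -> _](@fsum_single _ _ 0%N) => [|[|i]//= _]; last first.
  by rewrite (@cbinom_small _ 0)// mulr0 scale0r.
rewrite cbinom0 expr0 mulr1 !scale1r.
have -> : 1 + 0 - 0%:Z = 1 by lia.
have -> : k + 0 - 0%:Z = k by lia.
rewrite !addr0 => /eqP.
rewrite (@fsum_ord _ _ 2) => [|i i2]; last first.
  by rewrite (@cbinom_small _ 1)// scale0r.
rewrite !big_ord_recl big_ord0/= cbinom0 cbinom1 !scale1r addr0 !add0r.
have -> : (bump 0 0)%:Z = 1 by [].
have -> : 1 + k - 0%:Z = k + 1 by lia.
have -> : 1 + k - 1 = k by lia.
have -> : mode (conformal V) 1 a = n%:~R *: a by exact: an.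
rewrite addr0 act_derivative (linZ (act_linear_l _ _)) addrK.
rewrite [_ == _]eq_sym subr_eq [X in _ == X]addrC => /eqP; rewrite /L0 => ->; congr (_ + _).
rewrite -scaleNr -scalerDl; congr (_ *: _).
by rewrite !rmorphB/= rmorphD/=; ring.
Qed.

End Commutators.

Section Weights.
Context {R : realType} {V : voa R} {W : vmodule V}.
Implicit Types (w x : W) (a b : V) (lambda mu : R[i]).

Definition wshift lambda w : W := L0 w - lambda *: w.

Lemma L0_linear : linear (@L0 R V W).
Proof. exact: act_linear. Qed.

Lemma wshift_linear lambda : linear (wshift lambda).
Proof.
move=> c x y; rewrite /wshift L0_linear scalerBr scalerDr !scalerA.
by rewrite (mulrC c) opprD addrACA.
Qed.

Lemma iter_linear (f : W -> W) n : linear f -> linear (iter n f).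
Proof. by move=> fL; elim: n => // n IH c x y; rewrite !iterS IH fL. Qed.

Lemma iter_wshift0 lambda n : iter n (wshift lambda) 0 = 0.
Proof. exact: (lin0 (iter_linear n (wshift_linear lambda))). Qed.

Lemma gen0 lambda : L0_gen_eigen lambda (0 : W).
Proof. by exists 0%N. Qed.

(** Such an f intertwines L(0) - lambda and L(0) - (lambda + d), hence all their
    powers. *)
Lemma gen_map (f : W -> W) d lambda w : linear f ->
  (forall x, L0 (f x) = f (L0 x) + d *: f x) ->
  L0_gen_eigen lambda w -> L0_gen_eigen (lambda + d) (f w).
Proof.
move=> fL fd [n wn]; exists n; rewrite -/(wshift (lambda + d)).
suff -> x : iter n (wshift (lambda + d)) (f x) = f (iter n (wshift lambda) x).
  by rewrite wn (lin0 fL).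
elim: n x {wn} => // n IH x; rewrite !iterSr -IH; congr (iter n _ _).
rewrite /wshift fd (linB fL) (linZ fL) scalerDl opprD addrACA.
by rewrite subrr addr0.
Qed.

Lemma gen_comm (f : W -> W) lambda w : linear f ->
  (forall x, L0 (f x) = f (L0 x)) ->
  L0_gen_eigen lambda w -> L0_gen_eigen lambda (f w).
Proof.
move=> fL fL0 /(@gen_map _ 0 _ _ fL); rewrite addr0; apply=> x.
by rewrite scale0r addr0.
Qed.

Lemma gen_act a n k lambda w : has_wt a n -> L0_gen_eigen lambda w ->
  L0_gen_eigen (lambda + (n - k - 1)%:~R) (act a k w).
Proof.
by move=> an; apply: gen_map => [|x]; [exact: act_linear|exact: L0_act].
Qed.

Lemma gen_L0 lambda w : L0_gen_eigen lambda w -> L0_gen_eigen lambda (L0 w).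
Proof. by apply: gen_comm => //; exact: L0_linear. Qed.

(** L(0) - lambda and L(0) - mu commute, so by induction on the nilpotency order w
    is an honest eigenvector, on which L(0) - mu acts by lambda - mu. *)
Lemma gen_disjoint lambda mu w : lambda != mu ->
  L0_gen_eigen lambda w -> L0_gen_eigen mu w -> w = 0.
Proof.
move=> lm [r + [s]]; rewrite -/(wshift lambda) -/(wshift mu).
have comm x : wshift lambda (wshift mu x) = wshift mu (wshift lambda x).
  rewrite /wshift !(linB L0_linear) !(linZ L0_linear) !scalerBr !scalerA.
  by rewrite (mulrC lambda) !opprD !opprK addrACA.
elim: r w => // r IH w; rewrite iterSr => wr ws.
have w1 : wshift lambda w = 0.
  apply: IH => //.
  have -> : iter s (wshift mu) (wshift lambda w) = wshift lambda (iter s (wshift mu) w).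
    by elim: s {ws} => // s IHs; rewrite !iterS IHs comm.
  by rewrite ws (lin0 (wshift_linear _)).
have lw n : iter n (wshift mu) w = (lambda - mu) ^+ n *: w.
  elim: n => [|n IHn]; first by rewrite scale1r.
  rewrite iterS IHn (linZ (wshift_linear _)) exprSr -scalerA; congr (_ *: _).
  by move/eqP: w1; rewrite /wshift subr_eq0 => /eqP ->; rewrite scalerBl.
move/eqP: ws; rewrite lw scaler_eq0 expf_eq0 subr_eq0 (negPf lm) andbF.
by move/eqP.
Qed.

End Weights.

Section Gradings.
Context {R : realType} {E : lmodType R[i]}.
Variable pr : nat -> E -> E.
Hypothesis prG : is_grading pr.
Implicit Types (x y : E).

Lemma pr_linear m : linear (pr m). Proof. by have [] := prG. Qed.

Lemma prpr m n x : pr m (pr n x) = if m == n then pr n x else 0.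
Proof. by have [] := prG. Qed.

Lemma pr_piece m x : piece pr m (pr m x).
Proof. by rewrite /piece/= prpr eqxx. Qed.

Lemma pr_sum x : exists M : nat, (forall m, (M <= m)%N -> pr m x = 0) /\
  x = \sum_(m < M) pr m x.
Proof. by have [_ _] := prG. Qed.

Lemma piece0 m : piece pr m 0.
Proof. exact: (lin0 (pr_linear m)). Qed.

Lemma pieceD m x y : piece pr m x -> piece pr m y -> piece pr m (x + y).
Proof. by rewrite /piece/= => xm ym; rewrite (linD (pr_linear m)) xm ym. Qed.

Lemma piece_scale m a x : piece pr m x -> piece pr m (a *: x).
Proof. by rewrite /piece/= => xm; rewrite (linZ (pr_linear m)) xm. Qed.

Lemma piece_pr m n x : piece pr n x -> pr m x = if m == n then x else 0.
Proof. by move=> xn; rewrite -{1}xn prpr xn. Qed.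

Lemma pr_comm (f : E -> E) : linear f ->
  (forall m x, piece pr m x -> piece pr m (f x)) ->
  forall m x, pr m (f x) = f (pr m x).
Proof.
move=> fL fp m x; have [M [M0 {1}->]] := pr_sum x.
rewrite (lin_sum fL) (lin_sum (pr_linear m)).
rewrite (eq_bigr (fun i : 'I_M => if m == i then f (pr m x) else 0)) => [|i _].
  case: (ltnP m M) => mM.
    rewrite (bigD1 (Ordinal mM))//= eqxx big1 ?addr0// => i im.
    by case: eqP => // mi; move: im; rewrite -val_eqE/= mi eqxx.
  rewrite (M0 _ mM) (lin0 fL) big1// => i _.
  by case: ifP.
rewrite (piece_pr _ (fp _ _ (pr_piece i x))); case: eqP => // -> //.
Qed.

End Gradings.

Section CanonicalGrading.
Context {R : realType} {V : voa R} {W : vmodule V}.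
Variable pr : nat -> W -> W.
Hypothesis prC : canonical_grading pr.
Implicit Types (w x : W).

Let prG : is_grading pr. Proof. by have [] := prC. Qed.

(** The graded pieces are described summand by summand.  Uniqueness of the
    decomposition turns the projections onto the summands into module maps, and
    these respect the pieces, each of which is the sum of its parts. *)
Lemma canonical_components : exists n (p : 'I_n -> W -> W) (d : 'I_n -> R[i]),
  [/\ forall i a k x, p i (act a k x) = act a k (p i x),
      forall m w, piece pr m w ->
        forall i, L0_gen_eigen (d i + m%:R) (p i w),
      forall m w, (forall i, L0_gen_eigen (d i + m%:R) (p i w)) -> piece pr m w,
      forall w, w = \sum_i p i w &
      [/\ forall i, linear (p i),
          forall i j w, p i (p j w) = if i == j then p j w else 0 &
          forall m i x, pr m (p i x) = p i (pr m x)]].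
Proof.
have [_ [n [U [d [Usub Udec _ Up]]]]] := prC.
have sub i : subspace (U i) by have [[]] := Usub i.
have Uact i a k x : U i x -> U i (act a k x).
  by have [[_ Ua] _] := Usub i; exact: Ua.
have U0 i : U i 0 by have [] := sub i.
have UD i x y : U i x -> U i y -> U i (x + y).
  by move=> Ux Uy; rewrite -[x]scale1r; have [_] := sub i; exact.
have UZ i a x : U i x -> U i (a *: x).
  by move=> Ux; rewrite -[_ *: _]addr0; have [_] := sub i; apply.
have /choice [u uP] : forall w, exists u : {ffun 'I_n -> W},
    (forall i, U i (u i)) /\ w = \sum_i u i.
  by move=> w; have [u [uP _]] := Udec w; exists u.
have uniqu w (f : 'I_n -> W) : (forall i, U i (f i)) -> w = \sum_i f i ->
    forall i, u w i = f i.
  move=> Uf wf i; have [v [_ vu]] := Udec w.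
  have := vu _ (uP w) => <-.
  have -> : v = [ffun i => f i]; last by rewrite ffunE.
  apply: vu; split=> [j|]; first by rewrite ffunE.
  by rewrite wf; apply: eq_bigr => j _; rewrite ffunE.
pose p i w := u w i.
have UP i w : U i (p i w) by have [] := uP w.
have psum w : w = \sum_i p i w by have [] := uP w.
have pL i : linear (p i).
  move=> a x y; apply: (uniqu (a *: x + y) (fun j => a *: p j x + p j y)).
    by move=> j; apply: (UD); [exact: (UZ)|].
  by rewrite big_split/= -scaler_sumr -!psum.
have pp i j w : p i (p j w) = if i == j then p j w else 0.
  apply: (uniqu (p j w) (fun i => if i == j then p j w else 0)).
    by move=> k; case: eqP => // ->.
  by rewrite -big_mkcond big_pred1_eq.
have pact i a k x : p i (act a k x) = act a k (p i x).
  apply: (uniqu _ (fun i => act a k (p i x))) => [j|]; first exact: Uact.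
  by rewrite -(lin_sum (act_linear a k)) -psum.
have pgen m w : piece pr m w -> forall i, L0_gen_eigen (d i + m%:R) (p i w).
  move=> /Up[v [vU wv]] i; rewrite /p (uniqu _ _ _ wv); first by have [] := vU i.
  by move=> j; have [] := vU j.
have genp m w : (forall i, L0_gen_eigen (d i + m%:R) (p i w)) -> piece pr m w.
  by move=> wm; apply/Up; exists (fun i => p i w); split.
exists n, p, d; split=> //; split=> // m i x.
apply: (pr_comm prG) => // {}m {}x xm; apply: genp => j; rewrite pp.
by case: eqP => [->|_]; [exact: pgen|exact: gen0].
Qed.

Lemma pr_L0 m x : pr m (L0 x) = L0 (pr m x).
Proof.
have [n [p [d [pact pgen genp _ _]]]] := canonical_components.
apply: (pr_comm prG) => [|{}m {}x xm]; first exact: L0_linear.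
by apply: genp => i; rewrite pact; apply: gen_L0; exact: pgen.
Qed.

(** The mode a_k shifts generalized weights by wt a - k - 1.  A negative degree
    would be a generalized weight below the lowest one of its summand, and every
    graded component of such a vector has two different generalized weights. *)
Lemma piece_act a n k m w : has_wt a n -> piece pr m w ->
  pieceZ pr (m%:Z + n - k - 1) (act a k w).
Proof.
move=> an wm.
have [q [p [d [pact pgen genp psum [pL pp prp]]]]] := canonical_components.
have pg i : L0_gen_eigen (d i + (m%:Z + n - k - 1)%:~R) (p i (act a k w)).
  rewrite pact; have := gen_act k an (pgen _ _ wm i); congr L0_gen_eigen.
  by rewrite !rmorphB/= rmorphD/=; ring.
case: (m%:Z + n - k - 1) pg => e pg; first exact: genp.
rewrite /= [LHS]psum big1// => i _; set x := p i (act a k w).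
have xpr r : pr r x = 0.
  have : pr r x = p i (pr r x) by rewrite -prp /x pp eqxx.
  move=> ->; apply: (@gen_disjoint _ _ _ (d i + (Negz e)%:~R) (d i + r%:R)).
  - rewrite (inj_eq (addrI _)) -[r%:R]/((r%:Z)%:~R) eqr_int //.
  - apply: gen_comm => //; first by move=> y; rewrite /L0 pact.
    by apply: gen_comm; [exact: pr_linear|by move=> y; rewrite pr_L0|exact: pg].
  - by apply: pgen; exact: pr_piece.
by have [M [_ ->]] := pr_sum prG x; rewrite big1.
Qed.

Lemma piece_gen m w : piece pr m w -> exists n (u : 'I_n -> W) (d : 'I_n -> R[i]),
  (forall i, L0_gen_eigen (d i) (u i)) /\ w = \sum_i u i.
Proof.
have [n [p [d [_ pgen _ psum _]]]] := canonical_components => wm.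
by exists n, (p^~ w), (fun i => d i + m%:R); split=> // i; exact: pgen.
Qed.

(** Each piece carries finitely many generalized weights, one per summand. *)
Lemma dual_le_gen N theta : dual_le pr N theta ->
  exists S : seq R[i], forall lambda x,
    L0_gen_eigen lambda x -> lambda \notin S -> theta x = 0.
Proof.
move=> [thL th0].
have [n [p [d [pact pgen genp psum [pL pp prp]]]]] := canonical_components.
exists [seq d i + m%:R | i <- enum 'I_n, m <- iota 0 N.+1] => lambda x xl lS.
have [M [_ ->]] := pr_sum prG x; rewrite (lin_sum thL) big1// => m _.
case: (ltnP N m) => [Nm|mN]; first by apply: (th0 m); [|exact: pr_piece].
suff -> : pr m x = 0 by exact: lin0.
rewrite [LHS]psum big1// => i _.
apply: (@gen_disjoint _ _ _ lambda (d i + m%:R)).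
- apply: contraNneq lS => ->; apply/allpairsP; exists (i, nat_of_ord m).
  by rewrite mem_enum mem_iota/= add0n ltnS.
- apply: gen_comm => //; first by move=> y; rewrite /L0 pact.
  by apply: gen_comm => //; [exact: pr_linear|by move=> y; rewrite pr_L0].
- by apply: pgen; exact: pr_piece.
Qed.

End CanonicalGrading.

(** * Logarithmic intertwining operators *)

Section Intertwining.
Context {R : realType} {V : voa R} {A B D : vmodule V}.
Variable Y : intw A B D.
Hypothesis YP : log_intertwining Y.
Implicit Types (v : A) (u : B) (s lambda mu : R[i]).

Lemma Y_linear_l h s u : linear (fun v => Y v h s u).
Proof. by have [] := YP. Qed.

Lemma Y_linear_r v h s : linear (Y v h s).
Proof. by have [_ []] := YP. Qed.

Lemma Y_log : exists K : nat, forall v h s u, (K < h)%N -> Y v h s u = 0.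
Proof. by have [_ [_ []]] := YP. Qed.

Lemma Y_trunc v h s u : exists N : nat, forall n : nat, (N <= n)%N ->
  Y v h (s + n%:R) u = 0.
Proof.
by have [_ [_ [_ [/(_ v u s)[N YN] _]]]] := YP; exists N => n Nn; apply: YN.
Qed.

Lemma Y_commutator (a : V) (m : int) v h s u :
  Y v h s (act a m u) = act a m (Y v h s u) - \sum_(j \in [set: nat])
    cbinom m%:~R j *: Y (act a j%:Z v) h (s + m%:~R - j%:R) u.
Proof.
have [_ [_ [_ [_ [/(_ a m v h s u) <- _]]]]] := YP.
by rewrite opprB addrC subrK.
Qed.

Lemma Y_associator (a : V) (m : int) v h s u :
  Y (act a m v) h s u = \sum_(j \in [set: nat])
    (cbinom m%:~R j * (-1) ^+ j) *: (act a (m - j%:Z) (Y v h (s + j%:R) u)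
      - (-1) ^ m *: Y v h (s + m%:~R - j%:R) (act a j%:Z u)).
Proof. by have [_ [_ [_ [_ [_ []]]]]] := YP. Qed.

Lemma Y_derivative v h s u : Y (act (conformal V) 0 v) h s u =
  - (s *: Y v h (s - 1) u) + h.+1%:R *: Y v h.+1 (s - 1) u.
Proof. by have [_ [_ [_ [_ [_ []]]]]] := YP. Qed.

Lemma fin_supp_act_l (a : V) (W W' : vmodule V) (x : W) (f : nat -> W -> W') :
  (forall j, f j 0 = 0) -> fin_supp (fun j : nat => f j (act a j%:Z x)).
Proof.
move=> f0; have [N xN] := act_trunc a x; apply: (@fin_supp_nat _ _ N) => j Nj.
by rewrite xN// f0.
Qed.

Lemma fin_supp_Y (W : nmodType) v h s u (f : nat -> D -> W) :
  (forall j, f j 0 = 0) -> fin_supp (fun j : nat => f j (Y v h (s + j%:R) u)).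
Proof.
move=> f0; have [N xN] := Y_trunc v h s u; apply: (@fin_supp_nat _ _ N) => j Nj.
by rewrite xN// f0.
Qed.

(** The commutator with L(0) involves L(-1) v, which the derivative property turns
    into the exponent -s-1 and the next power of the logarithm. *)
Lemma Y_wshift lambda mu v h s u :
  wshift (lambda + mu - s - 1) (Y v h s u) =
  Y (wshift lambda v) h s u + Y v h s (wshift mu u) + h.+1%:R *: Y v h.+1 s u.
Proof.
have := Y_commutator (conformal V) 1 v h s u.
rewrite (@fsum_ord _ _ 2) => [|i i2]; last first.
  by rewrite (@cbinom_small _ 1)// scale0r.
rewrite !big_ord_recl big_ord0/= cbinom0 cbinom1 !scale1r addr0.
have -> : (bump 0 0)%:Z = 1 by [].
rewrite rmorph1 subr0 addrK Y_derivative addrK => e.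
have wgt : (lambda + mu - s - 1) *: Y v h s u =
    lambda *: Y v h s u + mu *: Y v h s u - (s + 1) *: Y v h s u.
  by rewrite -scalerDl -scalerBl; congr (_ *: _); ring.
rewrite /wshift (linB (Y_linear_l _ _ _)) (linZ (Y_linear_l _ _ _)).
rewrite (linB (Y_linear_r _ _ _)) (linZ (Y_linear_r _ _ _)) wgt /L0 e.
set P := act _ _ (Y _ _ _ _); set Q := Y (act _ _ _) _ _ _.
rewrite !opprD !opprK !addrA [RHS](ACl (3*2*7*4*(1*6)*(5*8)))/=.
by rewrite subrr addNr !addr0.
Qed.

(** In the formula for L(0) - (lambda + mu - s - 1) each term lowers one of three
    bounded quantities: the nilpotency orders of v and of u, and the number of
    powers of the logarithm above h. *)
Lemma gen_Y lambda mu v h s u : L0_gen_eigen lambda v -> L0_gen_eigen mu u ->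
  L0_gen_eigen (lambda + mu - s - 1) (Y v h s u).
Proof.
have [K YK] := Y_log.
have D0 t : iter t (wshift (lambda + mu - s - 1)) (0 : D) = 0.
  exact: iter_wshift0.
have nil t : forall r1 r2 v u h, (r1 + r2 + (K.+1 - h) <= t)%N ->
    iter r1 (wshift lambda) v = 0 -> iter r2 (wshift mu) u = 0 ->
    iter t (wshift (lambda + mu - s - 1)) (Y v h s u) = 0.
  elim: t => [|t IH] [|r1] [|r2] {}v {}u {}h rt vr ur;
    rewrite ?(vr : v = 0) ?(ur : u = 0) ?(lin0 (Y_linear_l _ _ _))
      ?(lin0 (Y_linear_r _ _ _)) ?D0 //.
  have [Kh|hK] := ltnP K h; first by rewrite YK ?D0.
  have itL := iter_linear t (wshift_linear (W := D) (lambda + mu - s - 1)).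
  rewrite iterSr (Y_wshift lambda mu) !(linD itL) (linZ itL).
  have -> : iter t (wshift (lambda + mu - s - 1)) (Y (wshift lambda v) h s u) = 0.
    by apply: (IH r1 r2.+1); [lia|rewrite -iterSr|].
  have -> : iter t (wshift (lambda + mu - s - 1)) (Y v h s (wshift mu u)) = 0.
    by apply: (IH r1.+1 r2); [lia| |rewrite -iterSr].
  have -> : iter t (wshift (lambda + mu - s - 1)) (Y v h.+1 s u) = 0.
    by apply: (IH r1.+1 r2.+1); [lia| |].
  by rewrite scaler0 !addr0.
move=> [r1 vr] [r2 ur]; exists (r1 + r2 + (K.+1 - h))%N.
exact: (nil _ r1 r2).
Qed.

End Intertwining.

(** * Correlation functions as series in two variables *)

Section DualForms.
Context {R : realType} {V : voa R} {W : vmodule V}.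
Variables (pr : nat -> W -> W) (N : nat).
Hypothesis prC : canonical_grading pr.

(** The transpose of a_n, without the twist that would make it the contragredient
    action. *)
Definition coact (theta : W -> R[i]^o) (a : V) (n : int) : W -> R[i]^o :=
  fun x => theta (act a n x).

Lemma coact_linear theta a n : linear theta -> linear (coact theta a n).
Proof. by move=> tL c x y; rewrite /coact act_linear tL. Qed.

Lemma dual_le_coact theta a n (j : nat) : has_wt a n -> 1 <= n ->
  dual_le pr N theta -> dual_le pr N (coact theta a (- 1 - j%:Z)).
Proof.
move=> an n1 [tL t0]; split=> [|m x Nm xm]; first exact: coact_linear.
have := piece_act prC (- 1 - j%:Z) an xm.
have -> : m%:Z + n - (- 1 - j%:Z) - 1 = (m + `|n|%N + j)%N%:Z by lia.
by move=> /= /(t0 (m + `|n|%N + j)%N); apply; lia.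
Qed.

Lemma coact_eq0 theta a n (j : nat) : has_wt a n -> 1 <= n ->
  dual_le pr N theta -> (N <= j)%N -> coact theta a (- 1 - j%:Z) = 0.
Proof.
move=> an n1 [tL t0] Nj; apply/funext => x; rewrite /coact.
have prG : is_grading pr by have [] := prC.
have [M [_ ->]] := pr_sum prG x.
rewrite (lin_sum (act_linear _ _)) (lin_sum tL) big1// => m _.
have := piece_act prC (- 1 - j%:Z) an (pr_piece prG m x).
have -> : m%:Z + n - (- 1 - j%:Z) - 1 = (m + `|n|%N + j)%N%:Z by lia.
by move=> /= /(t0 (m + `|n|%N + j)%N); apply; lia.
Qed.

End DualForms.

Section CorrelationSupport.
Context {R : realType} {V : voa R} {W A B C : vmodule V}.

Definition act1 (a : V) (n : int) (xi : quad W A B C) : quad W A B C :=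
  Quad (coact (q1 xi) a n) (q2 xi) (q3 xi) (q4 xi).

Definition gen_sum (X : vmodule V) (x : X) : Prop :=
  exists n (u : 'I_n -> X) (d : 'I_n -> R[i]),
    (forall i, L0_gen_eigen (d i) (u i)) /\ x = \sum_i u i.

(** The weights of v, u, w and of the value determine b + s, and the form sees
    only finitely many weights of the value. *)
Lemma trilinear_support (pr : nat -> W -> W) N theta
    (T : A -> B -> C -> R[i] -> R[i] -> W) v u w :
  canonical_grading pr -> dual_le pr N theta ->
  gen_sum v -> gen_sum u -> gen_sum w ->
  (forall u w b s, linear (fun v => T v u w b s)) ->
  (forall v w b s, linear (fun u => T v u w b s)) ->
  (forall v u b s, linear (fun w => T v u w b s)) ->
  (forall l1 l2 l3 v u w b s,
     L0_gen_eigen l1 v -> L0_gen_eigen l2 u -> L0_gen_eigen l3 w ->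
     L0_gen_eigen (l1 + l2 + l3 - (b + s) - 2%:R) (T v u w b s)) ->
  exists S : seq R[i], forall b s, b + s \notin S -> theta (T v u w b s) = 0.
Proof.
move=> prC tN [n1 [v' [d1 [vd ->]]]] [n2 [u' [d2 [ud ->]]]] [n3 [w' [d3 [wd ->]]]].
move=> L1 L2 L3 Tgen; have [S tS] := dual_le_gen prC tN; have [tL _] := tN.
exists [seq d1 t.1.1 + d2 t.1.2 + d3 t.2 - q - 2%:R |
  t <- enum {: 'I_n1 * 'I_n2 * 'I_n3}, q <- S] => b s bs.
rewrite (lin_sum (L1 _ _ _ _)) (lin_sum tL) big1// => i _.
rewrite (lin_sum (L2 _ _ _ _)) (lin_sum tL) big1// => j _.
rewrite (lin_sum (L3 _ _ _ _)) (lin_sum tL) big1// => r _.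
apply: (tS _ _ (Tgen _ _ _ _ _ _ b s (vd i) (ud j) (wd r))).
apply: contra bs => bs; apply/allpairsP.
exists ((i, j, r), d1 i + d2 j + d3 r - (b + s) - 2%:R).
by split=> //=; [rewrite mem_enum|ring].
Qed.

End CorrelationSupport.

Section RightCorrelation.
Context {R : realType} {V : voa R} {A B C BC W : vmodule V}.
Variables (Y1 : intw A BC W) (Y2 : intw B C BC) (h k : nat).
Hypotheses (Y1P : log_intertwining Y1) (Y2P : log_intertwining Y2).
Implicit Types xi : quad W A B C.

Definition corr_right xi : ser2 R := fun b s =>
  q1 xi (Y1 (q2 xi) h b (Y2 (q3 xi) k s (q4 xi))).

Lemma homog2_right (pr : nat -> W -> W) N xi : canonical_grading pr ->
  dual_le pr N (q1 xi) -> gen_sum (q2 xi) -> gen_sum (q3 xi) ->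
  gen_sum (q4 xi) -> homog2 (corr_right xi).
Proof.
move=> prC tN vg ug wg; split.
  apply: (@trilinear_support _ _ W A B C pr N (q1 xi)
    (fun v u w b s => Y1 v h b (Y2 u k s w))) => //.
  - by move=> u w b s; exact: Y_linear_l.
  - by move=> v w b s c x y; rewrite (Y_linear_l Y2P) (Y_linear_r Y1P).
  - by move=> v u b s c x y; rewrite (Y_linear_r Y2P) (Y_linear_r Y1P).
  - move=> l1 l2 l3 v u w b s v1 u2 w3.
    have := gen_Y Y1P h b v1 (gen_Y Y2P k s u2 w3).
    by congr L0_gen_eigen; ring.
move=> s; have [M YM] := Y_trunc Y2P (q3 xi) k s (q4 xi); exists M => n Mn b.
by have [tL _] := tN; rewrite /corr_right YM// (lin0 (Y_linear_r Y1P _ _ _)) (lin0 tL).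
Qed.

End RightCorrelation.

Section LeftCorrelation.
Context {R : realType} {V : voa R} {A B C AB W : vmodule V}.
Variables (Y1 : intw AB C W) (Y2 : intw A B AB) (h k : nat).
Hypotheses (Y1P : log_intertwining Y1) (Y2P : log_intertwining Y2).
Implicit Types xi : quad W A B C.

Definition corr_left xi : ser2 R := fun b s =>
  q1 xi (Y1 (Y2 (q2 xi) k s (q3 xi)) h b (q4 xi)).

Lemma homog2_left (pr : nat -> W -> W) N xi : canonical_grading pr ->
  dual_le pr N (q1 xi) -> gen_sum (q2 xi) -> gen_sum (q3 xi) ->
  gen_sum (q4 xi) -> homog2 (corr_left xi).
Proof.
move=> prC tN vg ug wg; split.
  apply: (@trilinear_support _ _ W A B C pr N (q1 xi)
    (fun v u w b s => Y1 (Y2 v k s u) h b w)) => //.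
  - by move=> u w b s c x y; rewrite (Y_linear_l Y2P) (Y_linear_l Y1P).
  - by move=> v w b s c x y; rewrite (Y_linear_r Y2P) (Y_linear_l Y1P).
  - by move=> v u b s; exact: Y_linear_r.
  - move=> l1 l2 l3 v u w b s v1 u2 w3.
    have := gen_Y Y1P h b (gen_Y Y2P k s v1 u2) w3.
    by congr L0_gen_eigen; ring.
move=> s; have [M YM] := Y_trunc Y2P (q2 xi) k s (q3 xi); exists M => n Mn b.
by have [tL _] := tN; rewrite /corr_left YM// (lin0 (Y_linear_l Y1P _ _ _)) (lin0 tL).
Qed.

End LeftCorrelation.

(** * The three Jacobi-type identities *)

Lemma fin_supp_bigord (V : nmodType) (T : choiceType) M (F : 'I_M -> T -> V) :
  (forall i, fin_supp (F i)) -> fin_supp (fun t => \sum_(i < M) F i t).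
Proof.
elim: M F => [|M IH] G GS; first by exists [::] => t _; rewrite big_ord0.
have [S0 G0] := GS ord0; have [S1 G1] := IH _ (fun i => GS (lift ord0 i)).
exists (S0 ++ S1) => t; rewrite mem_cat => /norP[/G0 t0 /G1 t1].
by rewrite big_ord_recl t0 t1 addr0.
Qed.

Lemma fsum_bigord (V : nmodType) (T : choiceType) M (F : 'I_M -> T -> V) :
  (forall i, fin_supp (F i)) ->
  \sum_(t \in [set: T]) \sum_(i < M) F i t =
  \sum_(i < M) \sum_(t \in [set: T]) F i t.
Proof.
elim: M F => [|M IH] F FS.
  by rewrite big_ord0; apply: fsum_eq0 => t; rewrite big_ord0.
rewrite big_ord_recl -IH => [|i]; last exact: FS.
rewrite -fsumD; [|exact: FS|].
  by apply: fsum_eq => t; rewrite big_ord_recl.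
by apply: fin_supp_bigord => i; exact: FS.
Qed.

Lemma fsum_nat_shift (V : nmodType) (F : nat -> V) (i : nat) :
  (forall j, (j < i)%N -> F j = 0) -> fin_supp F ->
  \sum_(j \in [set: nat]) F j = \sum_(l \in [set: nat]) F (l + i)%N.
Proof.
move=> Fi [S FS]; pose M := (\max_(j <- S) j).+1.
have FM j : (M <= j)%N -> F j = 0.
  move=> Mj; apply: FS; apply/negP => jS; move: Mj; rewrite /M ltnNge.
  by rewrite leq_bigmax_seq.
rewrite (@fsum_ord _ _ (i + M)) => [|j Mj]; last by apply: FM; lia.
rewrite [RHS](@fsum_ord _ _ M) => [|j Mj]; last by apply: FM; lia.
rewrite big_split_ord/= big1 ?add0r => [|j _]; last exact: Fi.
by apply: eq_bigr => j _; rewrite addnC.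
Qed.

Section NegativeModes.
Context {R : realType} {V : voa R} {A B D : vmodule V}.
Variable Y : intw A B D.
Hypothesis YP : log_intertwining Y.

(** For m = -1-j the signs in the associator formula cancel against those of the
    binomial coefficients with negative upper argument. *)
Lemma Y_associator_neg (a : V) (j : nat) v h s u :
  Y (act a (- 1 - j%:Z) v) h s u =
  \sum_(i \in [set: nat])
     'C(j + i, j)%:R *: act a (- 1 - (j + i)%N%:Z) (Y v h (s + i%:R) u) +
  \sum_(i \in [set: nat])
     cbinom (- 1 - i%:R) j *: Y v h (s - 1 - (j + i)%:R) (act a i%:Z u).
Proof.
rewrite (Y_associator YP) -fsumD; last 2 first.
- apply: (@fin_supp_Y _ _ _ _ _ _ YP _ v h s u (fun i x =>
    'C(j + i, j)%:R *: act a (- 1 - (j + i)%N%:Z) x)) => i.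
  by rewrite (lin0 (act_linear _ _)) scaler0.
- apply: (@fin_supp_act_l _ _ a _ _ u (fun i x =>
    cbinom (- 1 - i%:R) j *: Y v h (s - 1 - (j + i)%:R) x)) => i.
  by rewrite (lin0 (Y_linear_r YP _ _ _)) scaler0.
apply: fsum_eq => i; rewrite scalerBr scalerA.
have -> : (- 1 - j%:Z)%:~R = - 1 - j%:R :> R[i] by rewrite rmorphB/= rmorphN1.
congr (_ + _).
  rewrite cbinom_neg mulrC mulrA -expr2 sqrr_sign mul1r; congr (_ *: act _ _ _).
  by lia.
rewrite -scaleNr; congr (_ *: Y _ _ _ _); last by rewrite natrD; ring.
rewrite [cbinom _ i * _]mulrC -cbinom_neg_sym.
have -> : (-1) ^ (- 1 - j%:Z) = - (-1) ^+ j :> R[i].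
  have -> : - 1 - j%:Z = - (j.+1%:Z) by lia.
  by rewrite -invr_expz -exprnP exprS mulN1r invrN invr_sign.
by rewrite mulrN opprK mulrAC -expr2 sqrr_sign mul1r.
Qed.

Lemma Y_associator1 (a : V) v h s u :
  Y (act a (- 1) v) h s u =
  \sum_(i \in [set: nat]) act a (- 1 - i%:Z) (Y v h (s + i%:R) u) +
  \sum_(i \in [set: nat]) Y v h (s - 1 - i%:R) (act a i%:Z u).
Proof.
have := Y_associator_neg a 0 v h s u; rewrite subr0 => ->.
by congr (_ + _); apply: fsum_eq => i; rewrite ?bin0 ?cbinom0 scale1r.
Qed.

End NegativeModes.

Section Pointwise.
Context {R : realType}.
Implicit Types (f g : ser2 R).

Lemma ser2D f g b s : (f + g) b s = f b s + g b s. Proof. by []. Qed.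
Lemma ser2N f b s : (- f) b s = - f b s. Proof. by []. Qed.
Lemma ser2Z a f b s : (a *: f) b s = a * f b s. Proof. by []. Qed.
Lemma ser2_sum M (F : 'I_M -> ser2 R) b s :
  (\sum_(i < M) F i) b s = \sum_(i < M) F i b s.
Proof. by apply: (big_morph (fun f : ser2 R => f b s)). Qed.

Lemma monom_neg e (i : nat) f b s : monom e 0 0 (- 1 - i%:Z) f b s =
  \sum_(l \in [set: nat])
    cbinom (- 1 - i%:R) l * e ^+ l * f (b - 1 - (i + l)%:R) (s + l%:R) :> R[i].
Proof.
apply: fsum_eq => l; have -> : (- 1 - i%:Z)%:~R = - 1 - i%:R :> R[i].
  by rewrite rmorphB/= rmorphN1.
by congr (_ * f _ _); rewrite !rmorphD/= !rmorphN/= ?natrD ?rmorph1; ring.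
Qed.

Lemma scale_monom_neg a e (i : nat) f b s :
  (a *: monom e 0 0 (- 1 - i%:Z) f) b s = \sum_(l \in [set: nat])
    a * (cbinom (- 1 - i%:R) l * e ^+ l * f (b - 1 - (i + l)%:R) (s + l%:R)).
Proof. by rewrite ser2Z monom_neg; exact: fsumM. Qed.

Lemma monom_nat (l : nat) f b s : monom 1 0 0 l%:Z f b s =
  \sum_(i < l.+1) 'C(l, i)%:R * f (b + (l - i)%:R) (s + i%:R).
Proof.
rewrite /monom (@fsum_ord _ _ l.+1) => [|i li]; last first.
  by rewrite (@cbinom_small _ l)// !mul0r.
apply: eq_bigr => i _; rewrite (cbinom_nat l) expr1n mulr1.
have il : (i <= l)%N by rewrite -ltnS.
by rewrite !add0r subzn.
Qed.

Lemma monom_negl e (i : nat) f b s :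
  monom e (- 1 - i%:Z) 0 0 f b s = f (b - 1 - i%:R) s.
Proof. by rewrite monom_shift addr0; congr f; rewrite rmorphB/= rmorphN1 addrA. Qed.

Lemma monom_negr e (i : nat) f b s :
  monom e 0 (- 1 - i%:Z) 0 f b s = f b (s - 1 - i%:R).
Proof. by rewrite monom_shift addr0; congr f; rewrite rmorphB/= rmorphN1 addrA. Qed.

Lemma monom_posl e (i : nat) f b s : monom e i 0 0 f b s = f (b + i%:R) s.
Proof. by rewrite monom_shift addr0. Qed.

Lemma monom_posr e (i : nat) f b s : monom e 0 i 0 f b s = f b (s + i%:R).
Proof. by rewrite monom_shift addr0. Qed.

End Pointwise.

Section Identities.
Context {R : realType} {V : voa R} {W A B C : vmodule V}.

(** Lower truncation and the bounded support of the form provide such an M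
    ([vanish_exists]), which turns the identities below into finite sums. *)
Record vanish_from (a : V) (M : nat) (xi : quad W A B C) : Prop := {
  vanish1 : forall j : nat, (M <= j)%N -> coact (q1 xi) a (- 1 - j%:Z) = 0;
  vanish2 : forall j : nat, (M <= j)%N -> act a j%:Z (q2 xi) = 0;
  vanish3 : forall j : nat, (M <= j)%N -> act a j%:Z (q3 xi) = 0;
  vanish4 : forall j : nat, (M <= j)%N -> act a j%:Z (q4 xi) = 0 }.

(** The identities below hold for the products (big variable x, small variable
    y, expansion in |x| > |y|) and for the iterates (big variable y, small
    variable x - y) alike, when the monomials [mon i j k] are read as
    x^i y^j (x - y)^k. *)
Definition jacobi_identities (F : quad W A B C -> ser2 R)
    (mon : int -> int -> int -> ser2 R -> ser2 R) : Prop :=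
  forall (a : V) (M : nat) xi, linear (q1 xi) -> vanish_from a M xi ->
  [/\ F (act2 a (- 1) xi) =
        \sum_(j < M) mon j%:Z 0 0 (F (act1 a (- 1 - j%:Z) xi)) +
        \sum_(j < M) mon (- 1 - j%:Z) 0 0 (F (act4 a j%:Z xi)) +
        \sum_(j < M) mon 0 0 (- 1 - j%:Z) (F (act3 a j%:Z xi)),
      F (act3 a (- 1) xi) =
        \sum_(j < M) mon 0 j%:Z 0 (F (act1 a (- 1 - j%:Z) xi)) +
        \sum_(j < M) mon 0 (- 1 - j%:Z) 0 (F (act4 a j%:Z xi)) -
        \sum_(j < M) (-1) ^+ j *: mon 0 0 (- 1 - j%:Z) (F (act2 a j%:Z xi)) &
      F (act4 a (- 1) xi) =
        F (act1 a (- 1) xi) -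
        \sum_(j < M) (-1) ^+ j *: mon (- 1 - j%:Z) 0 0 (F (act2 a j%:Z xi)) -
        \sum_(j < M) (-1) ^+ j *: mon 0 (- 1 - j%:Z) 0 (F (act3 a j%:Z xi))].

End Identities.

Section RightIdentities.
Context {R : realType} {V : voa R} {A B C BC W : vmodule V}.
Variables (Y1 : intw A BC W) (Y2 : intw B C BC) (h k : nat).
Hypotheses (Y1P : log_intertwining Y1) (Y2P : log_intertwining Y2).

(** The mode a_(-1) is moved outwards.  Commuting a_j past Y(u, y) inside the
    associator formula for Y(a_(-1) v, x), or a_(-1-j) past Y(v, x), produces
    double sums whose inner sum is the expansion of (x - y)^(-1-i). *)
Lemma right_identities :
  jacobi_identities (corr_right (A := A) (B := B) (C := C) Y1 Y2 h k)
  (monom (-1)).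
Proof.
move=> a M [theta v u w] /= tL [/= van1 van2 van3 van4].
have t0 := lin0 tL.
have tY1 v' b : linear (fun c => theta (Y1 v' h b c)).
  by move=> x c c'; rewrite (Y_linear_r Y1P) tL.
have Y1v0 b c : Y1 0 h b c = 0 by rewrite (lin0 (Y_linear_l Y1P _ _ _)).
have Y1c0 v' b : Y1 v' h b 0 = 0 by rewrite (lin0 (Y_linear_r Y1P _ _ _)).
have Y2u0 s c : Y2 0 k s c = 0 by rewrite (lin0 (Y_linear_l Y2P _ _ _)).
have Y2w0 u' s : Y2 u' k s 0 = 0 by rewrite (lin0 (Y_linear_r Y2P _ _ _)).
have comm2 (m : int) s : Y2 u k s (act a m w) = act a m (Y2 u k s w) -
    \sum_(i < M) cbinom m%:~R i *: Y2 (act a i%:Z u) k (s + m%:~R - i%:R) w.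
  rewrite (Y_commutator Y2P) (@fsum_ord _ _ M)// => j Mj.
  by rewrite van3// Y2u0 scaler0.
have comm1 (m : int) b c : Y1 v h b (act a m c) = act a m (Y1 v h b c) -
    \sum_(i < M) cbinom m%:~R i *: Y1 (act a i%:Z v) h (b + m%:~R - i%:R) c.
  rewrite (Y_commutator Y1P) (@fsum_ord _ _ M)// => j Mj.
  by rewrite van2// Y1v0 scaler0.
have th1 (j : nat) x : (M <= j)%N -> theta (act a (- 1 - j%:Z) x) = 0.
  by move=> Mj; rewrite -/(coact theta a _ x) van1.
have trunc2 u' s (i : nat) : exists N, forall j : nat, (N <= j)%N ->
    Y2 u' k (s + j%:R - i%:R) w = 0.
  have [N YN] := Y_trunc Y2P u' k (s - i%:R) w; exists N => j Nj.
  by rewrite addrAC YN.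
split; apply/funext => b; apply/funext => s.
- rewrite /corr_right/= (Y_associator1 Y1P) (linD tL).
  rewrite (lin_fsum tL (fin_supp_Y Y1P (f := fun j => act a (- 1 - j%:Z)) v h b _ _))
    => [|j]; last exact: lin0 (act_linear _ _).
  rewrite (lin_fsum tL (fin_supp_act_l a _ (f := fun j => Y1 v h (b - 1 - j%:R)) _))//.
  rewrite !ser2D !ser2_sum -addrA; congr (_ + _).
    rewrite (@fsum_ord _ _ M) => [|j Mj]; last exact: th1.
    by apply: eq_bigr => j _; rewrite monom_posl.
  pose G (i : 'I_M) (j : nat) := 'C(j, i)%:R *
    theta (Y1 v h (b - 1 - j%:R) (Y2 (act a i%:Z u) k (s + j%:R - i%:R) w)).
  have GS i : fin_supp (G i).
    have [N YN] := trunc2 (act a i%:Z u) s i; apply: (@fin_supp_nat _ _ N) => j Nj.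
    by rewrite /G YN// Y1c0 t0 mulr0.
  transitivity (\sum_(j \in [set: nat])
    (theta (Y1 v h (b - 1 - j%:R) (Y2 u k s (act a j%:Z w))) + \sum_(i < M) G i j)).
    apply: fsum_eq => j; have := comm2 j%:Z s => /eqP.
    rewrite eq_sym subr_eq => /eqP ->; rewrite (linD (tY1 _ _)) (lin_sum (tY1 _ _)).
    by congr (_ + _); apply: eq_bigr => i _; rewrite (linZ (tY1 _ _)) (cbinom_nat j).
  rewrite fsumD; [|by apply: (@fin_supp_nat _ _ M) => j Mj; rewrite van4// Y2w0 Y1c0|
    exact: fin_supp_bigord].
  congr (_ + _).
    rewrite (@fsum_ord _ _ M) => [|j Mj]; last by rewrite van4// Y2w0 Y1c0.
    by apply: eq_bigr => j _; rewrite monom_negl.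
  rewrite fsum_bigord//; apply: eq_bigr => i _.
  rewrite (@fsum_nat_shift _ _ i)// => [|j ji]; last by rewrite /G bin_small// mul0r.
  rewrite monom_neg; apply: fsum_eq => l; rewrite /G cbinom_negM addnC.
  congr (_ * theta (Y1 _ _ _ (Y2 _ _ _ _))).
  by rewrite natrD; ring.
- rewrite /corr_right/= (Y_associator1 Y2P) (linD (tY1 _ _)).
  have S1 : fin_supp (fun j : nat => act a (- 1 - j%:Z) (Y2 u k (s + j%:R) w)).
    apply: (@fin_supp_Y _ _ _ _ _ _ Y2P _ u k s w (fun j => act a (- 1 - j%:Z))) => j.
    exact: lin0 (act_linear _ _).
  have S2 : fin_supp (fun j : nat => Y2 u k (s - 1 - j%:R) (act a j%:Z w)).
    exact: (@fin_supp_act_l _ _ a _ _ w (fun j => Y2 u k (s - 1 - j%:R))).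
  rewrite (lin_fsum (tY1 _ _) S1) (lin_fsum (tY1 _ _) S2).
  rewrite !ser2D ser2N !ser2_sum addrAC; congr (_ + _); last first.
    rewrite (@fsum_ord _ _ M) => [|j Mj]; last by rewrite van4// Y2w0 Y1c0.
    by apply: eq_bigr => j _; rewrite monom_negr.
  pose G (i : 'I_M) (j : nat) := - (cbinom (- 1 - j%:R) i *
    theta (Y1 (act a i%:Z v) h (b - 1 - (i + j)%:R) (Y2 u k (s + j%:R) w))).
  have GS i : fin_supp (G i).
    have [N YN] := trunc2 u s 0%N; apply: (@fin_supp_nat _ _ N) => j Nj.
    by rewrite /G -[s + _]subr0 YN// Y1c0 t0 mulr0 oppr0.
  transitivity (\sum_(j \in [set: nat])
    (theta (act a (- 1 - j%:Z) (Y1 v h b (Y2 u k (s + j%:R) w))) + \sum_(i < M) G i j)).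
    apply: fsum_eq => j; rewrite comm1 (linB tL); congr (_ + _).
    rewrite (lin_sum tL) -sumrN; apply: eq_bigr => i _; rewrite (linZ tL) /G.
    have -> : (- 1 - j%:Z)%:~R = - 1 - j%:R :> R[i] by rewrite rmorphB/= rmorphN1.
    by congr (- (_ * theta (Y1 _ _ _ _))); rewrite natrD; ring.
  rewrite fsumD; [|by apply: (@fin_supp_nat _ _ M) => j; exact: th1|
    exact: fin_supp_bigord].
  congr (_ + _).
    rewrite (@fsum_ord _ _ M) => [|j Mj]; last exact: th1.
    by apply: eq_bigr => j _; rewrite monom_posr.
  rewrite fsum_bigord// -sumrN; apply: eq_bigr => i _.
  rewrite -ser2N -scaleNr scale_monom_neg; apply: fsum_eq => l.
  by rewrite /G cbinom_neg_swap mulNr !mulrA.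
- rewrite /corr_right/= comm2 (linB (tY1 _ _)) comm1 (linB tL).
  rewrite !ser2D !ser2N !ser2_sum; congr (_ - _ - _).
    rewrite (lin_sum tL); apply: eq_bigr => i _.
    rewrite (linZ tL) ser2Z monom_negl.
    by rewrite rmorphN1 cbinomN1.
  rewrite (lin_sum (tY1 _ _)); apply: eq_bigr => i _.
  by rewrite (linZ (tY1 _ _)) ser2Z monom_negr rmorphN1 cbinomN1.
Qed.

End RightIdentities.

Section LeftIdentities.
Context {R : realType} {V : voa R} {A B C AB W : vmodule V}.
Variables (Y1 : intw AB C W) (Y2 : intw A B AB) (h k : nat).
Hypotheses (Y1P : log_intertwining Y1) (Y2P : log_intertwining Y2).

(** Here the inner sums are expansions in t = x - y: those of (y + t)^n = x^n for
    the modes that reach the form, a diagonal summation, and those of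
    (y + t)^(-1-i) = x^(-1-i) for the modes acting on the other factors. *)
Lemma left_identities :
  jacobi_identities (corr_left (A := A) (B := B) (C := C) Y1 Y2 h k)
    (fun i j l => monom 1 j l i).
Proof.
move=> a M [theta v u w] /= tL [/= van1 van2 van3 van4].
have t0 := lin0 tL.
have tY1 b w' : linear (fun c => theta (Y1 c h b w')).
  by move=> x c c'; rewrite (Y_linear_l Y1P) tL.
have tYa m b w' : linear (fun c => theta (act a m (Y1 c h b w'))).
  by move=> x c c'; rewrite (Y_linear_l Y1P) (act_linear a m) tL.
have Y1c0 b w' : Y1 0 h b w' = 0 by rewrite (lin0 (Y_linear_l Y1P _ _ _)).
have Y1w0 c b : Y1 c h b 0 = 0 by rewrite (lin0 (Y_linear_r Y1P _ _ _)).
have Y2v0 s u' : Y2 0 k s u' = 0 by rewrite (lin0 (Y_linear_l Y2P _ _ _)).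
have Y2u0 v' s : Y2 v' k s 0 = 0 by rewrite (lin0 (Y_linear_r Y2P _ _ _)).
have act0 m : act a m (0 : W) = 0 := lin0 (act_linear a m).
have comm2 (m : int) s : Y2 v k s (act a m u) = act a m (Y2 v k s u) -
    \sum_(i < M) cbinom m%:~R i *: Y2 (act a i%:Z v) k (s + m%:~R - i%:R) u.
  rewrite (Y_commutator Y2P) (@fsum_ord _ _ M)// => j Mj.
  by rewrite van2// Y2v0 scaler0.
have th1 (j : nat) x : (M <= j)%N -> theta (act a (- 1 - j%:Z) x) = 0.
  by move=> Mj; rewrite -/(coact theta a _ x) van1.
have trunc2 v' s (i : nat) : exists N, forall j : nat, (N <= j)%N ->
    Y2 v' k (s + j%:R - i%:R) u = 0.
  have [N YN] := Y_trunc Y2P v' k (s - i%:R) u; exists N => j Nj.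
  by rewrite addrAC YN.
split; apply/funext => b; apply/funext => s.
- rewrite /corr_left/= (Y_associator1 Y2P) (linD (tY1 _ _)).
  have S1 : fin_supp (fun j : nat => act a (- 1 - j%:Z) (Y2 v k (s + j%:R) u)).
    apply: (@fin_supp_Y _ _ _ _ _ _ Y2P _ v k s u (fun j => act a (- 1 - j%:Z))) => j.
    exact: lin0 (act_linear _ _).
  have S2 : fin_supp (fun j : nat => Y2 v k (s - 1 - j%:R) (act a j%:Z u)).
    exact: (@fin_supp_act_l _ _ a _ _ u (fun j => Y2 v k (s - 1 - j%:R))).
  rewrite (lin_fsum (tY1 _ _) S1) (lin_fsum (tY1 _ _) S2).
  rewrite !ser2D !ser2_sum; congr (_ + _); last first.
    rewrite (@fsum_ord _ _ M) => [|j Mj]; last by rewrite van3// Y2u0 Y1c0.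
    by apply: eq_bigr => j _; rewrite monom_negr.
  pose F (j i : nat) := 'C(j + i, j)%:R *
    theta (act a (- 1 - (j + i)%N%:Z) (Y1 (Y2 v k (s + j%:R) u) h (b + i%:R) w)).
  pose G (i : 'I_M) (j : nat) := cbinom (- 1 - i%:R) j *
    theta (Y1 (Y2 v k (s + j%:R) u) h (b - 1 - (j + i)%:R) (act a i%:Z w)).
  have FM j i : (M <= j + i)%N -> F j i = 0.
    by move=> ji; rewrite /F th1// mulr0.
  have GS i : fin_supp (G i).
    have [N YN] := trunc2 v s 0%N; apply: (@fin_supp_nat _ _ N) => j Nj.
    by rewrite /G -[s + _]subr0 YN// Y1c0 t0 mulr0.
  transitivity (\sum_(j \in [set: nat])
      (\sum_(i \in [set: nat]) F j i + \sum_(i < M) G i j)).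
    apply: fsum_eq => j; rewrite (Y_associator_neg Y1P) (linD tL).
    rewrite (lin_fsum tL); last first.
      apply: (@fin_supp_Y _ _ _ _ _ _ Y1P _ _ h b w (fun i x =>
        'C(j + i, j)%:R *: act a (- 1 - (j + i)%N%:Z) x)) => i.
      by rewrite act0 scaler0.
    rewrite (lin_fsum tL); last first.
      apply: (@fin_supp_act_l _ _ a _ _ w (fun i x => cbinom (- 1 - i%:R) j *:
        Y1 (Y2 v k (s + j%:R) u) h (b - 1 - (j + i)%:R) x)) => i.
      by rewrite Y1w0 scaler0.
    congr (_ + _); first by apply: fsum_eq => i; rewrite (linZ tL).
    rewrite (@fsum_ord _ _ M) => [|i Mi]; last by rewrite van4// Y1w0 scaler0.
    by apply: eq_bigr => i _; rewrite (linZ tL).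
  rewrite fsumD; [|apply: (@fin_supp_nat _ _ M) => j Mj; apply: fsum_eq0 => i;
    by apply: FM; lia|exact: fin_supp_bigord].
  congr (_ + _).
    rewrite (fsum_antidiag FM) (@fsum_ord _ _ M) => [|n Mn]; last first.
      rewrite big1// => l _; apply: FM; have := ltn_ord l; lia.
    apply: eq_bigr => n _; rewrite monom_nat; apply: eq_bigr => l _.
    by rewrite /F subnKC// -ltnS.
  rewrite fsum_bigord//; apply: eq_bigr => i _.
  rewrite monom_neg; apply: fsum_eq => l.
  by rewrite /G expr1n mulr1 addnC.
- rewrite /corr_left/= comm2 (linB (tY1 _ _)) (Y_associator1 Y1P) (linD tL).
  set c := Y2 v k s u.
  have S1 : fin_supp (fun j : nat => act a (- 1 - j%:Z) (Y1 c h (b + j%:R) w)).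
    exact: (@fin_supp_Y _ _ _ _ _ _ Y1P _ c h b w (fun j => act a (- 1 - j%:Z))).
  have S2 : fin_supp (fun j : nat => Y1 c h (b - 1 - j%:R) (act a j%:Z w)).
    exact: (@fin_supp_act_l _ _ a _ _ w (fun j => Y1 c h (b - 1 - j%:R))).
  rewrite (lin_fsum tL S1) (lin_fsum tL S2).
  rewrite !ser2D ser2N !ser2_sum; congr (_ + _ - _).
  + rewrite (@fsum_ord _ _ M) => [|j Mj]; last exact: th1.
    by apply: eq_bigr => j _; rewrite monom_posl.
  + rewrite (@fsum_ord _ _ M) => [|j Mj]; last by rewrite van4// Y1w0.
    by apply: eq_bigr => j _; rewrite monom_negl.
  + rewrite (lin_sum (tY1 _ _)); apply: eq_bigr => i _.
    by rewrite (linZ (tY1 _ _)) ser2Z monom_negr rmorphN1 cbinomN1.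
- rewrite /corr_left/= (Y_commutator Y1P) (linB tL).
  rewrite !ser2D !ser2N !ser2_sum -addrA; congr (_ + _).
  set c := Y2 v k s u.
  have S1 : fin_supp (fun j : nat => cbinom (- 1)%:~R j *:
      Y1 (act a j%:Z c) h (b + (- 1)%:~R - j%:R) w).
    apply: (@fin_supp_act_l _ _ a _ _ c (fun j x => cbinom (- 1)%:~R j *:
      Y1 x h (b + (- 1)%:~R - j%:R) w)) => j.
    by rewrite Y1c0 scaler0.
  rewrite (lin_fsum tL S1).
  pose G (r : 'I_M) (i : nat) := (-1) ^+ i * ('C(i, r)%:R *
    theta (Y1 (Y2 (act a r%:Z v) k (s + i%:R - r%:R) u) h (b - 1 - i%:R) w)).
  have GS r : fin_supp (G r).
    have [N YN] := trunc2 (act a r%:Z v) s r; apply: (@fin_supp_nat _ _ N) => j Nj.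
    by rewrite /G YN// Y1c0 t0 !mulr0.
  transitivity (- (\sum_(i \in [set: nat])
    (\sum_(r < M) G r i +
     (-1) ^+ i * theta (Y1 (Y2 v k s (act a i%:Z u)) h (b - 1 - i%:R) w)))).
    congr (- _); apply: fsum_eq => i; rewrite (linZ tL) rmorphN1 cbinomN1.
    have := comm2 i%:Z s => /eqP; rewrite eq_sym subr_eq => /eqP ->.
    rewrite (linD (tY1 _ _)) (lin_sum (tY1 _ _)) scalerDr addrC; congr (_ + _).
    rewrite scaler_sumr; apply: eq_bigr => r _.
    by rewrite (linZ (tY1 _ _)) (cbinom_nat i).
  rewrite fsumD; [|exact: fin_supp_bigord|
    by apply: (@fin_supp_nat _ _ M) => j Mj; rewrite van3// Y2u0 Y1c0 t0 mulr0].
  rewrite opprD; congr (- _ - _); last first.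
    rewrite (@fsum_ord _ _ M) => [|j Mj]; last by rewrite van3// Y2u0 Y1c0 t0 mulr0.
    by apply: eq_bigr => j _; rewrite ser2Z monom_negl.
  rewrite fsum_bigord//; apply: eq_bigr => r _.
  rewrite (@fsum_nat_shift _ _ r)// => [|j jr]; last first.
    by rewrite /G bin_small// mul0r mulr0.
  rewrite scale_monom_neg; apply: fsum_eq => l.
  rewrite /G cbinom_neg expr1n mulr1 addnC exprD -!mulrA.
  congr (_ * (_ * (_ * theta (Y1 (Y2 _ _ _ _) _ _ _)))).
  by rewrite natrD; ring.
Qed.

End LeftIdentities.

(** * Reduction modulo C_1 *)

Section C1Decomposition.
Context {R : realType} {V : voa R} {W : vmodule V}.
Variables (pr : nat -> W -> W) (P J : set W).
Hypotheses (prC : canonical_grading pr) (PC : is_complement P (C1 (W := W))).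
Hypotheses (Jspan : lspan J = P) (Jhom : J `<=` homogeneous pr).

Lemma pr_act a (p m : nat) x : has_wt a p.+1%:Z ->
  exists2 M : nat, x = \sum_(r < M) pr r x &
  pr m (act a (- 1) x) =
    \sum_(r < M) if m == (r + p.+1)%N then act a (- 1) (pr r x) else 0.
Proof.
move=> ap; have prG : is_grading pr by have [] := prC.
have [M [_ xE]] := pr_sum prG x; exists M => //.
rewrite {1}xE (lin_sum (act_linear _ _)) (lin_sum (pr_linear prG m)).
apply: eq_bigr => r _; apply: (piece_pr prG).
have := piece_act prC (- 1) ap (pr_piece prG r x).
by have -> : (r%:Z + p.+1%:Z - (- 1) - 1) = (r + p.+1)%N%:Z by lia.
Qed.

(** Writing x as an element of P plus an element of C_1 and projecting both to
    degree m loses nothing: P is spanned by homogeneous vectors, and C_1 is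
    stable under the projections because the modes are homogeneous. *)
Lemma C1_induction (Q : W -> Prop) m :
  Q 0 -> (forall c x y, Q x -> Q y -> Q (c *: x + y)) ->
  (forall x, J x -> piece pr m x -> Q x) ->
  (forall a (p q : nat) x, has_wt a p.+1%:Z -> piece pr q x ->
     (q + p.+1 = m)%N -> Q (act a (- 1) x)) ->
  forall x, piece pr m x -> Q x.
Proof.
move=> Q0 QL QJ Qact x xm; have prG : is_grading pr by have [] := prC.
have QD y z : Q y -> Q z -> Q (y + z) by move=> Qy; rewrite -[y]scale1r; exact: QL.
have Qsum n (c : 'I_n -> R[i]) (e : 'I_n -> W) :
    (forall i, Q (e i)) -> Q (\sum_i c i *: e i).
  by move=> Qe; elim/big_ind: _ => // i _; rewrite -[_ *: _]addr0; exact: QL.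
have [_ _ /(_ x)[y [z [Py Cz xyz]]]] := PC.
rewrite -[x](xm : pr m x = x) xyz (linD (pr_linear prG m)); apply: (QD).
  move: Py; rewrite -Jspan => -[n [c [e [Je ->]]]].
  rewrite (lin_sum (pr_linear prG m)).
  under eq_bigr do rewrite (linZ (pr_linear prG m)).
  apply: Qsum => i; have [q _ eq] := Jhom (Je i).
  rewrite (piece_pr prG _ eq); case: eqP => [mq|//].
  by apply: QJ; rewrite // mq.
have [n [c [e [Ce ->]]]] := Cz.
rewrite (lin_sum (pr_linear prG m)).
under eq_bigr do rewrite (linZ (pr_linear prG m)).
apply: Qsum => i; have [a [[[|p]|p] [t [at_ n1 ->]]]] := Ce i; [lia| |lia].
have [M _ ->] := pr_act m t at_.
apply: (big_ind Q) => // r _; case: eqP => // mE.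
by apply: (Qact a p r) => //; exact: pr_piece.
Qed.

End C1Decomposition.

Section Combinations.
Context {R : realType} {Q : Type}.
Variables (gens : set (lser R * lser R)) (sg : bool).
Hypothesis gensP : forall c r, gens (c, r) -> bounded sg c /\ is_powser r.
Variables (G : Q -> cser R) (J : set Q).
Hypothesis Gt : forall q, J q -> truncated sg (G q).

Let K := gen_alg gens.

(** Used for the unit ideal and for the series without constant term. *)
Definition ideal_like (I : lser R -> Prop) : Prop :=
  forall c d, is_powser c -> I d -> I (lmul c d).

Variable I : lser R -> Prop.
Hypothesis Iid : ideal_like I.

Let cmb := combination (fun c r => K c r /\ I r) G J.

Lemma comb0 : cmb 0.
Proof.
exists 0%N, (fun i : 'I_0 => False_rect Q (notF (ltn_ord i))),
  (fun=> 0), (fun=> 0); split=> [[]//|].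
by rewrite big_ord0.
Qed.

Lemma comb_single c r q : J q -> K c r -> I r -> cmb (lact c (G q)).
Proof.
move=> Jq Kcr Ir; exists 1%N, (fun=> q), (fun=> c), (fun=> r); split=> //.
by rewrite big_ord1.
Qed.

Lemma combD f g : cmb f -> cmb g -> cmb (f + g).
Proof.
move=> [n [mu [c [r [H ->]]]]] [n' [mu' [c' [r' [H' ->]]]]].
pose glue (T : Type) (f : 'I_n -> T) (g : 'I_n' -> T) (i : 'I_(n + n')) :=
  match fintype.split i with inl j => f j | inr j => g j end.
exists (n + n')%N, (glue _ mu mu'), (glue _ c c'), (glue _ r r'); split.
  by move=> i; rewrite /glue; case: (fintype.split i).
rewrite big_split_ord/= /glue; congr (_ + _); apply: eq_bigr => i _.
  by rewrite -[lshift _ _]/(unsplit (inl i)) unsplitK.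
by rewrite -[rshift _ _]/(unsplit (inr i)) unsplitK.
Qed.

Lemma comb_sum (T : Type) (s : seq T) (F : T -> cser R) :
  (forall t, cmb (F t)) -> cmb (\sum_(t <- s) F t).
Proof. by move=> FC; elim/big_ind: _ => //; [exact: comb0|exact: combD]. Qed.

Lemma comb_lact d s f : K d s -> cmb f -> cmb (lact d f).
Proof.
move=> Kds [n [mu [c [r [H ->]]]]].
have [db sp] := gen_algP gensP Kds.
have tr i : truncated sg (lact (c i) (G (mu i))).
  have [Ji [Ki _]] := H i; apply: truncated_lact; last exact: Gt.
  by have [] := gen_algP gensP Ki.
rewrite (lact_sum _ db)//; apply: comb_sum => i.
have [Ji [Ki Ii]] := H i; have [cb _] := gen_algP gensP Ki.
rewrite -(lact_mul db cb); last exact: Gt.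
by apply: (comb_single (r := lmul s (r i))) => //; [exact: gen_alg_mul|exact: Iid].
Qed.

Lemma combZ a f : cmb f -> cmb (a *: f).
Proof.
by move=> fc; rewrite -lact_const; apply: comb_lact fc; exact: gen_alg_const.
Qed.

Lemma combN f : cmb f -> cmb (- f).
Proof. by rewrite -scaleN1r; exact: combZ. Qed.

End Combinations.

Lemma sub_combination (R : realType) (Q : Type) (K K' : lser R -> lser R -> Prop)
    (G : Q -> cser R) (J J' : set Q) f :
  (forall c r, K c r -> K' c r) -> J `<=` J' ->
  combination K G J f -> combination K' G J' f.
Proof.
move=> KK JJ [n [mu [c [r [H ->]]]]]; exists n, mu, c, r; split=> // i.
by have [Ji Ki] := H i; split; [exact: JJ|exact: KK].
Qed.

(** The coefficient rings are closed under products, so combinations may be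
    substituted into one another. *)
Lemma comb_trans (R : realType) (Q : Type) gens sg (G : Q -> cser R)
    (J J' : set Q) f :
  (forall c r, gens (c, r) -> bounded sg c /\ is_powser r) ->
  (forall q, J' q -> truncated sg (G q)) ->
  (forall q, J q ->
     combination (fun c r => gen_alg gens c r /\ True) G J' (G q)) ->
  combination (fun c r => gen_alg gens c r /\ True) G J f ->
  combination (fun c r => gen_alg gens c r /\ True) G J' f.
Proof.
move=> gP Gt JJ [n [mu [c [r [H ->]]]]]; apply: (@comb_sum _ _ _ _ _ (fun=> True)) => i.
have [Ji [Ki _]] := H i.
exact: (@comb_lact _ _ _ _ gP _ _ Gt (fun=> True) _ _ _ _ Ki (JJ _ Ji)).
Qed.

(** * The reduction for a specialized correlation function *)

(** Multiplication by x^i y^j (x - y)^k, kept abstract because products and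
    iterates of intertwining operators expand different powers. *)
Record monomials (R : realType)
    (mon : int -> int -> int -> ser2 R -> ser2 R) : Prop := {
  mon_homog : forall i j k f, homog2 f -> homog2 (mon i j k f);
  monD : forall i j k f g, homog2 f -> homog2 g ->
    mon i j k (f + g) = mon i j k f + mon i j k g;
  monZ : forall i j k a f, mon i j k (a *: f) = a *: mon i j k f;
  monM : forall i j k i' j' k' f, homog2 f ->
    mon i j k (mon i' j' k' f) = mon (i + i') (j + j') (k + k') f;
  mon_id : forall f, mon 0 0 0 f = f }.

Record quadrilinear (R : realType) (V : voa R) (W A B C : vmodule V)
    (F : quad W A B C -> ser2 R) : Prop := {
  linear1 : forall v u w, linear (fun theta => F (Quad theta v u w));
  linear2 : forall theta u w, linear theta ->
    linear (fun v => F (Quad theta v u w));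
  linear3 : forall theta v w, linear theta ->
    linear (fun u => F (Quad theta v u w));
  linear4 : forall theta v u, linear theta ->
    linear (fun w => F (Quad theta v u w)) }.

(** Covers the twists by powers of the formal variable and by powers of a
    difference such as x - y or z - t. *)
Record power_family (R : realType) sg (zpow : nat -> lser R) : Prop := {
  pow0 : zpow 0%N = lconst 1;
  powS : forall n, lmul (zpow 1%N) (zpow n) = zpow n.+1;
  pow_bounded : forall n, bounded sg (zpow n) }.

Section Reduction.
Context {R : realType} {V : voa R} {W A B C : vmodule V}.
Variables (gW : nat -> W -> W) (gA : nat -> A -> A) (gB : nat -> B -> B)
  (gC : nat -> C -> C) (N : nat).
Hypotheses (gWC : canonical_grading gW) (gAC : canonical_grading gA)
  (gBC : canonical_grading gB) (gCC : canonical_grading gC).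
Implicit Types xi nu : quad W A B C.

Definition graded d1 d2 d3 xi : Prop :=
  [/\ dual_le gW N (q1 xi), piece gA d1 (q2 xi), piece gB d2 (q3 xi) &
      piece gC d3 (q4 xi)].

Definition lower d : set (quad W A B C) :=
  [set xi | exists d1 d2 d3, graded d1 d2 d3 xi /\ (d1 + d2 + d3 < d)%N].

Variable F : quad W A B C -> ser2 R.
Variable mon : int -> int -> int -> ser2 R -> ser2 R.
Hypothesis FL : quadrilinear F.
Let F1 := linear1 FL.
Let F2 := linear2 FL.
Let F3 := linear3 FL.
Let F4 := linear4 FL.
Hypothesis Fhomog : forall d1 d2 d3 xi, graded d1 d2 d3 xi -> homog2 (F xi).
Hypothesis Fjac : jacobi_identities F mon.
Hypothesis monP : monomials mon.
Let mon_homog := mon_homog monP.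
Let monD := monD monP.
Let monZ := monZ monP.
Let monM := monM monP.
Let mon_id := mon_id monP.

Variables (sg : bool) (Sp : ser2 R -> cser R) (gens : set (lser R * lser R)).
Hypothesis SpP : specialization sg Sp.
Hypothesis gensP : forall c r, gens (c, r) -> bounded sg c /\ is_powser r.

Variables (zy zt : int) (zpow : nat -> lser R).
Hypothesis zpowP : power_family sg zpow.
Hypothesis Sp_zpow : forall f, homog2 f ->
  Sp (mon 0 zy zt f) = lact (zpow 1%N) (Sp f).

Let G : quad W A B C -> cser R := gr_twist gA gB gC zpow (fun xi => Sp (F xi)).

Definition twisted (d : nat) (f : ser2 R) : cser R :=
  Sp (mon 0 (zy * d%:Z) (zt * d%:Z) f).

Lemma twistedE d f : homog2 f -> twisted d f = lact (zpow d) (Sp f).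
Proof.
move=> fh; elim: d => [|d IH].
  by rewrite /twisted !mulr0 mon_id (pow0 zpowP) lact_const scale1r.
have gh : homog2 (mon 0 (zy * d%:Z) (zt * d%:Z) f) by exact: mon_homog.
rewrite -(powS zpowP).
rewrite (lact_mul (pow_bounded zpowP 1) (pow_bounded zpowP d)); last first.
  exact: spec_trunc SpP _ fh.
rewrite -IH -Sp_zpow // monM// addr0 /twisted.
by congr (Sp (mon _ _ _ _)); rewrite -[d.+1]add1n PoszD; ring.
Qed.

Lemma Sp0 : Sp 0 = 0.
Proof. by have := specZ SpP 0 0; rewrite !scale0r. Qed.

Lemma G_graded d1 d2 d3 xi : graded d1 d2 d3 xi ->
  G xi = twisted (d1 + d2 + d3) (F xi).
Proof.
move=> H; rewrite (twistedE _ (Fhomog H)).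
case: xi H => theta v u w [/= [tL _] vd ud wd]; rewrite /G /gr_twist /=.
have gAG : is_grading gA by have [] := gAC.
have gBG : is_grading gB by have [] := gBC.
have gCG : is_grading gC by have [] := gCC.
rewrite (@fsum_single _ _ (d1, d2, d3)) => [|[[e1 e2] e3] /= e]; last first.
  have [E1|/eqP E1] := eqVneq e1 d1; last first.
    rewrite (piece_pr gAG _ vd); case: eqP => // _.
    by rewrite (lin0 (F2 _ _ tL)) Sp0 lact0.
  have [E2|/eqP E2] := eqVneq e2 d2; last first.
    rewrite (piece_pr gBG _ ud); case: eqP => // _.
    by rewrite (lin0 (F3 _ _ tL)) Sp0 lact0.
  rewrite (piece_pr gCG _ wd); case: eqP => [E3|_].
    by move: e; rewrite E1 E2 E3 eqxx.
  by rewrite (lin0 (F4 _ _ tL)) Sp0 lact0.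
by rewrite /= (vd : _ = v) (ud : _ = u) (wd : _ = w).
Qed.

(** How membership of a coefficient in the ring, or in its ideal [I], is certified:
    by a monomial of which the coefficient is the specialization. *)
Definition realizes (I : lser R -> Prop) (i j k : int) : Prop :=
  exists c r, [/\ gen_alg gens c r, I r &
    forall f, homog2 f -> Sp (mon i j k f) = lact c (Sp f)].

Lemma realizes_mul I J K i j k i' j' k' :
  (forall c d, is_powser c -> is_powser d -> I c -> J d -> K (lmul c d)) ->
  realizes I i j k -> realizes J i' j' k' ->
  realizes K (i + i') (j + j') (k + k').
Proof.
move=> IJK [c [r [Kcr Ir cP]]] [c' [r' [Kcr' Jr' cP']]].
have [cb rp] := gen_algP gensP Kcr; have [cb' rp'] := gen_algP gensP Kcr'.
exists (lmul c c'), (lmul r r'); split; [exact: gen_alg_mul|exact: IJK|move=> f fh].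
rewrite -monM// cP; last exact: mon_homog.
by rewrite cP'// (lact_mul cb cb')//; exact: spec_trunc SpP _ fh.
Qed.

Lemma realizes_scalar i j k a :
  (forall f, homog2 f -> Sp (mon i j k f) = a *: Sp f) ->
  realizes (fun=> True) i j k.
Proof.
move=> H; exists (lconst a), (lconst a); split=> //; first exact: gen_alg_const.
by move=> f fh; rewrite lact_const H.
Qed.

Lemma realizes_exp i j k (n : nat) : realizes (fun=> True) i j k ->
  realizes (fun=> True) (n%:Z * i) (n%:Z * j) (n%:Z * k).
Proof.
move=> H; elim: n => [|n IH].
  by rewrite !mul0r; apply: (@realizes_scalar _ _ _ 1) => f _; rewrite mon_id scale1r.
have -> m : n.+1%:Z * m = m + n%:Z * m by lia.
have -> m : n.+1%:Z * m = m + n%:Z * m by lia.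
have -> m : n.+1%:Z * m = m + n%:Z * m by lia.
exact: (realizes_mul _ H IH).
Qed.

Let twh d f (fh : homog2 f) : homog2 (mon 0 (zy * d%:Z) (zt * d%:Z) f) :=
  mon_homog 0 (zy * d%:Z) (zt * d%:Z) fh.

Lemma twistedD d f g : homog2 f -> homog2 g ->
  twisted d (f + g) = twisted d f + twisted d g.
Proof. by move=> fh gh; rewrite /twisted monD// (specD SpP)//; exact: twh. Qed.

Lemma twistedZ d a f : twisted d (a *: f) = a *: twisted d f.
Proof. by rewrite /twisted monZ (specZ SpP). Qed.

Lemma twisted0 d : twisted d 0 = 0.
Proof. by have := twistedZ d 0 0; rewrite !scale0r. Qed.

Lemma twistedN d f : twisted d (- f) = - twisted d f.
Proof. by rewrite -scaleN1r twistedZ scaleN1r. Qed.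

Lemma twisted_sum d M (f : 'I_M -> ser2 R) : (forall i, homog2 (f i)) ->
  twisted d (\sum_(i < M) f i) = \sum_(i < M) twisted d (f i).
Proof.
elim: M f => [|M IH] f fh; first by rewrite !big_ord0 twisted0.
rewrite !big_ord_recl twistedD ?IH//; exact: homog2_sum.
Qed.

Lemma mon0 i j k : mon i j k 0 = 0.
Proof. by have := monZ i j k 0 0; rewrite !scale0r. Qed.

Lemma graded_lower d1 d2 d3 xi : graded d1 d2 d3 xi -> lower (d1 + d2 + d3).+1 xi.
Proof. by move=> H; exists d1, d2, d3. Qed.

Lemma lower_trunc d xi : lower d xi -> truncated sg (G xi).
Proof.
move=> [d1 [d2 [d3 [H _]]]]; rewrite (G_graded H).
by apply: (spec_trunc SpP); apply: twh; exact: Fhomog H.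
Qed.

Let cmb I d := combination (fun c r => gen_alg gens c r /\ I r) G (lower d).

(** The alternative is for the modes that would lower a degree below zero: they
    act by zero, and the degree attached to the zero vector is arbitrary. *)
Definition descent (d j : nat) nu : Prop :=
  exists d1 d2 d3, graded d1 d2 d3 nu /\
    (F nu = 0 \/ (d1 + d2 + d3 + j.+1)%N = d).

Lemma descent_homog d j nu : descent d j nu -> homog2 (F nu).
Proof. by move=> [d1 [d2 [d3 [/Fhomog]]]]. Qed.

(** The difference of the degrees turns into a power of the twisting variable y or
    x - y. *)
Lemma twisted_descent d d1 d2 d3 e nu i j k :
  graded d1 d2 d3 nu -> (d1 + d2 + d3 + e)%N = d ->
  twisted d (mon i j k (F nu)) =
  Sp (mon i (j + zy * e%:Z) (k + zt * e%:Z)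
        (mon 0 (zy * (d1 + d2 + d3)%N%:Z) (zt * (d1 + d2 + d3)%N%:Z) (F nu))).
Proof.
move=> H <-; have Fh := Fhomog H.
rewrite /twisted !monM// add0r addr0.
by congr (Sp (mon _ _ _ _)); rewrite PoszD; ring.
Qed.

Lemma descent_comb I d e nu i j k : ideal_like I -> descent d e nu ->
  realizes I i (j + zy * e.+1%:Z) (k + zt * e.+1%:Z) ->
  cmb I d (twisted d (mon i j k (F nu))).
Proof.
move=> Iid [d1 [d2 [d3 [H [F0|dE]]]]] [c [r [Kcr Ir cP]]].
  by rewrite F0 mon0 twisted0; exact: comb0.
rewrite (twisted_descent _ _ _ H dE) cP; last exact: twh (Fhomog H).
rewrite -[Sp _]/(twisted _ _) -(G_graded H).
by apply: (@comb_single _ _ gens G (lower d) I c r) => //; exists d1, d2, d3;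
  split=> //; lia.
Qed.

Lemma descent_main d e nu : descent d e nu ->
  twisted d (mon 0 (- (zy * e.+1%:Z)) (- (zt * e.+1%:Z)) (F nu)) = G nu.
Proof.
move=> [d1 [d2 [d3 [H [F0|dE]]]]]; first by rewrite (G_graded H) F0 mon0 !twisted0.
by rewrite (twisted_descent _ _ _ H dE) !addNr mon_id (G_graded H).
Qed.

Lemma descent_G d e nu : descent d e nu ->
  combination (fun c r => gen_alg gens c r /\ True) G (lower d) (G nu).
Proof.
move=> D; rewrite -(descent_main D); apply: (@descent_comb (fun=> True) d e nu) => //.
rewrite !addNr; apply: (@realizes_scalar _ _ _ 1) => f _.
by rewrite mon_id scale1r.
Qed.


Lemma act_descent (X : vmodule V) (pr : nat -> X -> X) a (p j m : nat) x :
  canonical_grading pr -> has_wt a p.+1%:Z -> piece pr m x ->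
  exists q, piece pr q (act a j%:Z x) /\
    (act a j%:Z x = 0 \/ (q + j.+1)%N = (m + p.+1)%N).
Proof.
move=> prC ap xm; have := piece_act prC j%:Z ap xm.
case E : (m%:Z + p.+1%:Z - j%:Z - 1) => [q|q] /= xq; first by exists q; split=> //; right; lia.
by exists 0%N; rewrite xq; split; [apply: piece0; have [] := prC|left].
Qed.

Section Slots.
Variables (a : V) (p d1 d2 d3 : nat) (xi : quad W A B C).
Hypotheses (ap : has_wt a p.+1%:Z) (xiG : graded d1 d2 d3 xi).

Let thL : linear (q1 xi). Proof. by case: xiG => -[]. Qed.

Let d := (d1 + d2 + d3 + p.+1)%N.

Lemma descent2 (j : nat) : descent d j (act2 a j%:Z xi).
Proof.
have [t1 t2 t3 t4] := xiG; have [q [qp E]] := act_descent j gAC ap t2.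
exists q, d2, d3; split; first by split.
case: E => [E|E]; [left|right; rewrite /d; lia].
by rewrite /act2 E; exact: (lin0 (F2 _ _ thL)).
Qed.

Lemma descent3 (j : nat) : descent d j (act3 a j%:Z xi).
Proof.
have [t1 t2 t3 t4] := xiG; have [q [qp E]] := act_descent j gBC ap t3.
exists d1, q, d3; split; first by split.
case: E => [E|E]; [left|right; rewrite /d; lia].
by rewrite /act3 E; exact: (lin0 (F3 _ _ thL)).
Qed.

Lemma descent4 (j : nat) : descent d j (act4 a j%:Z xi).
Proof.
have [t1 t2 t3 t4] := xiG; have [q [qp E]] := act_descent j gCC ap t4.
exists d1, d2, q; split; first by split.
case: E => [E|E]; [left|right; rewrite /d; lia].
by rewrite /act4 E; exact: (lin0 (F4 _ _ thL)).
Qed.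

Lemma descent1 (j : nat) : descent d p (act1 a (- 1 - j%:Z) xi).
Proof.
have [t1 t2 t3 t4] := xiG; exists d1, d2, d3; split; last by right.
by split=> //=; apply: (dual_le_coact gWC j ap).
Qed.

Lemma G_act2 : G (act2 a (- 1) xi) = twisted d (F (act2 a (- 1) xi)).
Proof.
have [t1 t2 t3 t4] := xiG.
rewrite (@G_graded (d1 + p.+1) d2 d3); first by congr twisted; rewrite /d; lia.
split=> //; have := piece_act gAC (- 1) ap t2.
by have -> : (d1%:Z + p.+1%:Z - (- 1) - 1) = (d1 + p.+1)%N%:Z by lia.
Qed.

Lemma G_act3 : G (act3 a (- 1) xi) = twisted d (F (act3 a (- 1) xi)).
Proof.
have [t1 t2 t3 t4] := xiG.
rewrite (@G_graded d1 (d2 + p.+1) d3); first by congr twisted; rewrite /d; lia.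
split=> //; have := piece_act gBC (- 1) ap t3.
by have -> : (d2%:Z + p.+1%:Z - (- 1) - 1) = (d2 + p.+1)%N%:Z by lia.
Qed.

Lemma G_act4 : G (act4 a (- 1) xi) = twisted d (F (act4 a (- 1) xi)).
Proof.
have [t1 t2 t3 t4] := xiG.
rewrite (@G_graded d1 d2 (d3 + p.+1)); first by congr twisted; rewrite /d; lia.
split=> //; have := piece_act gCC (- 1) ap t4.
by have -> : (d3%:Z + p.+1%:Z - (- 1) - 1) = (d3 + p.+1)%N%:Z by lia.
Qed.

Lemma vanish_exists : exists M, vanish_from a M xi.
Proof.
have [t1 _ _ _] := xiG.
have [M2 H2] := act_trunc a (q2 xi); have [M3 H3] := act_trunc a (q3 xi).
have [M4 H4] := act_trunc a (q4 xi).
exists (N + M2 + M3 + M4)%N; split=> j Mj; [|apply: H2|apply: H3|apply: H4]; try lia.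
by apply: (@coact_eq0 _ _ _ gW N gWC _ _ _ _ ap) => //; lia.
Qed.

Lemma G_slots M : vanish_from a M xi -> forall j : nat, (M <= j)%N ->
  [/\ G (act2 a j%:Z xi) = 0, G (act3 a j%:Z xi) = 0 & G (act4 a j%:Z xi) = 0].
Proof.
move=> [_ v2 v3 v4] j Mj; split.
- have [e1 [e2 [e3 [H _]]]] := descent2 j; rewrite (G_graded H).
  by rewrite /act2 v2// (lin0 (F2 _ _ thL)) twisted0.
- have [e1 [e2 [e3 [H _]]]] := descent3 j; rewrite (G_graded H).
  by rewrite /act3 v3// (lin0 (F3 _ _ thL)) twisted0.
- have [e1 [e2 [e3 [H _]]]] := descent4 j; rewrite (G_graded H).
  by rewrite /act4 v4// (lin0 (F4 _ _ thL)) twisted0.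
Qed.

End Slots.

(** The terms of an identity that are absorbed into the error. *)
Definition negligible I d (r : ser2 R) : Prop := homog2 r /\ cmb I d (twisted d r).

Lemma negligibleD I d f g : negligible I d f -> negligible I d g ->
  negligible I d (f + g).
Proof.
move=> [fh fc] [gh gc]; split; first exact: homog2D.
by rewrite twistedD//; exact: combD.
Qed.

Lemma negligibleZ I d a f : ideal_like I -> negligible I d f ->
  negligible I d (a *: f).
Proof.
move=> Iid [fh fc]; split; first exact: homog2Z.
by rewrite twistedZ; apply: (combZ gensP _ Iid) fc; exact: lower_trunc.
Qed.

Lemma negligibleN I d f : ideal_like I -> negligible I d f -> negligible I d (- f).
Proof. by rewrite -scaleN1r; exact: negligibleZ. Qed.

Lemma negligible_sum I d M (f : 'I_M -> ser2 R) :
  (forall i, negligible I d (f i)) -> negligible I d (\sum_(i < M) f i).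
Proof.
move=> fn; split; first by apply: homog2_sum => i; have [] := fn i.
rewrite twisted_sum => [|i]; last by have [] := fn i.
by apply: comb_sum => i; have [] := fn i.
Qed.

Lemma negligible_descent I d e nu i j k : ideal_like I -> descent d e nu ->
  realizes I i (j + zy * e.+1%:Z) (k + zt * e.+1%:Z) ->
  negligible I d (mon i j k (F nu)).
Proof.
move=> Iid D H; split; last exact: (descent_comb _ D).
by apply: mon_homog; exact: descent_homog D.
Qed.

Lemma eq_mod_negligible d f m r g : f = m + r -> homog2 m ->
  negligible (in_max_ideal (R := R)) d r -> twisted d m = g ->
  eq_mod (gen_alg gens) G (lower d) (twisted d f) g.
Proof.
by move=> -> mh [rh rc] <-; exists (twisted d r) => //; rewrite twistedD.
Qed.

Let max_id : ideal_like (in_max_ideal (R := R)).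
Proof. exact: max_ideal_mull. Qed.

Section Modes.
Variables (a : V) (p d1 d2 d3 : nat) (xi : quad W A B C).
Hypotheses (ap : has_wt a p.+1%:Z) (xiG : graded d1 d2 d3 xi).

Let thL : linear (q1 xi). Proof. by case: xiG => -[]. Qed.

Let d := (d1 + d2 + d3 + p.+1)%N.

Let D1 j := descent1 ap xiG j.
Let D2 j := descent2 ap xiG j.
Let D3 j := descent3 ap xiG j.
Let D4 j := descent4 ap xiG j.

Let MH e nu i j k : descent d e nu -> homog2 (mon i j k (F nu)).
Proof. by move=> D; apply: mon_homog; exact: descent_homog D. Qed.

(** The terms that survive modulo the ideal: there the monomial is exactly
    compensated by the difference of the degrees. *)
Lemma twisted_main M (c : nat -> R[i]) (nu : nat -> quad W A B C) :
  (forall j, descent d j (nu j)) -> (forall j, (M <= j)%N -> G (nu j) = 0) ->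
  twisted d (\sum_(j < M) c j *:
    mon 0 (- (zy * j.+1%:Z)) (- (zt * j.+1%:Z)) (F (nu j))) =
  \sum_(j \in [set: nat]) c j *: G (nu j).
Proof.
move=> D G0; rewrite (@fsum_ord _ _ M) => [|j Mj]; last by rewrite G0// scaler0.
rewrite twisted_sum => [|j]; last by apply: homog2Z; exact: MH (D j).
by apply: eq_bigr => j _; rewrite twistedZ (descent_main (D j)).
Qed.

Lemma twisted_main1 M (nu : nat -> quad W A B C) :
  (forall j, descent d j (nu j)) -> (forall j, (M <= j)%N -> G (nu j) = 0) ->
  twisted d (\sum_(j < M)
    mon 0 (- (zy * j.+1%:Z)) (- (zt * j.+1%:Z)) (F (nu j))) =
  \sum_(j \in [set: nat]) G (nu j).
Proof.
move=> D G0; have := @twisted_main M (fun=> 1) nu D G0.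
under eq_bigr do rewrite scale1r.
by move=> ->; apply: fsum_eq => j; rewrite scale1r.
Qed.

Section ModeY.
Hypotheses (zyE : zy = 1) (ztE : zt = 0).
Hypothesis realY : forall (i : int) (j k : nat),
  realizes (in_max_ideal (R := R)) i j.+1%:Z (- k%:Z).

Let neg e nu i j k (j' k' : nat) : descent d e nu ->
  j + e.+1%:Z = j'.+1%:Z -> k = - k'%:Z ->
  negligible (in_max_ideal (R := R)) d (mon i j k (F nu)).
Proof.
move=> D jE kE; apply: (negligible_descent max_id D).
by rewrite zyE ztE mul1r mul0r addr0 jE kE; exact: realY.
Qed.

(** With x a number and the twist by powers of y, every mode that lowers the total
    degree by j + 1 leaves the factor y^(j+1), and the modes on the form leave
    y^p.+1.  Only the coefficients y^(-1-j) of the a_j w cancel it. *)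
Lemma modeY2 : eq_mod (gen_alg gens) G (lower d) (G (act2 a (- 1) xi)) 0.
Proof.
have [M vM] := vanish_exists ap xiG.
have [E _ _] := Fjac thL vM; rewrite (G_act2 ap xiG).
apply: (@eq_mod_negligible d _ 0 _ _ _ homog2_0 _ (twisted0 d)).
  by rewrite add0r; exact: E.
apply: negligibleD; [apply: negligibleD|]; apply: negligible_sum => j.
- by apply: (neg (j' := p) (k' := 0%N) _ (D1 j)); lia.
- by apply: (neg (j' := j) (k' := 0%N) _ (D4 j)); lia.
- by apply: (neg (j' := j) (k' := j.+1) _ (D3 j)); lia.
Qed.

Lemma modeY3 : eq_mod (gen_alg gens) G (lower d) (G (act3 a (- 1) xi))
  (\sum_(j \in [set: nat]) G (act4 a j%:Z xi)).
Proof.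
have [M vM] := vanish_exists ap xiG.
have [_ E _] := Fjac thL vM; rewrite (G_act3 ap xiG).
rewrite [X in X + _]addrC -addrA in E.
apply: (eq_mod_negligible E).
- by apply: homog2_sum => j; exact: MH (D4 j).
- apply: negligibleD; last apply: negligibleN => //; apply: negligible_sum => j.
    by apply: (neg (j' := (j + p)%N) (k' := 0%N) _ (D1 j)); lia.
  apply: negligibleZ => //.
  by apply: (neg (j' := j) (k' := j.+1) _ (D2 j)); lia.
- rewrite -(@twisted_main1 M)// => [|j /(G_slots ap xiG vM)[]//].
  by congr twisted; apply: eq_bigr => j _; rewrite zyE ztE; congr mon; lia.
Qed.

Lemma modeY4 : eq_mod (gen_alg gens) G (lower d) (G (act4 a (- 1) xi))
  (- \sum_(j \in [set: nat]) (-1) ^+ j *: G (act3 a j%:Z xi)).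
Proof.
have [M vM] := vanish_exists ap xiG.
have [_ _ E] := Fjac thL vM; rewrite (G_act4 ap xiG).
rewrite [RHS]addrC in E.
apply: (eq_mod_negligible E).
- rewrite -scaleN1r; apply: homog2Z.
  by apply: homog2_sum => j; apply: homog2Z; exact: MH (D3 j).
- apply: negligibleD; last apply: negligibleN => //.
    rewrite -[F _]mon_id -[- 1]subr0.
    by apply: (neg (j' := p) (k' := 0%N) _ (D1 0)); lia.
  apply: negligible_sum => j; apply: negligibleZ => //.
  by apply: (neg (j' := j) (k' := 0%N) _ (D2 j)); lia.
- rewrite twistedN -(@twisted_main M (fun j => (-1) ^+ j))//; last first.
    by move=> j /(G_slots ap xiG vM)[].
  congr (- twisted _ _); apply: eq_bigr => j _; rewrite zyE ztE; congr (_ *: mon _ _ _ _); lia.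
Qed.

End ModeY.

Section ModeT.
Hypotheses (zyE : zy = 0) (ztE : zt = 1).
Hypothesis realT : forall (i j : int) (k : nat),
  realizes (in_max_ideal (R := R)) i j k.+1%:Z.

Let neg e nu i j k (k' : nat) : descent d e nu -> k + e.+1%:Z = k'.+1%:Z ->
  negligible (in_max_ideal (R := R)) d (mon i j k (F nu)).
Proof.
move=> D kE; apply: (negligible_descent max_id D).
by rewrite zyE ztE mul1r mul0r addr0 kE; exact: realT.
Qed.

(** With y a number and the twist by powers of x - y, the roles are played by
    (x - y)^(j+1) and by the coefficients (x - y)^(-1-i). *)
Lemma modeT2 : eq_mod (gen_alg gens) G (lower d) (G (act2 a (- 1) xi))
  (\sum_(j \in [set: nat]) G (act3 a j%:Z xi)).
Proof.
have [M vM] := vanish_exists ap xiG.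
have [E _ _] := Fjac thL vM; rewrite (G_act2 ap xiG).
rewrite addrC in E; apply: (eq_mod_negligible E).
- by apply: homog2_sum => j; exact: MH (D3 j).
- apply: negligibleD; apply: negligible_sum => j.
  + by apply: (neg (k' := p) _ _ (D1 j)); lia.
  + by apply: (neg (k' := j) _ _ (D4 j)); lia.
- rewrite -(@twisted_main1 M)// => [|j /(G_slots ap xiG vM)[]//].
  by congr twisted; apply: eq_bigr => j _; rewrite zyE ztE; congr mon; lia.
Qed.

Lemma modeT3 : eq_mod (gen_alg gens) G (lower d) (G (act3 a (- 1) xi))
  (\sum_(j \in [set: nat]) (-1) ^+ j.+1 *: G (act2 a j%:Z xi)).
Proof.
have [M vM] := vanish_exists ap xiG.
have [_ E _] := Fjac thL vM; rewrite (G_act3 ap xiG).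
rewrite addrC in E; apply: (eq_mod_negligible E).
- rewrite -scaleN1r; apply: homog2Z.
  by apply: homog2_sum => j; apply: homog2Z; exact: MH (D2 j).
- apply: negligibleD; apply: negligible_sum => j.
  + by apply: (neg (k' := p) _ _ (D1 j)); lia.
  + by apply: (neg (k' := j) _ _ (D4 j)); lia.
- rewrite -(@twisted_main M (fun j => (-1) ^+ j.+1))//; last first.
    by move=> j /(G_slots ap xiG vM)[].
  rewrite -sumrN; congr twisted; apply: eq_bigr => j _.
  rewrite exprS mulN1r scaleNr zyE ztE; congr (- (_ *: mon _ _ _ _)); lia.
Qed.

Lemma modeT4 : eq_mod (gen_alg gens) G (lower d) (G (act4 a (- 1) xi)) 0.
Proof.
have [M vM] := vanish_exists ap xiG.
have [_ _ E] := Fjac thL vM; rewrite (G_act4 ap xiG).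
apply: (@eq_mod_negligible d _ 0 _ _ _ homog2_0 _ (twisted0 d)).
  by rewrite add0r; exact: E.
apply: negligibleD; [apply: negligibleD|].
- rewrite -[F _]mon_id -[- 1]subr0.
  by apply: (neg (k' := p) _ _ (D1 0)); lia.
- apply: negligibleN => //; apply: negligible_sum => j; apply: negligibleZ => //.
  by apply: (neg (k' := j) _ _ (D2 j)); lia.
- apply: negligibleN => //; apply: negligible_sum => j; apply: negligibleZ => //.
  by apply: (neg (k' := j) _ _ (D3 j)); lia.
Qed.

End ModeT.

End Modes.

Lemma main_comb a (p d1 d2 d3 : nat) xi M (c : nat -> R[i])
    (nu : nat -> quad W A B C) :
  (forall j, descent (d1 + d2 + d3 + p.+1) j (nu j)) ->
  vanish_from a M xi -> (forall j, (M <= j)%N -> G (nu j) = 0) ->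
  cmb (fun=> True) (d1 + d2 + d3 + p.+1)
    (\sum_(j \in [set: nat]) c j *: G (nu j)).
Proof.
move=> D vM G0; rewrite (@fsum_ord _ _ M) => [|j Mj]; last by rewrite G0// scaler0.
apply: comb_sum => j; apply: (combZ gensP _ (I := fun=> True)) => //.
  exact: lower_trunc.
exact: descent_G (D j).
Qed.

Lemma eq_mod_comb d f g : cmb (fun=> True) d g ->
  eq_mod (gen_alg gens) G (lower d) f g -> cmb (fun=> True) d f.
Proof.
move=> gc [e ec ->]; apply: combD => //.
by apply: sub_combination ec => // c r [].
Qed.

Section Spanning.
Variables (PA JA : set A) (PB JB : set B) (PC JC : set C)
  (J : set (W -> R[i]^o)).
Hypotheses (PAC : is_complement PA (C1 (W := A)))
  (PBC : is_complement PB (C1 (W := B))) (PCC : is_complement PC (C1 (W := C))).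
Hypotheses (JAs : lspan JA = PA) (JAh : JA `<=` homogeneous gA)
  (JBs : lspan JB = PB) (JBh : JB `<=` homogeneous gB)
  (JCs : lspan JC = PC) (JCh : JC `<=` homogeneous gC)
  (Js : lspan J = dual_le gW N).
Hypothesis descend : forall a (p d1 d2 d3 : nat) xi,
  has_wt a p.+1%:Z -> graded d1 d2 d3 xi ->
  [/\ cmb (fun=> True) (d1 + d2 + d3 + p.+1) (G (act2 a (- 1) xi)),
      cmb (fun=> True) (d1 + d2 + d3 + p.+1) (G (act3 a (- 1) xi)) &
      cmb (fun=> True) (d1 + d2 + d3 + p.+1) (G (act4 a (- 1) xi))].

Let J0 := quad_prod J JA JB JC.
Let cJ := combination (fun c r => gen_alg gens c r /\ True) G J0.

Lemma basis_dual theta : J theta -> dual_le gW N theta.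
Proof.
move=> Jt; rewrite -Js; exists 1%N, (fun=> 1), (fun=> theta); split=> //.
by rewrite big_ord1 scale1r.
Qed.

Lemma basis_trunc xi : J0 xi -> truncated sg (G xi).
Proof.
move=> [t1 /JAh[d1 _ t2] /JBh[d2 _ t3] /JCh[d3 _ t4]].
apply: (@lower_trunc (d1 + d2 + d3).+1); apply: graded_lower.
by split=> //; exact: basis_dual.
Qed.

Let cD := @combD _ _ gens G J0 (fun=> True).
Let cZ := @combZ _ _ _ _ gensP _ _ basis_trunc (fun=> True) (fun _ _ _ _ => I).
Let c0 := @comb0 _ _ gens G J0 (fun=> True).

(** The same descent serves each of the three module factors. *)
Lemma slot_spanning (X : vmodule V) (pr : nat -> X -> X) (P JX : set X)
    (q : X -> quad W A B C) (m d1 d2 d3 : nat) :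
  canonical_grading pr -> is_complement P (C1 (W := X)) -> lspan JX = P ->
  JX `<=` homogeneous pr -> linear (fun x => F (q x)) ->
  (forall x, piece pr m x -> graded d1 d2 d3 (q x)) ->
  (forall x, JX x -> piece pr m x -> cJ (G (q x))) ->
  (forall a (p e : nat) x, has_wt a p.+1%:Z -> piece pr e x ->
     (e + p.+1)%N = m -> cJ (G (q (act a (- 1) x)))) ->
  forall x, piece pr m x -> cJ (G (q x)).
Proof.
move=> prC PX JXs JXh qL qg qJ qact x xm.
have prG : is_grading pr by have [] := prC.
suff [] : piece pr m x /\ cJ (G (q x)) by [].
apply: (C1_induction prC PX JXs JXh (Q := fun x => piece pr m x /\ cJ (G (q x)))
  _ _ _ _ xm).
- have m0 : piece pr m 0 := piece0 prG m; split=> //.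
  by rewrite (G_graded (qg _ m0)) (lin0 qL) twisted0; exact: c0.
- move=> c y z [ym yc] [zm zc].
  have yzm : piece pr m (c *: y + z) by apply: pieceD => //; exact: piece_scale.
  have yh : homog2 (c *: F (q y)) by apply: homog2Z; exact: Fhomog (qg _ ym).
  split=> //; rewrite (G_graded (qg _ yzm)) qL (twistedD _ yh (Fhomog (qg _ zm))).
  rewrite twistedZ -(G_graded (qg _ ym)) -(G_graded (qg _ zm)).
  by apply: cD => //; exact: cZ.
- by move=> y Jy ym; split=> //; exact: qJ.
- move=> a p e y ap ye em; split; last exact: qact ap ye em.
  have := piece_act prC (- 1) ap ye.
  by have -> : (e%:Z + p.+1%:Z - (- 1) - 1) = m%:Z by lia.
Qed.

(** Induction on the total degree: the identities trade a factor in C_1 for terms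
    of strictly smaller total degree. *)
Lemma spanning d : forall d1 d2 d3 xi, graded d1 d2 d3 xi ->
  (d1 + d2 + d3 < d)%N -> cJ (G xi).
Proof.
elim: d => // d IH d1 d2 d3 [theta v u w] [/= td vd ud wd]; rewrite ltnS => dd.
have lowJ f : cmb (fun=> True) d f -> cJ f.
  apply: (comb_trans gensP basis_trunc) => nu [e1 [e2 [e3 [H ed]]]].
  exact: IH H ed.
have thL t : dual_le gW N t -> linear t by case.
have low e f : (e <= d)%N -> cmb (fun=> True) e f -> cJ f.
  move=> ed fc; apply: lowJ; apply: sub_combination fc => // nu.
  by move=> [e1 [e2 [e3 [H lt]]]]; exists e1, e2, e3; split=> //; lia.
(* All four coordinates are basis vectors up to the expansion of the form. *)
have stage0 t x y z : dual_le gW N t -> JA x -> JB y -> JC z ->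
    piece gA d1 x -> piece gB d2 y -> piece gC d3 z -> cJ (G (Quad t x y z)).
  move=> tN Jx Jy Jz xd yd zd; move: (tN); rewrite -Js => -[n [c [e [Je tE]]]].
  have ge i : graded d1 d2 d3 (Quad (e i) x y z) by split=> //; exact: basis_dual (Je i).
  have -> : G (Quad t x y z) = \sum_i c i *: G (Quad (e i) x y z).
    rewrite (@G_graded d1 d2 d3 (Quad t x y z))// tE (lin_sum (F1 _ _ _)) twisted_sum.
      by apply: eq_bigr => i _; rewrite (linZ (F1 _ _ _)) twistedZ (G_graded (ge i)).
    by move=> i; rewrite (linZ (F1 _ _ _)); apply: homog2Z; exact: Fhomog (ge i).
  apply: comb_sum => i; apply: cZ; rewrite -[G _]scale1r -lact_const.
  apply: (@comb_single _ _ gens G J0 (fun=> True) _ (lconst 1)) => //.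
    by split=> //; exact: (Je i).
  exact: gen_alg_const.
have stage1 t x y z : dual_le gW N t -> JA x -> JB y ->
    piece gA d1 x -> piece gB d2 y -> piece gC d3 z -> cJ (G (Quad t x y z)).
  move=> tN Jx Jy xd yd zd.
  apply: (slot_spanning gCC PCC JCs JCh (q := fun z => Quad t x y z)
    (d1 := d1) (d2 := d2) (d3 := d3) _ _ _ _ zd).
  - exact: F4 (thL _ tN).
  - by move=> z' z'd; split.
  - by move=> z' Jz' z'd; exact: stage0.
  - move=> a p e z' ap z'e ed; have gr : graded d1 d2 e (Quad t x y z') by split.
    by have [_ _ /low] := descend ap gr; apply; lia.
have stage2 t x y z : dual_le gW N t -> JA x ->
    piece gA d1 x -> piece gB d2 y -> piece gC d3 z -> cJ (G (Quad t x y z)).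
  move=> tN Jx xd yd zd.
  apply: (slot_spanning gBC PBC JBs JBh (q := fun y => Quad t x y z)
    (d1 := d1) (d2 := d2) (d3 := d3) _ _ _ _ yd).
  - exact: F3 (thL _ tN).
  - by move=> y' y'd; split.
  - by move=> y' Jy' y'd; exact: stage1.
  - move=> a p e y' ap y'e ed; have gr : graded d1 e d3 (Quad t x y' z) by split.
    by have [_ /low + _] := descend ap gr; apply; lia.
apply: (slot_spanning gAC PAC JAs JAh (q := fun v => Quad theta v u w)
  (d1 := d1) (d2 := d2) (d3 := d3) _ _ _ _ vd).
- exact: F2 (thL _ td).
- by move=> v' v'd; split.
- by move=> v' Jv' v'd; exact: stage2.
- move=> a p e v' ap v'e ed; have gr : graded e d2 d3 (Quad theta v' u w) by split.
  by have [/low + _ _] := descend ap gr; apply; lia.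
Qed.

Lemma spanning_lin_comb d1 d2 d3 xi : graded d1 d2 d3 xi ->
  lin_comb (gen_alg gens) G J0 (G xi).
Proof.
move=> H; apply: (sub_combination (J := J0) _ _ (spanning H (ltnSn _))) => //.
by move=> c r [Kcr _]; split=> //; have [] := gen_algP gensP Kcr.
Qed.

End Spanning.

Lemma realizes_gen (I : lser R -> Prop) c r i j k : gens (c, r) -> I r ->
  (forall f, homog2 f -> Sp (mon i j k f) = lact c (Sp f)) -> realizes I i j k.
Proof. by move=> cr Ir H; exists c, r; split=> //; exact: gen_alg_gen. Qed.

Lemma realizes_any (I : lser R -> Prop) i j k :
  realizes I i j k -> realizes (fun=> True) i j k.
Proof. by move=> [c [r [Kcr _ H]]]; exists c, r. Qed.

Let mul_max i j k i' j' k' : realizes (fun=> True) i j k ->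
  realizes (in_max_ideal (R := R)) i' j' k' ->
  realizes (in_max_ideal (R := R)) (i + i') (j + j') (k + k').
Proof. by apply: realizes_mul => c d cp _ _; exact: max_ideal_mull. Qed.

Let mul_any i j k i' j' k' : realizes (fun=> True) i j k ->
  realizes (fun=> True) i' j' k' ->
  realizes (fun=> True) (i + i') (j + j') (k + k').
Proof. exact: realizes_mul. Qed.

Section Conclusions.
Variables (PA JA : set A) (PB JB : set B) (PC JC : set C)
  (J : set (W -> R[i]^o)).
Hypotheses (PAC : is_complement PA (C1 (W := A)))
  (PBC : is_complement PB (C1 (W := B))) (PCC : is_complement PC (C1 (W := C))).
Hypotheses (JAs : lspan JA = PA) (JAh : JA `<=` homogeneous gA)
  (JBs : lspan JB = PB) (JBh : JB `<=` homogeneous gB)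
  (JCs : lspan JC = PC) (JCh : JC `<=` homogeneous gC)
  (Js : lspan J = dual_le gW N).
Variables (a : V) (n : int) (d1 d2 d3 : nat) (xi : quad W A B C).
Hypotheses (an : has_wt a n) (n1 : 1 <= n) (xiG : graded d1 d2 d3 xi).

Let K := gen_alg gens.
Let J0 := quad_prod J JA JB JC.
Let Omega : set (quad W A B C) := quad_le gW N.

Lemma lower_le d f g : eq_mod K G (lower d) f g -> eq_mod K G Omega f g.
Proof.
move=> [e ec ->]; exists e => //; apply: sub_combination ec => // nu.
by move=> [e1 [e2 [e3 [[]]]]].
Qed.

Let weight_pos : exists2 p : nat, n = p.+1%:Z & has_wt a p.+1%:Z.
Proof.
exists (absz n).-1; first by lia.
by have -> : ((absz n).-1.+1%:Z) = n by lia.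
Qed.

Theorem reduction_y : zy = 1 -> zt = 0 ->
  (forall i, realizes (fun=> True) i 0 0) ->
  realizes (in_max_ideal (R := R)) 0 1 0 ->
  realizes (fun=> True) 0 0 (-1) ->
  [/\ lin_comb K G J0 (G xi),
      eq_mod K G Omega (G (act2 a (-1) xi)) 0,
      eq_mod K G Omega (G (act3 a (-1) xi))
        (\sum_(j \in [set: nat]) G (act4 a j%:Z xi)) &
      eq_mod K G Omega (G (act4 a (-1) xi))
        (- \sum_(j \in [set: nat]) (-1) ^+ j *: G (act3 a j%:Z xi))].
Proof.
move=> zyE ztE rX rY rT.
have realY (i : int) (j k : nat) :
    realizes (in_max_ideal (R := R)) i j.+1%:Z (- k%:Z).
  have := mul_max (mul_any (rX i) (mul_any (realizes_exp k rT)
    (realizes_exp j (realizes_any rY)))) rY.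
  congr realizes; lia.
have [p nE ap] := weight_pos; split.
- apply: (spanning_lin_comb PAC PBC PCC JAs JAh JBs JBh JCs JCh Js _ xiG).
  move=> b q e1 e2 e3 nu bq H; have [M vM] := vanish_exists bq H; split.
  + apply: (eq_mod_comb _ (modeY2 bq H zyE ztE realY)); exact: comb0.
  + apply: (eq_mod_comb _ (modeY3 bq H zyE ztE realY)).
    have := @main_comb b q e1 e2 e3 nu M (fun=> 1) (fun j => act4 b j%:Z nu)
      (descent4 bq H) vM (fun j Mj => let: And3 _ _ z := G_slots bq H vM Mj in z).
    by congr cmb; apply: fsum_eq => j; rewrite scale1r.
  + apply: (eq_mod_comb _ (modeY4 bq H zyE ztE realY)).
    apply: (combN gensP (@lower_trunc _) (I := fun=> True)) => //.
    exact: (@main_comb b q e1 e2 e3 nu M (fun j => (-1) ^+ j)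
      (fun j => act3 b j%:Z nu) (descent3 bq H) vM
      (fun j Mj => let: And3 _ z _ := G_slots bq H vM Mj in z)).
- exact: lower_le (modeY2 ap xiG zyE ztE realY).
- exact: lower_le (modeY3 ap xiG zyE ztE realY).
- exact: lower_le (modeY4 ap xiG zyE ztE realY).
Qed.

Theorem reduction_t : zy = 0 -> zt = 1 ->
  realizes (fun=> True) 1 0 0 -> realizes (fun=> True) (-1) 0 0 ->
  (forall j, realizes (fun=> True) 0 j 0) ->
  realizes (in_max_ideal (R := R)) 0 0 1 ->
  [/\ lin_comb K G J0 (G xi),
      eq_mod K G Omega (G (act2 a (-1) xi))
        (\sum_(j \in [set: nat]) G (act3 a j%:Z xi)),
      eq_mod K G Omega (G (act3 a (-1) xi))
        (\sum_(j \in [set: nat]) (-1) ^+ j.+1 *: G (act2 a j%:Z xi)) &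
      eq_mod K G Omega (G (act4 a (-1) xi)) 0].
Proof.
move=> zyE ztE rX rX' rY rT.
have rXi (i : int) : realizes (fun=> True) i 0 0.
  case: i => i.
    by have := realizes_exp i rX; congr realizes; lia.
  by have := realizes_exp i.+1 rX'; congr realizes; lia.
have realT (i j : int) (k : nat) : realizes (in_max_ideal (R := R)) i j k.+1%:Z.
  have := mul_max (mul_any (rXi i) (mul_any (rY j)
    (realizes_exp k (realizes_any rT)))) rT.
  congr realizes; lia.
have [p nE ap] := weight_pos; split.
- apply: (spanning_lin_comb PAC PBC PCC JAs JAh JBs JBh JCs JCh Js _ xiG).
  move=> b q e1 e2 e3 nu bq H; have [M vM] := vanish_exists bq H; split.
  + apply: (eq_mod_comb _ (modeT2 bq H zyE ztE realT)).
    have := @main_comb b q e1 e2 e3 nu M (fun=> 1) (fun j => act3 b j%:Z nu)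
      (descent3 bq H) vM (fun j Mj => let: And3 _ z _ := G_slots bq H vM Mj in z).
    by congr cmb; apply: fsum_eq => j; rewrite scale1r.
  + apply: (eq_mod_comb _ (modeT3 bq H zyE ztE realT)).
    exact: (@main_comb b q e1 e2 e3 nu M (fun j => (-1) ^+ j.+1)
      (fun j => act2 b j%:Z nu) (descent2 bq H) vM
      (fun j Mj => let: And3 z _ _ := G_slots bq H vM Mj in z)).
  + apply: (eq_mod_comb _ (modeT4 bq H zyE ztE realT)); exact: comb0.
- exact: lower_le (modeT2 ap xiG zyE ztE realT).
- exact: lower_le (modeT3 ap xiG zyE ztE realT).
- exact: lower_le (modeT4 ap xiG zyE ztE realT).
Qed.

End Conclusions.

End Reduction.

(** * The four correlation functions *)

Section Instances.
Context {R : realType}.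

Lemma monomials_right e : monomials (monom (R := R) e).
Proof.
split; [exact: homog2_monom|exact: monomD|exact: monomZ|exact: monomM|].
exact: monom_id.
Qed.

Lemma monomials_left e : monomials (fun i j k => monom (R := R) e j k i).
Proof.
split=> *; [exact: homog2_monom|exact: monomD|exact: monomZ| |exact: monom_id].
exact: monomM.
Qed.

Lemma iota_pow0 (a b : R[i]) : iota_pow a b 0 = lconst 1.
Proof.
apply/funext => -[[|n]|n]; rewrite /iota_pow /lconst //=.
  by rewrite cbinom0 subrr expr0z expr0 !mul1r.
by rewrite (@cbinom_small _ 0)// !mul0r.
Qed.

Lemma iota_family sg (a b : R[i]) : a != 0 ->
  power_family sg (fun n : nat => iota_pow a b n%:Z).
Proof.
move=> a0; split=> [|n|n]; [exact: iota_pow0| |exact: bounded_iota_nat].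
by rewrite iota_powD// -intS.
Qed.

Lemma lmon_family sg : power_family sg (fun n : nat => lmon (R := R) n%:Z).
Proof.
split=> [|n|n]; [|apply/funext => m|exact: bounded_mon].
  by apply/funext => m; rewrite /lmon /lconst; case: eqP.
rewrite /lmul (@fsum_single _ _ 1) => [|k k1].
  by rewrite /lmon eqxx mul1r; congr (nat_of_bool _)%:R; apply/eqP/eqP; lia.
by rewrite /lmon (negPf k1) mul0r.
Qed.

Lemma lact_lmon0 (f : cser R) : lact (lmon 0) f = f.
Proof. by apply/funext => p; rewrite lact_mon subr0. Qed.

Lemma lact_iota_pow0 a b (f : cser R) : lact (iota_pow a b 0) f = f.
Proof. by rewrite iota_pow0 lact_const scale1r. Qed.

Lemma max_lmon1 : in_max_ideal (lmon (R := R) 1).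
Proof. by move=> n n0; rewrite /lmon; case: eqP n0 => // ->. Qed.

Lemma powser_lmon1 : is_powser (lmon (R := R) 1).
Proof. by move=> n n0; rewrite /lmon; case: eqP n0 => // ->. Qed.

End Instances.

Section Correlations.
Context {R : realType} {V : voa R} {A B C BC AB W : vmodule V}.

Lemma quadrilinear_right (Y1 : intw A BC W) (Y2 : intw B C BC) h k :
  log_intertwining Y1 -> log_intertwining Y2 ->
  quadrilinear (corr_right (A := A) (B := B) (C := C) Y1 Y2 h k).
Proof.
move=> Y1P Y2P; split=> [v u w c t t'|t u w tL c x y|t v w tL c x y|t v u tL c x y];
  apply/funext => b; apply/funext => s.
- by [].
- by rewrite /corr_right/= (Y_linear_l Y1P) tL.
- by rewrite /corr_right/= (Y_linear_l Y2P) (Y_linear_r Y1P) tL.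
- by rewrite /corr_right/= (Y_linear_r Y2P) (Y_linear_r Y1P) tL.
Qed.

Lemma quadrilinear_left (Y1 : intw AB C W) (Y2 : intw A B AB) h k :
  log_intertwining Y1 -> log_intertwining Y2 ->
  quadrilinear (corr_left (A := A) (B := B) (C := C) Y1 Y2 h k).
Proof.
move=> Y1P Y2P; split=> [v u w c t t'|t u w tL c x y|t v w tL c x y|t v u tL c x y];
  apply/funext => b; apply/funext => s.
- by [].
- by rewrite /corr_left/= (Y_linear_l Y2P) (Y_linear_l Y1P) tL.
- by rewrite /corr_left/= (Y_linear_r Y2P) (Y_linear_l Y1P) tL.
- by rewrite /corr_left/= (Y_linear_r Y1P) tL.
Qed.

Variables (gW : nat -> W -> W) (gA : nat -> A -> A) (gB : nat -> B -> B)
  (gC : nat -> C -> C) (N : nat).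
Hypotheses (gWC : canonical_grading gW) (gAC : canonical_grading gA)
  (gBC : canonical_grading gB) (gCC : canonical_grading gC).
Variables (PA JA : set A) (PB JB : set B) (PC JC : set C)
  (J : set (W -> R[i]^o)).
Hypotheses (PAC : is_complement PA (C1 (W := A)))
  (PBC : is_complement PB (C1 (W := B))) (PCC : is_complement PC (C1 (W := C))).
Hypotheses (JAs : lspan JA = PA) (JAh : JA `<=` homogeneous gA)
  (JBs : lspan JB = PB) (JBh : JB `<=` homogeneous gB)
  (JCs : lspan JC = PC) (JCh : JC `<=` homogeneous gC)
  (Js : lspan J = dual_le gW N).
Variables (a : V) (n : int) (d1 d2 d3 : nat) (xi : quad W A B C).
Hypotheses (an : has_wt a n) (n1 : 1 <= n) (xiG : graded gW gA gB gC N d1 d2 d3 xi).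
Variables (h k : nat) (l : R[i]).
Let z := cexp l.
Let z0 : z != 0. Proof. by rewrite /z -cpow1 cpow_neq0. Qed.
Let J0 := quad_prod J JA JB JC.
Let Omega : set (quad W A B C) := quad_le gW N.

Section Right.
Variables (Y1 : intw A BC W) (Y2 : intw B C BC).
Hypotheses (Y1P : log_intertwining Y1) (Y2P : log_intertwining Y2).

Let Fhomog e1 e2 e3 nu : graded gW gA gB gC N e1 e2 e3 nu ->
  homog2 (corr_right Y1 Y2 h k nu).
Proof.
move=> [t1 t2 t3 t4]; apply: (homog2_right h k Y1P Y2P gWC t1).
- exact: piece_gen gAC _ _ t2.
- exact: piece_gen gBC _ _ t3.
- exact: piece_gen gCC _ _ t4.
Qed.

(** The number is the value of the big variable x, so that (x - y)^(-1) becomes a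
    power series in y. *)
Lemma right_y : let K := ring_y_in_y z in
  let G := G_right_y Y1 Y2 gA gB gC h k l in
  [/\ lin_comb K G J0 (G xi),
      eq_mod K G Omega (G (act2 a (-1) xi)) 0,
      eq_mod K G Omega (G (act3 a (-1) xi))
        (\sum_(j \in [set: nat]) G (act4 a j%:Z xi)) &
      eq_mod K G Omega (G (act4 a (-1) xi))
        (- \sum_(j \in [set: nat]) (-1) ^+ j *: G (act3 a j%:Z xi))].
Proof.
move=> K G.
have gensP c r : [set (iota_pow z (-1) (-1), iota_pow z (-1) (-1));
    (lmon 1, lmon 1)] (c, r) -> bounded true c /\ is_powser r.
  move=> [[-> ->]|[-> ->]]; split.
  - exact: powser_bounded (powser_iota _ _ _).
  - exact: powser_iota.
  - exact: bounded_mon.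
  - exact: powser_lmon1.
have spY f : homog2 f -> spec_big l (monom (-1) 0 1 0 f) = lact (lmon 1) (spec_big l f).
  by move=> fh; rewrite spec_big_monom// lact_iota_pow0 expr0z scale1r.
have H := reduction_y gWC gAC gBC gCC
  (quadrilinear_right h k Y1P Y2P) Fhomog (right_identities h k Y1P Y2P)
  (monomials_right (-1)) (spec_big_specialization l) gensP (lmon_family true)
  spY PAC PBC PCC JAs JAh JBs JBh JCs JCh Js an n1 xiG.
apply: H => //.
- move=> i; apply: (@realizes_scalar _ _ _ _ i 0 0 (z ^ i)) => f fh.
  by rewrite spec_big_monom// lact_iota_pow0 lact_lmon0.
- apply: (@realizes_gen _ _ _ _ _ (lmon 1) (lmon 1)) => //; first by right.
  exact: max_lmon1.
- apply: (@realizes_gen _ _ _ _ _ (iota_pow z (-1) (-1)) (iota_pow z (-1) (-1)))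
    => //; first by left.
  by move=> f fh; rewrite spec_big_monom// expr0z scale1r lact_lmon0.
Qed.

(** The number is the value of the small variable y.  Here (x - y)^(-1) would be an
    infinite series in 1 / x, but after the twist only powers of x - y with
    nonnegative exponents are left. *)
Lemma right_xy : let K := ring_xy_in_x z in
  let G := G_right_xy Y1 Y2 gA gB gC h k l z in
  [/\ lin_comb K G J0 (G xi),
      eq_mod K G Omega (G (act2 a (-1) xi))
        (\sum_(j \in [set: nat]) G (act3 a j%:Z xi)),
      eq_mod K G Omega (G (act3 a (-1) xi))
        (\sum_(j \in [set: nat]) (-1) ^+ j.+1 *: G (act2 a j%:Z xi)) &
      eq_mod K G Omega (G (act4 a (-1) xi)) 0].
Proof.
move=> K G.
have gensP c r : [set (lmon 1, iota_pow z 1 1); (lmon (-1), iota_pow z 1 (-1));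
    (iota_pow (- z) 1 1, lmon 1)] (c, r) -> bounded false c /\ is_powser r.
  move=> [[[-> ->]|[-> ->]]|[-> ->]]; split.
  - exact: bounded_mon.
  - exact: powser_iota.
  - exact: bounded_mon.
  - exact: powser_iota.
  - exact: (bounded_iota_nat _ _ _ 1).
  - exact: powser_lmon1.
have spX i f : spec_small l (monom (-1) i 0 0 f) = lact (lmon i) (spec_small l f).
  by rewrite spec_small_shift expr0z scale1r.
have spY j f : spec_small l (monom (-1) 0 j 0 f) = z ^ j *: spec_small l f.
  by rewrite spec_small_shift lact_lmon0.
have spT f : homog2 f -> spec_small l (monom (-1) 0 0 1 f) =
    lact (iota_pow (- z) 1 1) (spec_small l f).
  move=> fh; have SP := spec_small_specialization l.
  rewrite monom_add scaleN1r -scaleN1r (specD SP); last first.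
  - by apply: homog2Z; exact: homog2_monom.
  - exact: homog2_monom.
  rewrite (specZ SP) spX spY expr1z; apply/funext => p.
  change (lact (lmon 1) (spec_small l f) p + -1 * (z * spec_small l f p) =
    lact (iota_pow (- z) 1 1) (spec_small l f) p).
  by rewrite lact_iota1 lact_mon; ring.
have zN0 : - z != 0 by rewrite oppr_eq0.
have H := reduction_t gWC gAC gBC gCC
  (quadrilinear_right h k Y1P Y2P) Fhomog (right_identities h k Y1P Y2P)
  (monomials_right (-1)) (spec_small_specialization l) gensP
  (iota_family false 1 zN0)
  spT PAC PBC PCC JAs JAh JBs JBh JCs JCh Js an n1 xiG.
apply: H => //.
- by apply: (@realizes_gen _ _ _ _ _ (lmon 1) (iota_pow z 1 1)) => //; left; left.
- by apply: (@realizes_gen _ _ _ _ _ (lmon (-1)) (iota_pow z 1 (-1))) => //; left; right.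
- by move=> j; apply: (@realizes_scalar _ _ _ _ 0 j 0 (z ^ j)).
- apply: (@realizes_gen _ _ _ _ _ (iota_pow (- z) 1 1) (lmon 1)) => //; first by right.
  exact: max_lmon1.
Qed.

End Right.

Section Left.
Variables (Y1 : intw AB C W) (Y2 : intw A B AB).
Hypotheses (Y1P : log_intertwining Y1) (Y2P : log_intertwining Y2).

Let Fhomog e1 e2 e3 nu : graded gW gA gB gC N e1 e2 e3 nu ->
  homog2 (corr_left Y1 Y2 h k nu).
Proof.
move=> [t1 t2 t3 t4]; apply: (homog2_left h k Y1P Y2P gWC t1).
- exact: piece_gen gAC _ _ t2.
- exact: piece_gen gBC _ _ t3.
- exact: piece_gen gCC _ _ t4.
Qed.

(** The number is the value of x = y + t, the sum of the two variables, so that y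
    acts as z - t. *)
Lemma left_y : let K := ring_y_in_t z in
  let G := G_left_y Y1 Y2 gA gB gC h k l z in
  [/\ lin_comb K G J0 (G xi),
      eq_mod K G Omega (G (act2 a (-1) xi)) 0,
      eq_mod K G Omega (G (act3 a (-1) xi))
        (\sum_(j \in [set: nat]) G (act4 a j%:Z xi)) &
      eq_mod K G Omega (G (act4 a (-1) xi))
        (- \sum_(j \in [set: nat]) (-1) ^+ j *: G (act3 a j%:Z xi))].
Proof.
move=> K G.
have gensP c r : [set (lmon (-1), iota_pow z (-1) (-1));
    (iota_pow z (-1) 1, lmon 1)] (c, r) -> bounded true c /\ is_powser r.
  move=> [[-> ->]|[-> ->]]; split.
  - exact: bounded_mon.
  - exact: powser_iota.
  - exact: (bounded_iota_nat _ _ _ 1).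
  - exact: powser_lmon1.
have spY f : homog2 f -> spec_sum l (monom 1 1 0 0 f) =
    lact (iota_pow z (-1) 1) (spec_sum l f) by exact: spec_sum_big.
have H := reduction_y gWC gAC gBC gCC
  (quadrilinear_left h k Y1P Y2P) Fhomog (left_identities h k Y1P Y2P)
  (monomials_left 1) (spec_sum_specialization l) gensP (iota_family true (-1) z0)
  spY PAC PBC PCC JAs JAh JBs JBh JCs JCh Js an n1 xiG.
apply: H => //.
- move=> i; apply: (@realizes_scalar _ _ _ _ i 0 0 (z ^ i)) => f fh.
  exact: spec_sum_sum.
- apply: (@realizes_gen _ _ _ _ _ (iota_pow z (-1) 1) (lmon 1)) => //; first by right.
  exact: max_lmon1.
- apply: (@realizes_gen _ _ _ _ _ (lmon (-1)) (iota_pow z (-1) (-1))) => //;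
    first by left.
  by move=> f fh; exact: spec_sum_shift.
Qed.

(** The number is the value of the big variable y, so that x^(-1) becomes a power
    series in t. *)
Lemma left_xy : let K := ring_xy_in_t z in
  let G := G_left_xy Y1 Y2 gA gB gC h k l in
  [/\ lin_comb K G J0 (G xi),
      eq_mod K G Omega (G (act2 a (-1) xi))
        (\sum_(j \in [set: nat]) G (act3 a j%:Z xi)),
      eq_mod K G Omega (G (act3 a (-1) xi))
        (\sum_(j \in [set: nat]) (-1) ^+ j.+1 *: G (act2 a j%:Z xi)) &
      eq_mod K G Omega (G (act4 a (-1) xi)) 0].
Proof.
move=> K G.
have gensP c r : [set (iota_pow z 1 1, iota_pow z 1 1);
    (iota_pow z 1 (-1), iota_pow z 1 (-1)); (lmon 1, lmon 1)] (c, r) ->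
    bounded true c /\ is_powser r.
  move=> [[[-> ->]|[-> ->]]|[-> ->]]; split.
  - exact: powser_bounded (powser_iota _ _ _).
  - exact: powser_iota.
  - exact: powser_bounded (powser_iota _ _ _).
  - exact: powser_iota.
  - exact: bounded_mon.
  - exact: powser_lmon1.
have spX i f : homog2 f -> spec_big l (monom 1 0 0 i f) =
    lact (iota_pow z 1 i) (spec_big l f).
  by move=> fh; rewrite spec_big_monom// lact_lmon0 expr0z scale1r.
have spY j f : homog2 f -> spec_big l (monom 1 j 0 0 f) = z ^ j *: spec_big l f.
  by move=> fh; rewrite spec_big_monom// lact_lmon0 lact_iota_pow0.
have spT f : homog2 f -> spec_big l (monom 1 0 1 0 f) = lact (lmon 1) (spec_big l f).
  by move=> fh; rewrite spec_big_monom// lact_iota_pow0 expr0z scale1r.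
have H := reduction_t gWC gAC gBC gCC
  (quadrilinear_left h k Y1P Y2P) Fhomog (left_identities h k Y1P Y2P)
  (monomials_left 1) (spec_big_specialization l) gensP (lmon_family true)
  spT PAC PBC PCC JAs JAh JBs JBh JCs JCh Js an n1 xiG.
apply: H => //.
- by apply: (@realizes_gen _ _ _ _ _ (iota_pow z 1 1) (iota_pow z 1 1)) => //;
    [left; left|exact: spX].
- by apply: (@realizes_gen _ _ _ _ _ (iota_pow z 1 (-1)) (iota_pow z 1 (-1))) => //;
    [left; right|exact: spX].
- by move=> j; apply: (@realizes_scalar _ _ _ _ 0 j 0 (z ^ j)); exact: spY.
- apply: (@realizes_gen _ _ _ _ _ (lmon 1) (lmon 1)) => //; first by right.
  exact: max_lmon1.
Qed.

End Left.
End Correlations.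

Theorem theorem3p1 (R : realType) (V : voa R) (A B C : vmodule V)
  (A_indec : indecomposable [set: A]) (B_indec : indecomposable [set: B])
  (C_indec : indecomposable [set: C])
  (A_cof : C1_cofinite A) (B_cof : C1_cofinite B) (C_cof : C1_cofinite C)
  (A_grad : nat_gradable A) (B_grad : nat_gradable B) (C_grad : nat_gradable C)
  (BC A_BC AB AB_C : vmodule V)
  (YBC : intw B C BC) (YA_BC : intw A BC A_BC)
  (YAB : intw A B AB) (YAB_C : intw AB C AB_C)
  (BC_fus : is_fusion_product YBC) (A_BC_fus : is_fusion_product YA_BC)
  (AB_fus : is_fusion_product YAB) (AB_C_fus : is_fusion_product YAB_C)
  (gA : nat -> A -> A) (gB : nat -> B -> B) (gC : nat -> C -> C)
  (gA_BC : nat -> A_BC -> A_BC) (gAB_C : nat -> AB_C -> AB_C)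
  (gA_can : canonical_grading gA) (gB_can : canonical_grading gB)
  (gC_can : canonical_grading gC) (gA_BC_can : canonical_grading gA_BC)
  (gAB_C_can : canonical_grading gAB_C)
  (PA JA : set A) (PB JB : set B) (PC JC : set C)
  (PA_compl : is_complement PA (C1 (W:=A)))
  (PB_compl : is_complement PB (C1 (W:=B)))
  (PC_compl : is_complement PC (C1 (W:=C)))
  (JA_basis : is_basis JA PA) (JA_hom : JA `<=` homogeneous gA)
  (JB_basis : is_basis JB PB) (JB_hom : JB `<=` homogeneous gB)
  (JC_basis : is_basis JC PC) (JC_hom : JC `<=` homogeneous gC)
  (N : nat) (J : set (A_BC -> R[i]^o)) (J' : set (AB_C -> R[i]^o))
  (J_basis : is_basis J (dual_le gA_BC N))
  (J_hom : J `<=` dual_homogeneous gA_BC)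
  (J'_basis : is_basis J' (dual_le gAB_C N))
  (J'_hom : J' `<=` dual_homogeneous gAB_C)
  (h k : nat) (v : A) (u : B) (w : C)
  (v_hom : homogeneous gA v) (u_hom : homogeneous gB u)
  (w_hom : homogeneous gC w)
  (a : V) (n : int) (a_wt : has_wt a n) (n_ge1 : 1 <= n)
  (x0 y0 lx ly : R[i]) (x0_neq0 : x0 != 0) (y0_neq0 : y0 != 0)
  (lxP : cexp lx = x0) (lyP : cexp ly = y0) :
  (forall theta : A_BC -> R[i]^o, J theta ->
     let xi := Quad theta v u w in
     let J0 := quad_prod J JA JB JC in
     let Omega := quad_le (A:=A) (B:=B) (C:=C) gA_BC N in
     let Gy := G_right_y YA_BC YBC gA gB gC h k lx in
     let Gxy := G_right_xy YA_BC YBC gA gB gC h k ly y0 in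
     let Ky := ring_y_in_y x0 in
     let Kxy := ring_xy_in_x y0 in
     lin_comb Ky Gy J0 (Gy xi) /\
     lin_comb Kxy Gxy J0 (Gxy xi) /\
     eq_mod Kxy Gxy Omega (Gxy (act2 a (-1) xi))
       (\sum_(j \in [set: nat]) Gxy (act3 a j%:Z xi)) /\
     eq_mod Kxy Gxy Omega (Gxy (act3 a (-1) xi))
       (\sum_(j \in [set: nat]) (-1) ^+ j.+1 *: Gxy (act2 a j%:Z xi)) /\
     eq_mod Kxy Gxy Omega (Gxy (act4 a (-1) xi)) 0 /\
     eq_mod Ky Gy Omega (Gy (act2 a (-1) xi)) 0 /\
     eq_mod Ky Gy Omega (Gy (act3 a (-1) xi))
       (\sum_(j \in [set: nat]) Gy (act4 a j%:Z xi)) /\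
     eq_mod Ky Gy Omega (Gy (act4 a (-1) xi))
       (- \sum_(j \in [set: nat]) (-1) ^+ j *: Gy (act3 a j%:Z xi))) /\
  (forall theta' : AB_C -> R[i]^o, J' theta' ->
     let xi := Quad theta' v u w in
     let J0 := quad_prod J' JA JB JC in
     let Omega := quad_le (A:=A) (B:=B) (C:=C) gAB_C N in
     let Gy := G_left_y YAB_C YAB gA gB gC h k lx x0 in
     let Gxy := G_left_xy YAB_C YAB gA gB gC h k ly in
     let Ky := ring_y_in_t x0 in
     let Kxy := ring_xy_in_t y0 in
     lin_comb Ky Gy J0 (Gy xi) /\
     lin_comb Kxy Gxy J0 (Gxy xi) /\
     eq_mod Kxy Gxy Omega (Gxy (act2 a (-1) xi))
       (\sum_(j \in [set: nat]) Gxy (act3 a j%:Z xi)) /\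
     eq_mod Kxy Gxy Omega (Gxy (act3 a (-1) xi))
       (\sum_(j \in [set: nat]) (-1) ^+ j.+1 *: Gxy (act2 a j%:Z xi)) /\
     eq_mod Kxy Gxy Omega (Gxy (act4 a (-1) xi)) 0 /\
     eq_mod Ky Gy Omega (Gy (act2 a (-1) xi)) 0 /\
     eq_mod Ky Gy Omega (Gy (act3 a (-1) xi))
       (\sum_(j \in [set: nat]) Gy (act4 a j%:Z xi)) /\
     eq_mod Ky Gy Omega (Gy (act4 a (-1) xi))
       (- \sum_(j \in [set: nat]) (-1) ^+ j *: Gy (act3 a j%:Z xi))).
Proof.
have YBCP : log_intertwining YBC by case: BC_fus.
have YA_BCP : log_intertwining YA_BC by case: A_BC_fus.
have YABP : log_intertwining YAB by case: AB_fus.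
have YAB_CP : log_intertwining YAB_C by case: AB_C_fus.
have [_ JAs] := JA_basis; have [_ JBs] := JB_basis; have [_ JCs] := JC_basis.
have [d1 _ vd] := v_hom; have [d2 _ ud] := u_hom; have [d3 _ wd] := w_hom.
split=> theta Jt xi J0 Omega Gy Gxy Ky Kxy.
- have [_ Js] := J_basis; have tN := basis_dual Js Jt.
  have xiG : graded gA_BC gA gB gC N d1 d2 d3 xi by split.
  have := right_y gA_BC_can gA_can gB_can gC_can PA_compl PB_compl PC_compl
    JAs JA_hom JBs JB_hom JCs JC_hom Js a_wt n_ge1 xiG h k lx YA_BCP YBCP.
  have := right_xy gA_BC_can gA_can gB_can gC_can PA_compl PB_compl PC_compl
    JAs JA_hom JBs JB_hom JCs JC_hom Js a_wt n_ge1 xiG h k ly YA_BCP YBCP.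
  by rewrite lxP lyP => -[? ? ? ?] [? ? ? ?]; do !split.
- have [_ Js] := J'_basis; have tN := basis_dual Js Jt.
  have xiG : graded gAB_C gA gB gC N d1 d2 d3 xi by split.
  have := left_y gAB_C_can gA_can gB_can gC_can PA_compl PB_compl PC_compl
    JAs JA_hom JBs JB_hom JCs JC_hom Js a_wt n_ge1 xiG h k lx YAB_CP YABP.
  have := left_xy gAB_C_can gA_can gB_can gC_can PA_compl PB_compl PC_compl
    JAs JA_hom JBs JB_hom JCs JC_hom Js a_wt n_ge1 xiG h k ly YAB_CP YABP.
  by rewrite lxP lyP => -[? ? ? ?] [? ? ? ?]; do !split.
Qed.
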